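(* Let $n\ge5$, $p=\frac{n-2}{n-4}$ and $c_n=\frac{(n+2)(n-4)}{4}$. There exists $\varepsilon_n>0$ such that, for every $s\in\mathbb{R}$ with $0<|s|<\varepsilon_n$, the equation $$\Delta^2u=c_n\,u^{p-1}\bigl[-\Delta(u^p)\bigr]\qquad\text{in }\mathbb{R}^n$$ has a positive smooth radial solution $u_s$ satisfying $u_s(0)=1$, $u_s'(0)=0$, $u_s''(0)=-s$. There exists $\ell_s>0$ such that $u_s(r)\to\ell_s$ as $r\to\infty$. Moreover, if $k_s>0$ is defined by $k_s^2=c_n p\,\ell_s^{2(p-1)}$, then there are real constants $A_s,B_s$, not both zero, and a function $L_s$ of $r$ such that, as $r\to\infty$, $$L_s(r)-\ell_s=O(r^{3-n}),$$ $$u_s(r)=L_s(r)+r^{-\frac{n-1}{2}}\{A_s\cos(k_sr)+B_s\sin(k_sr)+o(1)\}.$$ Both $-\Delta u_s$ and $-\Delta(u_s^p)$ change sign infinitely many times (as functions of $r$). In particular, $u_s$ is neither a standard bubble nor weakly superharmonic.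
   Context: $\Delta$ is the Euclidean Laplacian on $\mathbb{R}^n$. A radial function $u$ on $\mathbb{R}^n$ is identified with its profile $u(r)$, $r=|x|$, and primes denote $d/dr$. A standard bubble is a function $U_{\xi,\lambda}(x)=\left(\frac{2\lambda}{\lambda^2+|x-\xi|^2}\right)^{(n-4)/2}$ with $\xi\in\mathbb{R}^n$, $\lambda>0$. A function $u$ is weakly superharmonic if $-\Delta u\ge0$ in $\mathbb{R}^n$. The implied constants in the asymptotics may depend on $s$ and $n$. *)

(* Defs.v *)
From HB Require Import structures.
From mathcomp Require Import all_boot all_order all_algebra.
From mathcomp Require Import all_classical all_reals all_analysis.

Set Implicit Arguments.
Unset Strict Implicit.
Unset Printing Implicit Defensive.

Import Order.TTheory GRing.Theory Num.Theory.
Import numFieldNormedType.Exports.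

Local Open Scope classical_set_scope.
Local Open Scope ring_scope.

Section EuclideanSpace.
Context {R : realType} {n : nat}.
Implicit Types (f u : 'rV[R]_n -> R) (x xi : 'rV[R]_n).

(* The norm [`|x|] that the library puts on ['rV[R]_n] is the max norm. *)
Definition enorm x : R := Num.sqrt (\sum_(i < n) x 0 i ^+ 2).

Definition partial (i : 'I_n) f : 'rV[R]_n -> R := 'D_(delta_mx 0 i) f.

Definition laplacian f : 'rV[R]_n -> R :=
  fun x => \sum_(i < n) partial i (partial i f) x.

(* ['D_v f] is a junk value where the limit does not exist, so the existence
   of the partial derivatives is required separately. *)
Fixpoint Cclass (k : nat) f : Prop :=
  if k is k'.+1 then
    [/\ continuous f,
        forall (i : 'I_n) x, derivable f x (delta_mx 0 i)
      & forall i : 'I_n, Cclass k' (partial i f)]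
  else continuous f.

Definition smooth f : Prop := forall k, Cclass k f.

Definition radial f : Prop := exists g : R -> R, forall x, f x = g (enorm x).

(* The profile is read off along the first coordinate axis. See [radial_profileE].
   Being defined on the whole line, as an
   even function, it has ordinary two-sided derivatives at [r = 0]. *)
Definition profile u : R -> R :=
  fun r => u (r *: \row_(j < n) ((j : nat) == 0%N)%:R).

Lemma radial_profileE u x : (0 < n)%N -> radial u -> u x = profile u (enorm x).
Proof.
move=> n0 [g ug]; rewrite /profile !ug; congr g.
rewrite {2}/enorm (bigD1 (Ordinal n0)) //= big1 => [|j /negPf jn0].
  by rewrite !mxE eqxx mulr1 addr0 sqrtr_sqr ger0_norm // sqrtr_ge0.
by rewrite !mxE -[_ == 0%N]/(j == Ordinal n0) jn0 mulr0 expr0n.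
Qed.

Definition bubble xi (lambda : R) : 'rV[R]_n -> R :=
  fun x => (2 * lambda / (lambda ^+ 2 + enorm (x - xi) ^+ 2))
             `^ ((n%:R - 4) / 2).

Definition standard_bubble u : Prop :=
  exists xi (lambda : R), 0 < lambda /\ u = bubble xi lambda.

Definition weakly_superharmonic u : Prop := forall x, 0 <= - laplacian u x.

End EuclideanSpace.

(* The number of sign changes of [g] on [0, +oo[ is infinite: for every [N]
   there are points [0 <= r 0 < r 1 < ... < r N] at which the values of [g] are
   nonzero and alternate in sign. *)
Definition infinitely_many_sign_changes (R : realType) (g : R -> R) : Prop :=
  forall N : nat, exists r : nat -> R, 0 <= r 0%N /\
    forall i : nat, (i < N)%N -> r i < r i.+1 /\ g (r i) * g (r i.+1) < 0.

Definition pexp (R : realType) (n : nat) : R := (n%:R - 2) / (n%:R - 4).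

Definition cconst (R : realType) (n : nat) : R :=
  (n%:R + 2) * (n%:R - 4) / 4.

(* Main.v *)
Require Import Defs.
From HB Require Import structures.
From mathcomp Require Import all_boot all_order all_algebra.
From mathcomp Require Import all_classical all_reals all_analysis.
From mathcomp Require Import ring lra.

Set Implicit Arguments.
Unset Strict Implicit.
Unset Printing Implicit Defensive.

Import Order.TTheory GRing.Theory Num.Theory.
Import numFieldNormedType.Exports.

Local Open Scope classical_set_scope.
Local Open Scope ring_scope.

(* The equation reads [laplacian w + q(u) w + b(u) |u'|^2 = 0] with
   [w = laplacian u], [q(u) = c p u^(2(p-1))] and [b(u) = c p (p-1) u^(2p-3)], and
   [u = 1] solves it. For a small datum [w(0) = - n s], [w] is close to a multiple
   of the Bessel-type solution of [laplacian w + k^2 w = 0]: in terms of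
   [z = r^((n-1)/2) w] the energy [z'^2 + q z^2] has relative variation
   [O(r^-2)], hence it stays of order [s^2] from above and from below, and
   [z = A cos(k r) + B sin(k r) + O(1/r)] with [(A, B) <> 0]. Integrating
   [(r^(n-1) u')' = r^(n-1) w] after replacing [w] by the equation shows that
   [u' = - w'/q(u) + O(r^(2-n))], which gives both the decay of [u'] and
   [L = u + w/q(u) = l + O(r^(3-n))]. Smoothness at the origin follows because
   [f'(r)/r] is again an even function of the same kind. *)

(** * Derivatives and primitives on the line *)

(** The obstacle is a circularity: bounds on [q(u)] need [u] close to 1 on the whole half-line, this
    needs [u'] integrable, and the decay of [u'] is read off from estimates that already use those
    bounds. It is cut by truncating [u'] at [mu / sqrt (1 + r ^ k)], with [k = n - 1], inside the
    equation; what remains is a Volterra fixed-point problem for [w] that is solvable on the whole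
    line. The truncation turns out to be inactive because of the scaling [mu = M * |s|]: truncated
    terms enter the upper bounds only through [mu <= 1/8] and [mu ^ 2 <= |s|], so the resulting
    bound of [u'] by a multiple of [|s|] has a constant free of [M], and [M] can be taken larger
    than it. For the lower bound of the energy [mu ^ 4] has to be small against [s ^ 2], which holds
    for small [s]. The hypothesis [n >= 5] enters as [k >= 4]: the truncation level is then
    [O(r ^ -2)], which is integrable and matches the rate of variation of the energy. *)

Section Calculus.
Context {R : realType}.
Implicit Types (f g df dg : R -> R) (a b c d x y : R).

Definition der f x d := is_derive x (1 : R) f d.

Lemma derE f x d d' : der f x d -> d = d' -> der f x d'.
Proof. by move=> ? <-. Qed.

Lemma der_ext f g x d : f =1 g -> der f x d -> der g x d.
Proof. by move=> /funext ->. Qed.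

Lemma der_near f g x d : (\near x, f x = g x) -> der f x d -> der g x d.
Proof. exact: near_eq_is_derive. Qed.

Lemma der_cst c x : der (fun _ => c) x 0.
Proof. exact: is_derive_cst. Qed.

Lemma der_id x : der (fun t => t) x 1.
Proof. exact: is_derive_id. Qed.

Lemma derD f g x a b : der f x a -> der g x b -> der (fun t => f t + g t) x (a + b).
Proof. exact: is_deriveD. Qed.

Lemma derN f x a : der f x a -> der (fun t => - f t) x (- a).
Proof. exact: is_deriveN. Qed.

Lemma derB f g x a b : der f x a -> der g x b -> der (fun t => f t - g t) x (a - b).
Proof. exact: is_deriveB. Qed.

Lemma derM f g x a b : der f x a -> der g x b ->
  der (fun t => f t * g t) x (a * g x + f x * b).
Proof.
move=> fa gb; apply: (derE (is_deriveM fa gb : der _ _ _)).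
by rewrite /GRing.scale/= addrC [g x * a]mulrC.
Qed.

Lemma derX f n x a : der f x a ->
  der (fun t => f t ^+ n.+1) x (n.+1%:R * f x ^+ n * a).
Proof.
move=> fa.
have <- : (f ^+ n.+1 : R -> R) = (fun t => f t ^+ n.+1).
  by apply/funext => t; elim: n => [|n IH]; rewrite ?expr1// exprS [in RHS]exprS -IH.
exact: is_deriveX.
Qed.

Lemma derV f x a : f x != 0 -> der f x a ->
  der (fun t => (f t)^-1) x (- a / f x ^+ 2).
Proof.
move=> f0 fa; apply: (derE (is_deriveV f0 fa : der _ _ _)).
by rewrite /GRing.scale/= !mulNr mulrC.
Qed.

Lemma der_comp f g x a b : der f (g x) a -> der g x b ->
  der (fun t => f (g t)) x (a * b).
Proof. by move=> fa gb; have := is_derive1_comp fa gb. Qed.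

Lemma der_powR f e x a : 0 < f x -> der f x a ->
  der (fun t => f t `^ e) x (e * f x `^ (e - 1) * a).
Proof. by move=> f0; apply: (@der_comp (@powR R ^~ e)); exact: is_derive1_powR. Qed.

Lemma der_cont f x a : der f x a -> {for x, continuous f}.
Proof.
move=> fa; apply/differentiable_continuous/derivable1_diffP.
by case: fa.
Qed.

Lemma der_derive1 f x a : der f x a -> derive1 f x = a.
Proof. by move=> [_ <-]; rewrite derive1E. Qed.

Lemma der_mul_id0 g : {for 0, continuous g} -> der (fun t => t * g t) 0 (g 0).
Proof.
move=> g0; apply/is_derive1_caratheodory; exists g; split => //.
by move=> z; rewrite mul0r !subr0 mulrC.
Qed.

(** The derivative bounds are asked on the open interval only, because the derivatives in use
    contain a term in [k / r] and the interval may start at 0. *)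
Lemma der_le f g df dg a b : a <= b ->
  (forall x, a < x < b -> der f x (df x)) ->
  (forall x, a < x < b -> der g x (dg x)) ->
  (forall x, a <= x <= b -> {for x, continuous f}) ->
  (forall x, a <= x <= b -> {for x, continuous g}) ->
  (forall x, a < x < b -> df x <= dg x) ->
  f b - f a <= g b - g a.
Proof.
move=> ab Df Dg cf cg dfg.
have [/eqP ->|nab] := boolP (a == b); first by rewrite !subrr.
have ltab : a < b by rewrite lt_neqAle nab.
have [||c] := @MVT _ (fun t => g t - f t) (fun t => dg t - df t) _ _ ltab.
- by move=> x; rewrite in_itv/= => xab; apply: derB; [exact: Dg|exact: Df].
- apply: continuous_in_subspaceT => x; rewrite inE/= in_itv/= => xab.
  by apply: continuousB; [exact: cg|exact: cf].
- rewrite in_itv/= => cab E.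
  suff : 0 <= g b - f b - (g a - f a) by lra.
  by rewrite E mulr_ge0// subr_ge0// dfg.
Qed.

Lemma der_norm_le f g df dg a b : a <= b ->
  (forall x, a < x < b -> der f x (df x)) ->
  (forall x, a < x < b -> der g x (dg x)) ->
  (forall x, a <= x <= b -> {for x, continuous f}) ->
  (forall x, a <= x <= b -> {for x, continuous g}) ->
  (forall x, a < x < b -> `|df x| <= dg x) ->
  `|f b - f a| <= g b - g a.
Proof.
move=> ab Df Dg cf cg dfg; rewrite ler_norml; apply/andP; split.
  suff : (- f b) - (- f a) <= g b - g a by lra.
  apply: (der_le ab (fun x h => derN (Df x h)) Dg _ cg) => x xab.
    by apply: continuousN; exact: cf.
  by move: (dfg _ xab); rewrite ler_norml => /andP[]; lra.
by apply: (der_le ab Df Dg cf cg) => x xab; move: (dfg _ xab); rewrite ler_norml => /andP[].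
Qed.

Lemma der0_eq f a b : (forall x, der f x 0) -> f a = f b.
Proof. exact: is_derive_0_is_cst. Qed.

Lemma norm_le_at_limit f c x : {for x, continuous f} ->
  (forall y, y != x -> `|f y| <= c) -> `|f x| <= c.
Proof.
move=> fx fc; rewrite leNgt; apply/negP => cf.
have /cvgrPdist_lt /(_ (`|f x| - c)) : f y @[y --> x] --> f x by exact: fx.
rewrite subr_gt0 => /(_ cf) /nbhs_ballP[e /= e0] H.
have := H (x + e / 2); rewrite /ball/= opprD addNKr normrN ger0_norm; last by lra.
have -> : e / 2 < e by lra.
move=> /(_ isT).
have := fc (x + e / 2); rewrite -subr_eq0 addrAC subrr add0r => /(_ _)/wrap[]; first by lra.
move=> H1; have := ler_normD (f x - f (x + e/2)) (f (x + e/2)); rewrite subrK.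
by lra.
Qed.

Lemma eq_at_limit f c x : {for x, continuous f} ->
  (forall y, y != x -> f y = c) -> f x = c.
Proof.
move=> fx fc; apply/eqP; rewrite -subr_eq0 -normr_le0.
apply: (@norm_le_at_limit (fun y => f y - c)) => [|y yx].
  by apply: continuousB => //; exact: cst_continuous.
by rewrite fc// subrr normr0.
Qed.

Section Primitive.
Variable f : R -> R.
Hypothesis cf : continuous f.

Let F (k : nat) x : R := (\int[lebesgue_measure]_(t in `[- k%:R, x]) f t)%R.

Let derF k x : - k%:R < x -> der (F k) x (f x).
Proof.
move=> kx.
have [||//||d e] := @continuous_FTC1_closed _ f (- k%:R) x (x + 1).
- by rewrite ltrDl.
- apply: continuous_compact_integrable; first exact: segment_compact.
  exact: continuous_subspaceT.
- exact: cf.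
- by split; [exact: d|rewrite -derive1E].
Qed.

Let FF k l x : - k%:R < x -> - k%:R < 0 :> R -> (k <= l)%N ->
  F k x - F k 0 = F l x - F l 0.
Proof.
move=> kx k0 kl.
have kl' : - l%:R <= - k%:R :> R by rewrite lerN2 ler_nat.
have D y : - k%:R < y -> der (fun t => F k t - F l t) y 0.
  move=> ky; rewrite -(subrr (f y)); apply: derB; apply: derF => //.
  exact: le_lt_trans ky.
suff H a b : - k%:R < a -> a <= b -> F k a - F l a = F k b - F l b.
  by case: (leP 0 x) => [/(H _ _ k0)|/ltW/(H _ _ kx)]; lra.
move=> ka ab; have [| |c _] := @MVT_segment _ (fun t => F k t - F l t) (fun=> 0) _ _ ab.
- move=> y; rewrite in_itv/= => /andP[ay _]; apply: D; exact: lt_trans ay.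
- apply: continuous_in_subspaceT => y; rewrite inE/= in_itv/= => /andP[ay _].
  apply: der_cont; apply: D; exact: lt_le_trans ay.
by rewrite mul0r; lra.
Qed.

(** An integral with a fixed left endpoint gives a primitive only to the right of that endpoint.
    After subtraction of the value at 0 it no longer depends on the endpoint, so the local
    primitives glue together. *)
Lemma primitive_exists : exists G : R -> R, G 0 = 0 /\ forall x, der G x (f x).
Proof.
pose K x := (Num.trunc `|x|).+1.
have HK x : - (K x)%:R < x.
  have := truncnS_gt `|x|; have := lerNnormlW (lexx `|x|).
  rewrite -/(K x) => h1 h2; lra.
have HK0 x : - (K x)%:R < 0 :> R by rewrite oppr_lt0 ltr0n.
exists (fun x => F (K x) x - F (K x) 0); split; first by rewrite subrr.
(* For [y] near [x] the index [K y] is at most [K x + 1], so one integral serves a whole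
   neighbourhood of [x]. *)
move=> x; apply: (@der_near (fun y => F (K x).+1 y - F (K x).+1 0)); last first.
  rewrite -[f x]subr0; apply: derB; last exact: der_cst.
  apply: derF; apply: le_lt_trans (HK x); rewrite lerN2 ler_nat//.
near=> y.
suff : (K y <= (K x).+1)%N by move=> h; rewrite (FF (HK y) _ h).
rewrite /K ltnS truncn_le_nat; have := truncnS_gt `|x|; rewrite -/(K x) => h.
apply: le_lt_trans (_ : `|y - x| + `|x| < _); first by rewrite -{1}(subrK x y) ler_normD.
rewrite [X in _ < X]mulrS; apply: ltrD => //; rewrite distrC; near: y; exact: nbhsx_ballx.
Unshelve. all: by end_near. Qed.

End Primitive.

(** A choice operator, so that the primitive can be written as a total function of [f] in
    fixed-point equations; the junk value is the zero function. *)
Definition prim f : R -> R :=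
  xget (fun=> 0) [set G | G 0 = 0 /\ forall x, der G x (f x)].

Lemma primP f : continuous f -> prim f 0 = 0 /\ forall x, der (prim f) x (f x).
Proof.
move=> /primitive_exists[G HG].
by have := @xgetPex _ (fun=> 0) [set G | G 0 = 0 /\ forall x, der G x (f x)]; apply; exists G.
Qed.

Lemma prim0 f : continuous f -> prim f 0 = 0.
Proof. by move=> /primP[]. Qed.

Lemma der_prim f x : continuous f -> der (prim f) x (f x).
Proof. by move=> /primP[]. Qed.

Lemma prim_unique f G : continuous f -> G 0 = 0 -> (forall x, der G x (f x)) ->
  prim f = G.
Proof.
move=> cf G0 DG; apply/funext => x.
have := @der0_eq (fun t => prim f t - G t) x 0.
rewrite prim0// G0 subrr => /(_ _)/wrap[]; last by lra.
by move=> y; rewrite -(subrr (f y)); apply: derB => //; exact: der_prim.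
Qed.

End Calculus.

(** * The radial averaging operator *)

Section Averages.
Context {R : realType}.
Implicit Types (f g w : R -> R) (a b c d x y r : R) (k : nat).

(** Radial profiles are extended to even functions on the whole line, which makes the origin an
    interior point and spares one-sided derivatives. *)
Definition evenc f := continuous f /\ forall x, f (- x) = f x.

Lemma cont_cst c : continuous (fun _ : R => c).
Proof. by move=> x; exact: cst_continuous. Qed.

Lemma cont_id : continuous (fun x : R => x).
Proof. by move=> x; exact: cvg_id. Qed.

Lemma contM f g : continuous f -> continuous g -> continuous (fun x => f x * g x).
Proof. by move=> cf cg x; apply: continuousM; [exact: cf|exact: cg]. Qed.

Lemma contD f g : continuous f -> continuous g -> continuous (fun x => f x + g x).
Proof. by move=> cf cg x; apply: continuousD; [exact: cf|exact: cg]. Qed.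

Lemma contB f g : continuous f -> continuous g -> continuous (fun x => f x - g x).
Proof. by move=> cf cg x; apply: continuousB; [exact: cf|exact: cg]. Qed.

Lemma contN f : continuous f -> continuous (fun x => - f x).
Proof. by move=> cf x; apply: continuousN; exact: cf. Qed.

Lemma contX f k : continuous f -> continuous (fun x => f x ^+ k).
Proof.
move=> cf; elim: k => [|k IH]; first exact: cont_cst.
have -> : (fun x => f x ^+ k.+1) = (fun x => f x * f x ^+ k).
  by apply/funext => x; rewrite exprS.
exact: contM.
Qed.

Lemma prim_cont f : continuous f -> continuous (prim f).
Proof. by move=> cf x; apply: der_cont; exact: der_prim. Qed.

Lemma primB f g : continuous f -> continuous g ->
  prim (fun x => f x - g x) = (fun x => prim f x - prim g x).
Proof.
move=> cf cg; apply: prim_unique; first exact: contB.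
  by rewrite !prim0// subrr.
by move=> x; apply: derB; exact: der_prim.
Qed.

Lemma prim_even f : continuous f -> (forall x, f (- x) = - f x) ->
  forall x, prim f (- x) = prim f x.
Proof.
move=> cf of_ x; rewrite [in RHS](@prim_unique _ f (fun y => prim f (- y)))//.
  by rewrite oppr0 prim0.
move=> y; apply: (derE (der_comp (der_prim _ cf) (derN (der_id _)))).
by rewrite of_; ring.
Qed.

Lemma prim_norm_le f g dg r : continuous f -> 0 <= r ->
  (forall x, der g x (dg x)) ->
  (forall x, 0 < x < r -> `|f x| <= dg x) -> `|prim f r| <= g r - g 0.
Proof.
move=> cf r0 Dg fg; rewrite -[prim f r]subr0 -[X in _ - X](prim0 cf).
apply: (@der_norm_le _ _ _ f dg) => //.
- by move=> x _; exact: der_prim.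
- by move=> x _; exact: prim_cont.
- by move=> x _; exact: der_cont.
Qed.

(* [avg k w r = \int_0^1 t ^ k * w (t * r) dt], so that [r * avg k w r] is the
   derivative of the radial solution of [laplacian f = w] in dimension [k.+1]. *)
Definition avg k w r :=
  if r == 0 then w 0 / k.+1%:R else prim (fun t => t ^+ k * w t) r / r ^+ k.+1.

Lemma cont_pow k : continuous (fun x : R => x ^+ k).
Proof. exact: contX cont_id. Qed.

Lemma cont_powM k w : continuous w -> continuous (fun t : R => t ^+ k * w t).
Proof. by move=> cw; apply: contM => //; exact: cont_pow. Qed.

Lemma avgE k w r : continuous w ->
  r ^+ k.+1 * avg k w r = prim (fun t => t ^+ k * w t) r.
Proof.
move=> cw; rewrite /avg; case: eqP => [->|/eqP r0].
  by rewrite expr0n mul0r prim0//; exact: cont_powM.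
by rewrite mulrC divfK// expf_neq0.
Qed.

Lemma der_avg k w r : continuous w ->
  der (fun t => t ^+ k.+1 * avg k w t) r (r ^+ k * w r).
Proof.
move=> cw; apply: (der_ext (fun x => esym (avgE k x cw))).
by apply: der_prim; exact: cont_powM.
Qed.

Lemma avg_le k w c r : continuous w -> 0 <= r ->
  (forall t, 0 <= t <= r -> `|w t| <= c) -> `|avg k w r| <= c / k.+1%:R.
Proof.
move=> cw r0 wc; have k0 : 0 < k.+1%:R :> R by rewrite ltr0n.
rewrite /avg; case: eqP => [e|/eqP nr0].
  rewrite normrM normfV (gtr0_norm k0) ler_pM2r ?invr_gt0// wc//.
  by rewrite lexx.
have rp : 0 < r by rewrite lt_neqAle eq_sym nr0.
rewrite normrM normfV (gtr0_norm (exprn_gt0 _ rp)) ler_pdivrMr ?exprn_gt0//.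
have := @prim_norm_le (fun t => t ^+ k * w t) (fun t => c / k.+1%:R * t ^+ k.+1)
  (fun t => c * t ^+ k) r (@cont_powM k w cw) r0.
rewrite expr0n/= mulr0 subr0; apply => x.
  apply: (derE (derM (der_cst _ _) (derX k (der_id _)))).
  by rewrite mul0r add0r mulr1 mulrA divfK// gt_eqF.
move=> /andP[x0 xr]; rewrite normrM ger0_norm ?exprn_ge0 ?(ltW x0)// mulrC.
by rewrite ler_pM2r ?exprn_gt0// wc// !ltW.
Qed.

Lemma avgB k f g r : continuous f -> continuous g ->
  avg k (fun x => f x - g x) r = avg k f r - avg k g r.
Proof.
move=> cf cg; rewrite /avg; case: eqP => _; first by rewrite mulrBl.
rewrite -mulrBl; congr (_ / _).
have -> : (fun t => t ^+ k * (f t - g t)) = (fun t => t ^+ k * f t - t ^+ k * g t).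
  by apply/funext => t; rewrite mulrBr.
by rewrite primB//; exact: cont_powM.
Qed.

Lemma avg_cst k c r : avg k (fun=> c) r = c / k.+1%:R.
Proof.
rewrite /avg; case: eqP => // /eqP r0.
rewrite (@prim_unique _ _ (fun t => c / k.+1%:R * t ^+ k.+1)).
- by rewrite mulfK// expf_neq0.
- by apply: cont_powM; exact: cont_cst.
- by rewrite expr0n mulr0.
move=> x; apply: (derE (derM (der_cst _ _) (derX k (der_id _)))).
by rewrite mul0r add0r mulr1 mulrA divfK ?pnatr_eq0// mulrC.
Qed.

Lemma avg_even k w r : evenc w -> avg k w (- r) = avg k w r.
Proof.
move=> [cw ew]; rewrite /avg oppr_eq0; case: eqP => // /eqP r0.
have -> : prim (fun t => t ^+ k * w t) (- r) =
          (-1) ^+ k.+1 * prim (fun t => t ^+ k * w t) r.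
  rewrite [in RHS](@prim_unique _ _ (fun x => (-1) ^+ k.+1 * prim (fun t => t ^+ k * w t) (- x))).
  - by rewrite mulrA -expr2 sqrr_sign mul1r.
  - exact: cont_powM.
  - by rewrite oppr0 prim0 ?mulr0//; exact: cont_powM.
  move=> x; apply: (derE (derM (der_cst _ _)
    (der_comp (der_prim _ (@cont_powM k w cw)) (derN (der_id _))))).
  rewrite mul0r add0r ew (exprNn x) exprS.
  transitivity (((-1) ^+ k * (-1) ^+ k) * (x ^+ k * w x)); first ring.
  by rewrite -expr2 sqrr_sign mul1r.
by rewrite (exprNn r) -mulf_div divff ?signr_eq0// mul1r.
Qed.

Lemma avg_cont k w : evenc w -> continuous (avg k w).
Proof.
move=> [cw ew] x; have [->|x0] := eqVneq x 0; last first.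
  apply: (@der_cont _ _ _ _); apply: (@der_near _ (fun r => prim (fun t => t ^+ k * w t) r / r ^+ k.+1)).
    near=> y; rewrite /avg ifF//; apply/negbTE; near: y.
    by apply: open_neq.
  apply: derM; first by apply: der_prim; exact: cont_powM.
  by apply: derV; [rewrite expf_neq0|exact: derX (der_id _)].
have a0 : avg k w 0 = w 0 / k.+1%:R by rewrite /avg eqxx.
apply/cvgrPdist_le => e e0; rewrite a0.
have : w y @[y --> 0] --> w 0 by exact: cw.
move/cvgrPdist_le => /(_ e e0) /nbhs_ballP[d /= d0 H].
apply/nbhs_ballP; exists d => //= y; rewrite /ball/= sub0r normrN => yd.
have -> : avg k w y = avg k w `|y|.
  by case: (leP 0 y) => y0; [rewrite ger0_norm|rewrite ltr0_norm// avg_even].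
(* Subtracting the average of the constant [w 0] leaves the average of [w - w 0] up to [|y|], which
   continuity of [w] at 0 makes small. *)
rewrite -(avg_cst k (w 0) `|y|) -avgB//; last exact: cont_cst.
apply: le_trans (_ : e / k.+1%:R <= _).
  apply: avg_le => //; first by apply: contB => //; exact: cont_cst.
  move=> t /andP[t0 ty]; apply: H; rewrite /ball/= sub0r normrN ger0_norm//.
  exact: le_lt_trans yd.
by rewrite ler_pdivrMr ?ltr0n// ler_peMr ?ler1n// ltW.
Unshelve. all: by end_near. Qed.

Lemma evenc_avg k w : evenc w -> evenc (avg k w).
Proof. by move=> ew; split; [exact: avg_cont|move=> x; exact: avg_even]. Qed.

Lemma cont_idM f : continuous f -> continuous (fun t : R => t * f t).
Proof. by apply: contM; exact: cont_id. Qed.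

Lemma evenc_prim_idM f : evenc f -> evenc (prim (fun t => t * f t)).
Proof.
move=> [cf ef]; split; first by apply: prim_cont; exact: cont_idM.
by move=> x; rewrite prim_even//; [exact: cont_idM|move=> y; rewrite ef mulNr].
Qed.

Lemma der_expR_sq a x : der (fun t => expR (a * t ^+ 2)) x (2 * a * x * expR (a * x ^+ 2)).
Proof.
have h := derM (der_cst a x) (derX 1 (der_id x)).
apply: (derE (@der_comp _ expR _ x _ _ (is_derive_expR _) h)).
by rewrite mul0r; ring.
Qed.

(* The weight [exp (l r^2)] makes the solution operator of the radial Poisson
   equation small of order [1 / l]. *)
Lemma prim_avg_le k f a l r : evenc f -> 0 <= r -> 0 <= a -> 0 < l ->
  (forall t, 0 <= t <= r -> `|f t| <= a * expR (l * t ^+ 2)) ->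
  `|prim (fun t => t * avg k f t) r| <= a / (2 * l) * (expR (l * r ^+ 2) - 1).
Proof.
move=> ef r0 a0 l0 fa.
have := @prim_norm_le (fun t => t * avg k f t)
  (fun t => a / (2 * l) * expR (l * t ^+ 2))
  (fun t => a * t * expR (l * t ^+ 2)) r _ r0.
rewrite expr0n/= mulr0 expR0 mulrBr; apply.
- by apply: cont_idM; exact: avg_cont.
- move=> x; apply: (derE (derM (der_cst _ _) (der_expR_sq _ _))).
  by field; rewrite gt_eqF.
move=> x /andP[x0 xr]; rewrite normrM gtr0_norm// -mulrA mulrCA ler_pM2l//.
apply: le_trans (_ : a * expR (l * x ^+ 2) / k.+1%:R <= _).
  apply: avg_le; [exact: ef.1|exact: ltW|move=> t /andP[t0 tx]].
  apply: le_trans (fa t _) _; first by rewrite t0 (le_trans tx)// ltW.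
  apply: ler_wpM2l => //; rewrite ler_expR ler_pM2l//.
  by rewrite ler_pXn2r// nnegrE// ltW.
by rewrite ler_pdivrMr ?ltr0n// ler_peMr ?ler1n// mulr_ge0// expR_ge0.
Qed.

(** Completeness in the form suited to limits with rates: the intervals need not be ordered, only
    pairwise intersecting, and one point serves all of them. *)
Lemma nested_point (I : Type) (P : I -> Prop) (lo up : I -> R) : (exists i, P i) ->
  (forall i j, P i -> P j -> lo i <= up j) ->
  exists l, forall i, P i -> lo i <= l <= up i.
Proof.
move=> [i0 Pi0] H; pose S := [set lo i | i in [set i | P i]].
have S0 : S !=set0 by exists (lo i0); exists i0.
have ub j : P j -> ubound S (up j) by move=> Pj _ [i Pi <-]; exact: H.
exists (sup S) => i Pi; apply/andP; split.
  by apply: ub_le_sup; [exists (up i0); exact: ub|exists i].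
by apply: ge_sup => //; exact: ub.
Qed.

(** The limit is quantified before [d]: it must not depend on the constant, since the constants of
    the Picard iteration vary with the compact interval. Hence the intervals around [a j] are
    indexed by pairs of [j] and an admissible [d]. *)
Lemma geometric_limit (a : nat -> R) :
  (exists d, forall j, `|a j.+1 - a j| <= d / 2 ^+ j) ->
  exists l, forall d, (forall j, `|a j.+1 - a j| <= d / 2 ^+ j) ->
    forall j, `|a j - l| <= 2 * d / 2 ^+ j.
Proof.
move=> [d0 Hd0].
pose P (i : nat * R) := forall j, `|a j.+1 - a j| <= i.2 / 2 ^+ j.
have S d j : d / 2 ^+ j = 2 * (d / 2 ^+ j.+1).
  by rewrite exprS; field; rewrite expf_neq0.
have lomono (d : R) i j : P (0%N, d) -> (i <= j)%N ->
    a i - 2 * (d / 2 ^+ i) <= a j - 2 * (d / 2 ^+ j) /\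
    a j + 2 * (d / 2 ^+ j) <= a i + 2 * (d / 2 ^+ i).
  move=> Pd /subnK <-; elim: (j - i)%N => [//|m [IH1 IH2]].
  have := Pd (m + i)%N; rewrite ler_norml /= => /andP[].
  have := S d (m + i)%N; rewrite -addSn => ->.
  by move: IH1 IH2; rewrite (S d (m + i)%N) !addSn; split; lra.
have [||l Hl] := @nested_point _ P (fun i => a i.1 - 2 * (i.2 / 2 ^+ i.1))
  (fun i => a i.1 + 2 * (i.2 / 2 ^+ i.1)).
- by exists (0%N, d0).
- move=> [i d] [j e] Pd Pe /=.
  have d_ge0 : 0 <= d by have := le_trans (normr_ge0 _) (Pd 0%N); rewrite /= expr0 divr1.
  have e_ge0 : 0 <= e by have := le_trans (normr_ge0 _) (Pe 0%N); rewrite /= expr0 divr1.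
  have [h1 _] := lomono d i (maxn i j) Pd (leq_maxl _ _).
  have [_ h2] := lomono e j (maxn i j) Pe (leq_maxr _ _).
  have p1 : 0 <= d / 2 ^+ maxn i j by rewrite divr_ge0// exprn_ge0.
  have p2 : 0 <= e / 2 ^+ maxn i j by rewrite divr_ge0// exprn_ge0.
  lra.
exists l => d Hd j; have := Hl (j, d) Hd; rewrite /= ler_norml -mulrA.
by move=> /andP[h1 h2]; apply/andP; split; lra.
Qed.

Lemma geometric_small c e : 0 < e -> exists j : nat, c / 2 ^+ j <= e.
Proof.
move=> e0; exists (Num.trunc (c / e)).+1.
rewrite ler_pdivrMr ?exprn_gt0// mulrC -ler_pdivrMr//.
apply: le_trans (ltW (truncnS_gt _)) _.
by rewrite -natrX ler_nat ltnW// ltn_expl.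
Qed.

Lemma geometric_eq0 c x : (forall j : nat, `|x| <= c / 2 ^+ j) -> x = 0.
Proof.
move=> H; apply/eqP; rewrite -normr_le0; apply/ler_addgt0Pr => e e0.
by have [j hj] := geometric_small c e0; rewrite add0r (le_trans (H j)).
Qed.

Lemma uniform_limit_cont (W : nat -> R -> R) w x :
  (forall e, 0 < e -> exists2 j, {for x, continuous (W j)} &
     \forall y \near x, `|W j y - w y| <= e) ->
  {for x, continuous w}.
Proof.
move=> H; apply/cvgrPdist_le => e e0.
have [|j Wj Hj] := H (e / 3); first by rewrite divr_gt0.
have /cvgrPdist_le /(_ (e / 3)) : W j y @[y --> x] --> W j x by exact: Wj.
rewrite divr_gt0// => /(_ isT) Wj'.
have hx : `|W j x - w x| <= e / 3 by exact: nbhs_singleton Hj.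
near=> y.
have h1 : `|W j y - w y| <= e / 3 by near: y.
have h2 : `|W j x - W j y| <= e / 3 by near: y.
move: hx h1 h2; rewrite !ler_norml => /andP[? ?] /andP[? ?] /andP[? ?].
by apply/andP; split; lra.
Unshelve. all: by end_near. Qed.

End Averages.

(** * Picard iteration *)

Section Picard.
Context {R : realType}.
Variables (k : nat) (c0 C : R) (N : (R -> R) -> R -> R).
Hypothesis C_gt0 : 0 < C.
Hypothesis N_even : forall w, evenc w -> evenc (N w).
Hypothesis N_growth : forall w, evenc w -> forall r, 0 <= r ->
  `|N w r| <= C * (1 + `|w r|).
Hypothesis N_lip : forall M B, 0 <= M -> 0 <= B -> exists2 L, 0 <= L &
  forall w1 w2, evenc w1 -> evenc w2 ->
    (forall t, 0 <= t <= M -> `|w1 t| <= B) ->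
    (forall t, 0 <= t <= M -> `|w2 t| <= B) ->
  forall r a, 0 <= r <= M ->
    (forall t, 0 <= t <= r -> `|w1 t - w2 t| <= a) ->
  `|N w1 r - N w2 r| <= L * a.

Let Phi w r := c0 - prim (fun t => t * avg k (N w) t) r.

Let Phi_even w : evenc w -> evenc (Phi w).
Proof.
move=> /N_even/evenc_avg -/(_ k)/evenc_prim_idM[c e]; split=> [|x].
  by apply: contB => //; exact: cont_cst.
by rewrite /Phi e.
Qed.

Let W j := iter j Phi (fun=> c0).

Let W_even j : evenc (W j).
Proof.
elim: j => [|j IH]; last exact: Phi_even.
by split => //; exact: cont_cst.
Qed.

Let expR_sq_ge1 (l r : R) : 0 <= l -> 1 <= expR (l * r ^+ 2).
Proof. by move=> l0; rewrite -expR0 ler_expR mulr_ge0// sqr_ge0. Qed.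

(** With this value [|c0| + (1 + B) / 2 * (E - 1) <= B * E] for [E >= 1], which is the induction
    step of the bound below. *)
Let B := 2 * `|c0| + 1.

Let W_bound j r : 0 <= r -> `|W j r| <= B * expR (C * r ^+ 2).
Proof.
elim: j r => [|j IH] r r0.
  rewrite -[leLHS]mulr1; apply: ler_pM => //; last exact/expR_sq_ge1/ltW.
  by rewrite /B /=; have := normr_ge0 c0; lra.
have B0 : 0 <= B by rewrite /B; have := normr_ge0 c0; lra.
have h := @prim_avg_le _ k (N (W j)) (C * (1 + B)) C r
  (N_even (W_even j)) r0 _ C_gt0.
apply: le_trans (ler_normB _ _) _.
have {h} := h _ _; set E := expR _ => h.
have E1 : 1 <= E by apply/expR_sq_ge1/ltW.
have : `|prim (fun t => t * avg k (N (W j)) t) r| <= C * (1 + B) / (2 * C) * (E - 1).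
  apply: h; first by rewrite mulr_ge0 ?addr_ge0// ltW.
  move=> t /andP[t0 _]; apply: le_trans (N_growth (W_even j) t0) _.
  rewrite -mulrA ler_pM2l// mulrDl mul1r lerD ?IH// expR_sq_ge1// ltW//.
have -> : C * (1 + B) / (2 * C) = (1 + B) / 2 by field; rewrite gt_eqF.
move=> /(lerD (lexx `|c0|)) /le_trans; apply.
have := normr_ge0 c0; rewrite /B; nra.
Qed.

Let W_step M : 0 <= M -> exists d, forall j r, 0 <= r <= M ->
  `|W j.+1 r - W j r| <= d / 2 ^+ j.
Proof.
move=> M0; pose BM := B * expR (C * M ^+ 2).
have B0 : 0 <= B by rewrite /B; have := normr_ge0 c0; lra.
have WM j t : 0 <= t <= M -> `|W j t| <= BM.
  move=> /andP[t0 tM]; apply: le_trans (W_bound j t0) _; rewrite ler_wpM2l//.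
  by rewrite ler_expR ler_pM2l// ler_pXn2r.
have BM0 : 0 <= BM by rewrite mulr_ge0// expR_ge0.
have [L L0 HL] := N_lip M0 BM0.
(* Any rate [l >= L] makes the contraction factor [L / (2 * l)] at most 1/2; the 1 keeps [l]
   positive when [L = 0]. *)
pose l := L + 1; have l0 : 0 < l by rewrite /l; lra.
have key j r : 0 <= r <= M ->
    `|W j.+1 r - W j r| <= 2 * BM / 2 ^+ j * expR (l * r ^+ 2).
  elim: j r => [|j IH] r /andP[r0 rM].
    rewrite expr0 divr1 -[leLHS]mulr1; apply: ler_pM => //; last first.
      exact/expR_sq_ge1/ltW.
    apply: le_trans (ler_normB _ _) _.
    have h1 := WM 1%N r; have h2 := WM 0%N r.
    by rewrite mulr2n mulrDl mul1r lerD// ?h1 ?h2// r0.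
  have -> : W j.+2 r - W j.+1 r =
      - prim (fun t => t * avg k (fun x => N (W j.+1) x - N (W j) x) t) r.
    have -> : (fun t => t * avg k (fun x => N (W j.+1) x - N (W j) x) t) =
        (fun t => t * avg k (N (W j.+1)) t - t * avg k (N (W j)) t).
      by apply/funext => t; rewrite avgB ?mulrBr//; apply: (N_even _).1.
    rewrite primB; first by rewrite /W /= /Phi; ring.
      by apply: cont_idM; apply: avg_cont; exact: N_even.
    by apply: cont_idM; apply: avg_cont; exact: N_even.
  rewrite normrN; set a := 2 * BM / 2 ^+ j in IH.
  have a0 : 0 <= a by rewrite divr_ge0 ?mulr_ge0// exprn_ge0.
  have aS : 2 * BM / 2 ^+ j.+1 = a / 2 by rewrite /a exprS; field; rewrite expf_neq0.
  rewrite aS.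
  have := @prim_avg_le _ k (fun x => N (W j.+1) x - N (W j) x) (L * a) l r _ r0 _ l0.
  move=> /(_ _ _ _)/wrap[].
  - have [c1 e1] := N_even (W_even j.+1); have [c2 e2] := N_even (W_even j).
    by split; [exact: contB|move=> x; rewrite e1 e2].
  - exact: mulr_ge0.
  - move=> t /andP[t0 tr]; rewrite -mulrA.
    have tM : 0 <= t <= M by rewrite t0 (le_trans tr).
    apply: (HL _ _ (W_even _) (W_even _) (WM _) (WM _) _ _ tM).
    move=> x /andP[x0 xt]; apply: le_trans (IH x _) _.
      by rewrite x0 (le_trans xt)// (le_trans tr).
    by rewrite ler_wpM2l// ler_expR ler_pM2l// ler_pXn2r.
  move=> /le_trans; apply.
  have E1 : 1 <= expR (l * r ^+ 2) by apply/expR_sq_ge1/ltW.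
  apply: le_trans (_ : L * a / (2 * l) * expR (l * r ^+ 2) <= _).
    apply: ler_wpM2l; last by lra.
    by rewrite divr_ge0// mulr_ge0// ltW.
  rewrite ler_wpM2r ?expR_ge0//.
  have -> : L * a / (2 * l) = (L / l) * (a / 2) by field; rewrite gt_eqF.
  rewrite -[leRHS]mul1r ler_wpM2r//; first by rewrite divr_ge0.
  by rewrite ler_pdivrMr// mul1r /l; lra.
exists (2 * BM * expR (l * M ^+ 2)) => j r /andP[r0 rM].
apply: le_trans (key j r _) _; first by rewrite r0.
rewrite mulrAC ler_wpM2r// ?invr_ge0 ?exprn_ge0//.
rewrite ler_wpM2l// ?mulr_ge0// ler_expR ler_pM2l// ler_pXn2r//.
Qed.

(** The Lipschitz condition is causal, the value at [r] seeing only [[0, r]], so the iteration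
    converges on every bounded interval however large [L] is. The growth condition bounds the
    iterates there before a Lipschitz constant has to be chosen. *)
Lemma picard : exists2 w, evenc w &
  forall r, w r = c0 - prim (fun t => t * avg k (N w) t) r.
Proof.
have W_step' M j x : 0 <= M -> `|x| <= M -> forall d, (forall j r, 0 <= r <= M ->
    `|W j.+1 r - W j r| <= d / 2 ^+ j) -> `|W j.+1 x - W j x| <= d / 2 ^+ j.
  move=> M0 xM d Hd; have e i : W i x = W i `|x|.
    by case: (leP 0 x) => x0; [rewrite ger0_norm|rewrite ltr0_norm// (W_even i).2].
  by rewrite !e Hd// normr_ge0.
have : forall x, exists l, forall d, (forall j, `|W j.+1 x - W j x| <= d / 2 ^+ j) ->
    forall j, `|W j x - l| <= 2 * d / 2 ^+ j.
  move=> x; apply: geometric_limit.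
  have [d Hd] := W_step (normr_ge0 x); exists d => j.
  exact: (W_step' `|x|).
move=> /boolp.choice[w Hw].
have Wlim M : 0 <= M -> exists2 d, 0 <= d & forall j x, `|x| <= M ->
    `|W j x - w x| <= 2 * d / 2 ^+ j.
  move=> M0; have [d Hd] := W_step M0; exists d.
    have := Hd 0%N 0; rewrite lexx M0 => /(_ isT); rewrite expr0 divr1.
    exact: le_trans.
  by move=> j x xM; apply: Hw => i; exact: (W_step' M).
have ew : evenc w.
  split=> x.
    apply: (@uniform_limit_cont _ W) => e e0.
    have [|d _ Hd] := Wlim (`|x| + 1); first by rewrite addr_ge0.
    have [j hj] := geometric_small (2 * d) e0; exists j; first exact: (W_even j).1.
    near=> y; apply: le_trans (Hd _ _ _) hj.
    apply: le_trans (_ : `|y - x| + `|x| <= _); first by rewrite -{1}(subrK x y) ler_normD.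
    rewrite addrC lerD2l distrC; apply: ltW; near: y; exact: nbhsx_ballx.
  have [d _ Hd] := Wlim _ (normr_ge0 x).
  apply/eqP; rewrite -subr_eq0; apply/eqP; apply: (@geometric_eq0 _ (4 * d)) => j.
  have h1 := Hd j x (lexx _); have := Hd j (- x); rewrite normrN (W_even j).2 => /(_ (lexx _)) h2.
  have -> : w (- x) - w x = (W j x - w x) - (W j x - w (- x)) by ring.
  apply: le_trans (ler_normB _ _) _; have -> : 4 * d / 2 ^+ j = 2 * d / 2 ^+ j + 2 * d / 2 ^+ j.
    by ring.
  by rewrite lerD.
exists w => //.
suff pos r : 0 <= r -> w r = Phi w r.
  move=> r; case: (leP 0 r) => r0; first exact: pos.
  by rewrite -ew.2 -[RHS](Phi_even ew).2; apply: pos; rewrite oppr_ge0 ltW.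
move=> r0; apply/eqP; rewrite -subr_eq0; apply/eqP.
have [d d0 Hd] := Wlim _ r0.
pose BM := B * expR (C * r ^+ 2) + 2 * d.
have B0 : 0 <= B by rewrite /B; have := normr_ge0 c0; lra.
have WM j t : 0 <= t <= r -> `|W j t| <= B * expR (C * r ^+ 2).
  move=> /andP[t0 tM]; apply: le_trans (W_bound j t0) _; rewrite ler_wpM2l//.
  by rewrite ler_expR ler_pM2l// ler_pXn2r.
have BM0 : 0 <= BM by rewrite addr_ge0 ?mulr_ge0// expR_ge0.
have [L L0 HL] := N_lip r0 BM0.
pose K := L * (2 * d) / (2 * 1) * (expR (1 * r ^+ 2) - 1).
apply: (@geometric_eq0 _ (2 * d + K)) => j.
have h1 : `|W j.+1 r - w r| <= 2 * d / 2 ^+ j.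
  apply: le_trans (Hd _ _ _) _; first by rewrite ger0_norm.
  apply: ler_wpM2l; first by rewrite mulr_ge0.
  by rewrite lef_pV2 ?posrE ?exprn_gt0// ler_eXn2l// ltr1n.
suff h2 : `|W j.+1 r - Phi w r| <= K / 2 ^+ j.
  have -> : w r - Phi w r = (W j.+1 r - Phi w r) - (W j.+1 r - w r) by ring.
  by apply: le_trans (ler_normB _ _) _; rewrite mulrDl addrC lerD.
have -> : W j.+1 r - Phi w r =
    - prim (fun t => t * avg k (fun x => N (W j) x - N w x) t) r.
  have -> : (fun t => t * avg k (fun x => N (W j) x - N w x) t) =
      (fun t => t * avg k (N (W j)) t - t * avg k (N w) t).
    by apply/funext => t; rewrite avgB ?mulrBr//; apply: (N_even _).1.
  rewrite primB; first by rewrite /W /= /Phi; ring.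
    by apply: cont_idM; apply: avg_cont; exact: N_even.
  by apply: cont_idM; apply: avg_cont; exact: N_even.
rewrite normrN.
have := @prim_avg_le _ k (fun x => N (W j) x - N w x) (L * (2 * d / 2 ^+ j)) 1 r _ r0 _ ltr01.
move=> /(_ _ _ _)/wrap[].
- have [c1 e1] := N_even (W_even j); have [c2 e2] := N_even ew.
  by split; [exact: contB|move=> x; rewrite e1 e2].
- by rewrite mulr_ge0// divr_ge0 ?mulr_ge0// exprn_ge0.
- move=> t /andP[t0 tr].
  apply: le_trans (_ : L * (2 * d / 2 ^+ j) <= _); last first.
    rewrite ler_peMr ?expR_sq_ge1// mulr_ge0// divr_ge0 ?mulr_ge0// exprn_ge0//.
  apply: (HL _ _ (W_even _) ew) => [x xr|x /andP[x0 xr]||x /andP[x0 xt]].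
  - by apply: le_trans (WM _ _ xr) _; rewrite lerDl mulr_ge0.
  - have -> : w x = W 0%N x - (W 0%N x - w x) by ring.
    apply: le_trans (ler_normB _ _) _; apply: lerD; first by rewrite WM// x0.
    by have := Hd 0%N x; rewrite expr0 divr1; apply; rewrite ger0_norm.
  - by rewrite t0.
  - by apply: Hd; rewrite ger0_norm// (le_trans xt).
move=> /le_trans; apply; rewrite /K le_eqVlt; apply/orP; left; apply/eqP.
by field; rewrite expf_neq0.
Unshelve. all: by end_near. Qed.

End Picard.

(** * The clamped radial system *)

Section Clamp.
Context {R : realType}.
Implicit Types (a x y : R).

Definition clamp a x := Num.max (- a) (Num.min a x).

Lemma clamp_norm_le a x : 0 <= a -> `|clamp a x| <= a.
Proof.
move=> a0; rewrite /clamp ler_norml le_max lexx /= ge_max ge_min lexx /= andbT.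
by lra.
Qed.

Lemma clamp_id a x : `|x| <= a -> clamp a x = x.
Proof.
rewrite ler_norml /clamp => /andP[h1 h2].
by rewrite (min_idPr h2) (max_idPr h1).
Qed.

Lemma clamp_cases a x : 0 <= a ->
  [\/ x <= - a /\ clamp a x = - a, - a <= x <= a /\ clamp a x = x
    | a <= x /\ clamp a x = a].
Proof.
move=> a0; rewrite /clamp; case: (leP a x) => h1.
  by constructor 3; rewrite max_r//; lra.
case: (leP x (- a)) => h2; first by constructor 1.
by constructor 2; split => //; lra.
Qed.

Lemma clampN a x : 0 <= a -> clamp a (- x) = - clamp a x.
Proof.
by move=> a0; case: (clamp_cases x a0) => -[? ->]; case: (clamp_cases (- x) a0) => -[? ->]; lra.
Qed.

Lemma clamp_lip a x y : 0 <= a -> `|clamp a x - clamp a y| <= `|x - y|.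
Proof.
move=> a0; case: (clamp_cases x a0) => -[? ->]; case: (clamp_cases y a0) => -[? ->];
  have := ler_norm (x - y); have := ler_norm (- (x - y));
  rewrite normrN ler_norml; lra.
Qed.

Lemma clamp_cont (f g : R -> R) : continuous f -> continuous g ->
  continuous (fun x => clamp (f x) (g x)).
Proof.
move=> cf cg x; apply: (@continuous_max R R (fun x => - f x)).
  by apply: continuousN; exact: cf.
by apply: (@continuous_min R R); [exact: cf|exact: cg].
Qed.

End Clamp.

Section NearOne.
Context {R : realType}.

(** The lower end keeps the base of the real powers away from 0, whence uniform bounds for [q], [b]
    and their derivatives. *)
Definition unear (u : R) := 1/2 <= u <= 3/2.

Lemma unear_lip (f df : R -> R) (K : R) : (forall u, unear u -> der f u (df u)) ->
  (forall u, unear u -> `|df u| <= K) ->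
  forall x y, unear x -> unear y -> `|f x - f y| <= K * `|x - y|.
Proof.
move=> Df dfK; have H x y : unear x -> unear y -> y <= x -> `|f x - f y| <= K * `|x - y|.
  move=> /andP[x1 x2] /andP[y1 y2] yx; rewrite [X in K * X]ger0_norm ?subr_ge0// mulrBr.
  have un z : y <= z <= x -> unear z by move=> /andP[? ?]; apply/andP; split; lra.
  apply: (@der_norm_le _ f (fun t => K * t) df (fun=> K)) => // z zI.
  - by apply: Df; apply: un; lra.
  - by apply: (derE (derM (der_cst _ _) (der_id _))); ring.
  - by apply: (der_cont (Df _ (un _ _))).
  - by apply: contM; [exact: cont_cst|exact: cont_id].
  - by apply: dfK; apply: un; lra.
move=> x y ux uy; case: (leP y x) => yx; first exact: H.
by rewrite distrC [X in K * X]distrC H// ltW.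
Qed.

End NearOne.

Section ClampedSystem.
Context {R : realType}.
Implicit Types (w : R -> R) (r t x : R).
Variables (k : nat) (q dq b db : R -> R) (q0 K mu : R).
Hypothesis k4 : (4 <= k)%N.
Hypothesis q0_gt0 : 0 < q0.
Hypothesis K_ge1 : 1 <= K.
Hypothesis q_bd : forall u, unear u -> q0 <= q u <= K.
Hypothesis b_bd : forall u, unear u -> `|b u| <= K.
Hypothesis q_der : forall u, unear u -> der q u (dq u).
Hypothesis b_der : forall u, unear u -> der b u (db u).
Hypothesis dq_bd : forall u, unear u -> `|dq u| <= K.
Hypothesis db_bd : forall u, unear u -> `|db u| <= K.
Hypothesis mu_ge0 : 0 <= mu.
Hypothesis mu_le : mu <= 1/8.

Let q_lip := unear_lip q_der dq_bd.
Let b_lip := unear_lip b_der db_bd.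

(** [r ^ (- k / 2)] is the decay of the oscillating part of [u']. The shape makes
    [(1 + r ^ k) * rho ^ 2] constant, and the absolute value keeps [rho] even for odd [k]. *)
Definition rho r := mu / Num.sqrt (1 + `|r| ^+ k).

Let rho_den r : 1 <= Num.sqrt (1 + `|r| ^+ k).
Proof. by rewrite -{1}sqrtr1 ler_sqrt; rewrite ?lerDl ?addr_ge0 ?exprn_ge0. Qed.

Lemma rho_ge0 r : 0 <= rho r.
Proof. by rewrite divr_ge0// sqrtr_ge0. Qed.

Lemma rho_even r : rho (- r) = rho r.
Proof. by rewrite /rho normrN. Qed.

Lemma rho_cont : continuous rho.
Proof.
apply: contM; first exact: cont_cst.
move=> x; apply: (@continuousV R R (fun x : R => Num.sqrt (1 + `|x| ^+ k))).
  by rewrite gt_eqF// (lt_le_trans ltr01).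
apply: (@continuous_comp _ _ _ (fun x : R => 1 + `|x| ^+ k) Num.sqrt); last exact: sqrt_continuous.
have : continuous (fun x : R => 1 + `|x| ^+ k); last by apply.
apply: contD; first exact: cont_cst.
by apply: contX; exact: norm_continuous.
Qed.

Lemma rho_le_mu r : rho r <= mu.
Proof. by rewrite ler_pdivrMr ?(lt_le_trans ltr01)// ler_peMr. Qed.

Lemma rho_sq r : (1 + `|r| ^+ k) * rho r ^+ 2 = mu ^+ 2.
Proof.
have h : 0 <= 1 + `|r| ^+ k by rewrite addr_ge0// exprn_ge0.
rewrite /rho expr_div_n sqr_sqrtr// mulrC divfK// gt_eqF//.
Qed.

(** Here [k >= 4] enters: [(1 + r) ^ 2 / 4] is at most 1 up to [r = 1] and at most [r ^ 2] beyond.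
    The integral of the bound over the half-line is [4 * mu <= 1/2], which keeps [uclamp] within
    [unear]. *)
Lemma rho_le_sq r : 0 <= r -> rho r <= 4 * mu / (1 + r) ^+ 2.
Proof.
move=> r0; have r1 : 0 < (1 + r) ^+ 2 by rewrite exprn_gt0//; lra.
have -> : 4 * mu / (1 + r) ^+ 2 = mu * (4 / (1 + r) ^+ 2) by rewrite mulrA [mu * 4]mulrC.
rewrite /rho; have -> : 4 / (1 + r) ^+ 2 = ((1 + r) ^+ 2 / 4)^-1 by rewrite invf_div.
have A1 : 0 < (1 + r) ^+ 2 / 4 by rewrite divr_gt0.
have A0 := ltW A1; have S0 := lt_le_trans ltr01 (rho_den r).
rewrite ler_wpM2l// lef_pV2//.
rewrite -[leLHS](ger0_norm A0) -sqrtr_sqr ler_sqrt ?addr_ge0 ?exprn_ge0//.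
rewrite (ger0_norm r0); case: (leP r 1) => h.
  apply: le_trans (_ : 1 <= _); last by rewrite lerDl exprn_ge0.
  by rewrite expr_le1// ?divr_ge0// ?(ltW r1)//; nra.
apply: le_trans (_ : r ^+ 4 <= _).
  by rewrite (exprM r 2 2) ler_pXn2r// ?nnegrE ?divr_ge0 ?sqr_ge0//; nra.
by apply: le_trans (_ : r ^+ k <= _); [rewrite ler_weXn2l// ltW|rewrite lerDr].
Qed.

(* Clamping the velocity at the decay rate that is to be proved makes all a priori
   estimates unconditional; they then show that the clamp is inactive. *)
Definition vclamp w r := clamp (rho r) (r * avg k w r).
Definition uclamp w r := 1 + prim (vclamp w) r.
Definition rhs w r := q (uclamp w r) * w r + b (uclamp w r) * vclamp w r ^+ 2.

Lemma vclamp_cont w : evenc w -> continuous (vclamp w).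
Proof.
move=> ew; apply: clamp_cont; first exact: rho_cont.
by apply: cont_idM; exact: avg_cont.
Qed.

Lemma vclampN w r : evenc w -> vclamp w (- r) = - vclamp w r.
Proof.
by move=> ew; rewrite /vclamp rho_even avg_even// mulNr clampN// rho_ge0.
Qed.

Lemma der_uclamp w r : evenc w -> der (uclamp w) r (vclamp w r).
Proof.
move=> ew; rewrite -[vclamp w r]add0r; apply: derD; first exact: der_cst.
by apply: der_prim; exact: vclamp_cont.
Qed.

Lemma evenc_uclamp w : evenc w -> evenc (uclamp w).
Proof.
move=> ew; split=> x; first exact: der_cont (der_uclamp _ ew).
by rewrite /uclamp prim_even//; [exact: vclamp_cont|move=> y; exact: vclampN].
Qed.

Lemma vclamp_norm_le w r : `|vclamp w r| <= rho r.
Proof. by rewrite clamp_norm_le// rho_ge0. Qed.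

Lemma uclamp_near w r : evenc w -> unear (uclamp w r).
Proof.
move=> ew; suff H x : 0 <= x -> `|uclamp w x - 1| <= 4 * mu.
  have -> : uclamp w r = uclamp w `|r|.
    case: (leP 0 r) => r0; [by rewrite ger0_norm|rewrite ltr0_norm//].
    by rewrite (evenc_uclamp ew).2.
  by have := H _ (normr_ge0 r); have := mu_le; rewrite /unear ler_norml; lra.
move=> x0; rewrite /uclamp addrAC subrr add0r.
have D t : t \in `[0, x] -> der (fun t => - (4 * mu / (1 + t))) t (4 * mu / (1 + t) ^+ 2).
  rewrite in_itv/= => /andP[t0 _]; have t1 : 1 + t != 0 by rewrite gt_eqF//; lra.
  apply: (derE (derN (derM (der_cst _ _) (derV t1 (derD (der_cst _ _) (der_id _)))))).
  by field.
have := @der_norm_le _ (prim (vclamp w)) (fun t => - (4 * mu / (1 + t))) (vclamp w)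
  (fun t => 4 * mu / (1 + t) ^+ 2) 0 x x0.
rewrite prim0; last exact: vclamp_cont.
rewrite subr0 => H; apply: le_trans (H _ _ _ _ _) _.
- by move=> t _; apply: der_prim; exact: vclamp_cont.
- by move=> t /andP[t0 tx]; apply: D; rewrite in_itv/= !ltW.
- by move=> t _; apply: prim_cont; exact: vclamp_cont.
- by move=> t tI; apply: (der_cont (D _ _)); rewrite in_itv.
- move=> t /andP[t0 tx]; apply: le_trans (vclamp_norm_le _ _) _.
  by apply: rho_le_sq; exact: ltW.
rewrite addr0 divr1 opprK addrC lerBlDr lerDl divr_ge0 ?mulr_ge0//; lra.
Qed.

Let cont_unear (f df : R -> R) w : (forall u, unear u -> der f u (df u)) -> evenc w ->
  continuous (fun r => f (uclamp w r)).
Proof.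
move=> Df ew x; apply: (@der_cont _ _ _ (df (uclamp w x) * vclamp w x)).
by apply: der_comp; [exact/Df/uclamp_near|exact: der_uclamp].
Qed.

Lemma evenc_rhs w : evenc w -> evenc (rhs w).
Proof.
move=> ew; split.
  apply: contD; apply: contM.
  - exact: (cont_unear q_der).
  - exact: ew.1.
  - exact: (cont_unear b_der).
  - by apply: contX; exact: vclamp_cont.
by move=> x; rewrite /rhs vclampN// (evenc_uclamp ew).2 ew.2 sqrrN.
Qed.

Let vclamp_le1 w r : `|vclamp w r| <= 1.
Proof.
by apply: le_trans (vclamp_norm_le _ _) _; apply: le_trans (rho_le_mu _) _; have := mu_le; lra.
Qed.

Lemma rhs_growth w : evenc w -> forall r, 0 <= r -> `|rhs w r| <= K * (1 + `|w r|).
Proof.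
move=> ew r _; apply: le_trans (ler_normD _ _) _; rewrite !normrM mulrDr mulr1 addrC.
have un := uclamp_near r ew; apply: lerD.
  rewrite -[leRHS]mulr1; apply: ler_pM => //; first exact: b_bd.
  by rewrite -[leRHS]mulr1; apply: ler_pM.
apply: ler_wpM2r => //; have /andP[h1 h2] := q_bd un.
by rewrite ger0_norm// (le_trans _ h1)// ltW.
Qed.

Lemma rhs_lip M B : 0 <= M -> 0 <= B -> exists2 L, 0 <= L &
  forall w1 w2, evenc w1 -> evenc w2 ->
    (forall t, 0 <= t <= M -> `|w1 t| <= B) ->
    (forall t, 0 <= t <= M -> `|w2 t| <= B) ->
  forall r a, 0 <= r <= M ->
    (forall t, 0 <= t <= r -> `|w1 t - w2 t| <= a) ->
  `|rhs w1 r - rhs w2 r| <= L * a.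
Proof.
move=> M0 B0; have K0 : 0 <= K by have := K_ge1; lra.
(* One summand for each term of the telescoped difference below: on [[0, M]] an error [a] in [w]
   costs at most [M * a] in the velocity and [M ^ 2 * a] in [uclamp]. *)
exists (K + K * (M * M) * B + K * (M * M) + K * (2 * M)).
  by rewrite !addr_ge0 ?mulr_ge0.
move=> w1 w2 e1 e2 w1B w2B r a /andP[r0 rM] Ha.
have a0 : 0 <= a by apply: le_trans (normr_ge0 _) (Ha 0 _); rewrite lexx r0.
have dv t : 0 <= t <= r -> `|vclamp w1 t - vclamp w2 t| <= M * a.
  move=> /andP[t0 tr]; apply: le_trans (clamp_lip _ _ (rho_ge0 _)) _.
  rewrite -mulrBr normrM ger0_norm//; apply: ler_pM => //; first exact: le_trans rM.
  rewrite -avgB; [|exact: e1.1|exact: e2.1].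
  apply: le_trans (_ : a / k.+1%:R <= _).
    apply: avg_le => //; first by apply: contB; [exact: e1.1|exact: e2.1].
    by move=> x /andP[x0 xt]; apply: Ha; rewrite x0 (le_trans xt).
  by rewrite ler_pdivrMr ?ltr0n// ler_peMr// ler1n.
have du : `|uclamp w1 r - uclamp w2 r| <= M * M * a.
  have -> : uclamp w1 r - uclamp w2 r = prim (fun t => vclamp w1 t - vclamp w2 t) r.
    rewrite primB; [rewrite /uclamp; ring|exact: vclamp_cont|exact: vclamp_cont].
  have := @prim_norm_le _ (fun t => vclamp w1 t - vclamp w2 t) (fun t => M * a * t)
    (fun=> M * a) r.
  move=> /(_ _ r0 _ _)/wrap[].
  - by apply: contB; exact: vclamp_cont.
  - by move=> x; apply: (derE (derM (der_cst _ _) (der_id _))); ring.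
  - by move=> x /andP[x0 xr]; apply: dv; rewrite !ltW.
  rewrite mulr0 subr0 => /le_trans; apply.
  by rewrite mulrAC ler_wpM2r// ler_wpM2l.
have rr : 0 <= r <= r by rewrite r0 lexx.
have u1 := uclamp_near r e1; have u2 := uclamp_near r e2.
have dqu := le_trans (q_lip u1 u2) (ler_wpM2l K0 du).
have dbu := le_trans (b_lip u1 u2) (ler_wpM2l K0 du).
have -> : rhs w1 r - rhs w2 r =
  q (uclamp w1 r) * (w1 r - w2 r) + (q (uclamp w1 r) - q (uclamp w2 r)) * w2 r +
  (b (uclamp w1 r) - b (uclamp w2 r)) * vclamp w1 r ^+ 2 +
  b (uclamp w2 r) * ((vclamp w1 r - vclamp w2 r) * (vclamp w1 r + vclamp w2 r)).
  by rewrite /rhs; ring.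
rewrite [leRHS](_ : _ = K * a + K * (M * M) * B * a + K * (M * M) * a + K * (2 * M) * a); last ring.
apply: le_trans (ler_normD _ _) _; apply: lerD.
  apply: le_trans (ler_normD _ _) _; apply: lerD.
    apply: le_trans (ler_normD _ _) _; apply: lerD; rewrite normrM.
      apply: ler_pM => //; last exact: Ha.
      by have /andP[h1 h2] := q_bd u1; rewrite ger0_norm// (le_trans _ h1)// ltW.
    have -> : K * (M * M) * B * a = K * (M * M * a) * B by ring.
    by apply: ler_pM => //; apply: w2B; rewrite r0.
  rewrite normrM -[leRHS]mulr1; apply: ler_pM => //; last by rewrite normrX expr_le1.
  by rewrite -mulrA.
rewrite normrM -mulrA; apply: ler_pM => //; first exact: b_bd.
rewrite normrM -[2 * M * a]mulrA [2 * _]mulrC; apply: ler_pM => //; first exact: dv.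
by apply: le_trans (ler_normD _ _) _; have := vclamp_le1 w1 r; have := vclamp_le1 w2 r; lra.
Qed.

Lemma clamped_solution (c0 : R) : exists2 w, evenc w &
  forall r, w r = c0 - prim (fun t => t * avg k (rhs w) t) r.
Proof.
apply: (@picard _ k c0 K) => //.
- exact: lt_le_trans K_ge1.
- exact: evenc_rhs.
- exact: rhs_growth.
- exact: rhs_lip.
Qed.

End ClampedSystem.

(** * A priori estimates *)

Ltac nonneg := repeat first [ done | exact: sqr_ge0 | exact: expR_ge0 | exact: ltW
  | apply: addr_ge0 | apply: exprn_ge0 | apply: mulr_ge0 | rewrite invr_ge0 ].

(** * Gronwall inequalities *)

Section Gronwall.
Context {R : realType}.
Implicit Types (a b r x : R).

(** [G * exp (- H)] is nonincreasing. The exponent is kept as a primitive [H] because two rates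
    occur: a constant near the origin and [O(r ^ -2)] outside. *)
Lemma gronwall (G dG H dH : R -> R) a b : a <= b ->
  (forall x, a < x < b -> der G x (dG x)) ->
  (forall x, a < x < b -> der H x (dH x)) ->
  (forall x, a <= x <= b -> {for x, continuous G}) ->
  (forall x, a <= x <= b -> {for x, continuous H}) ->
  (forall x, a < x < b -> dG x <= dH x * G x) ->
  G b <= expR (H b - H a) * G a.
Proof.
move=> ab DG DH cG cH dGH.
have DE x : a < x < b -> der (fun t => G t * expR (- H t)) x
    ((dG x - dH x * G x) * expR (- H x)).
  move=> xab; apply: (derE (derM (DG _ xab)
    (@der_comp _ expR _ _ _ _ (is_derive_expR _) (derN (DH _ xab))))).
  by ring.
have := @der_le _ _ (fun=> 0) _ (fun=> 0) a b ab DE.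
move=> /(_ _ _ _ _)/wrap[].
- by move=> x _; exact: der_cst.
- move=> x xab; apply: continuousM; first exact: cG.
  apply: (@continuous_comp _ _ _ (fun x => - H x) expR); last exact: continuous_expR.
  by apply: continuousN; exact: cH.
- by move=> x _; exact: cst_continuous.
- by move=> x xab; rewrite mulr_le0_ge0 ?expR_ge0// subr_le0 dGH.
rewrite subrr subr_le0 => /(ler_wpM2r (expR_ge0 (H b))).
by rewrite -mulrA -expRD addNr expR0 mulr1 -mulrA -expRD mulrC [- _ + _]addrC.
Qed.

Lemma gronwall_lower (G dG H dH : R -> R) a b : a <= b ->
  (forall x, a < x < b -> der G x (dG x)) ->
  (forall x, a < x < b -> der H x (dH x)) ->
  (forall x, a <= x <= b -> {for x, continuous G}) ->
  (forall x, a <= x <= b -> {for x, continuous H}) ->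
  (forall x, a < x < b -> - (dH x * G x) <= dG x) ->
  expR (- (H b - H a)) * G a <= G b.
Proof.
move=> ab DG DH cG cH dGH.
have := @gronwall (fun x => - G x) (fun x => - dG x) (fun x => - H x) (fun x => - dH x) a b ab.
move=> /(_ _ _ _ _ _)/wrap[].
- by move=> x xab; apply: derN; exact: DG.
- by move=> x xab; apply: derN; exact: DH.
- by move=> x xab; apply: continuousN; exact: cG.
- by move=> x xab; apply: continuousN; exact: cH.
- by move=> x /dGH; lra.
by rewrite opprK mulrN lerN2 opprD opprK.
Qed.

Lemma norm_mul2_le (x y : R) : `|2 * x * y| <= x ^+ 2 + y ^+ 2.
Proof.
have := sqr_ge0 (x - y); have := sqr_ge0 (x + y); rewrite sqrrD sqrrB ler_norml.
by move=> h1 h2; apply/andP; split; lra.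
Qed.

Lemma der_pow k r : r != 0 -> der (fun t => t ^+ k) r (k%:R * (r ^+ k / r)).
Proof.
move=> r0; case: k => [|k]; first by rewrite mul0r; exact: der_cst.
apply: (derE (derX k (der_id r))).
by rewrite mulr1 exprS; field.
Qed.

(** Passes from the derivative of a flux [t ^ k * h] to that of [h], which produces the friction
    term [- k / r * h]. *)
Lemma der_div_pow k (h : R -> R) r e : r != 0 ->
  der (fun t => t ^+ k * h t) r (r ^+ k * e) -> der h r (e - k%:R / r * h r).
Proof.
move=> r0 D; have p0 : r ^+ k != 0 by rewrite expf_neq0.
apply: (@der_near _ (fun t => (t ^+ k * h t) / t ^+ k)).
  near=> t; rewrite mulrAC mulfV ?mul1r// expf_neq0//.
  by near: t; apply: open_neq.
apply: (derE (derM D (@derV _ (fun t => t ^+ k) r _ p0 (der_pow k r0)))).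
by field; rewrite p0 r0.
Unshelve. all: by end_near. Qed.

End Gronwall.

Section Constants.
Context {R : realType}.
Variables (k : nat) (q0 K : R).
Let m : R := k%:R / 2.

(* [C_inner], [C_outer]: Gronwall rates on [0 <= r <= 1] and for [r >= 1];
   [A_inner], [A_outer], [A_der], [A_flux], [A_vel]: the resulting bounds, in
   units of [sigma = `|s|] or its square; [A_low]: lower bound of the energy. *)
Definition C_inner := 2 + K + K ^+ 2.
Definition A_inner := expR C_inner * (k.+1%:R ^+ 2 + 1).
Definition C_outer := m ^+ 2 * (1 + q0^-1) + 1 + K ^+ 2 + K / q0.
Definition A_outer := expR C_outer * (2 * A_inner + 2 * m ^+ 2 * A_inner + K * A_inner + 1).
Definition A_der := (2 + 2 * m ^+ 2 / q0) * A_outer.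
Definition A_flux := K / q0 + K / (2 * q0 ^+ 2) * (A_der + 1) + (1 + A_inner) * (1 + q0^-1).
Definition A_vel := 2 * A_der / q0 ^+ 2 + 2 * A_flux ^+ 2.
Definition A_low := expR (- (C_outer * (1 + A_inner))) * (q0 * (1 + A_inner)^-1 ^+ k).

End Constants.

Section Estimates.
Context {R : realType}.
Implicit Types (r t x : R).
Variables (k : nat) (q dq b db : R -> R) (q0 K mu : R).
Hypothesis k4 : (4 <= k)%N.
Hypothesis q0_gt0 : 0 < q0.
Hypothesis K_ge1 : 1 <= K.
Hypothesis q_bd : forall u, unear u -> q0 <= q u <= K.
Hypothesis b_bd : forall u, unear u -> `|b u| <= K.
Hypothesis q_der : forall u, unear u -> der q u (dq u).
Hypothesis b_der : forall u, unear u -> der b u (db u).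
Hypothesis dq_bd : forall u, unear u -> `|dq u| <= K.
Hypothesis db_bd : forall u, unear u -> `|db u| <= K.
Hypothesis mu_ge0 : 0 <= mu.
Hypothesis mu_le : mu <= 1/8.
Variables (w : R -> R) (c0 sigma : R).
Hypothesis ew : evenc w.
Hypothesis w_sol : forall r,
  w r = c0 - prim (fun t => t * avg k (rhs k q b mu w) t) r.
Hypothesis c0_sigma : `|c0| = k.+1%:R * sigma.
Hypothesis sigma_gt0 : 0 < sigma.
Hypothesis sigma_le1 : sigma <= 1.
Hypothesis mu_sigma : mu ^+ 2 <= sigma.

Let S := rhs k q b mu w.
Let u := uclamp k mu w.
Let vt := vclamp k mu w.
Let v r := r * avg k w r.
Let wd r := - (r * avg k S r).
Let m : R := k%:R / 2.

Let eS : evenc S. Proof. exact: (evenc_rhs (dq := dq) (db := db)). Qed.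
Let un r : unear (u r). Proof. exact: uclamp_near. Qed.
Let k4R : 4 <= k%:R :> R. Proof. by rewrite ler_nat. Qed.
Let m2 : 2 <= m. Proof. by have := k4R; rewrite /m; lra. Qed.
(** The forcing [b * vt ^ 2] has size [mu ^ 2], so its square lives on the scale [sigma ^ 2] of the
    energy. *)
Let mu4 : mu ^+ 4 <= sigma ^+ 2.
Proof. by rewrite (exprM mu 2 2) ler_pXn2r// nnegrE ?sqr_ge0// ltW. Qed.

Lemma sol_der_w r : der w r (wd r).
Proof.
apply: (@der_ext _ (fun r => c0 - prim (fun t => t * avg k S t) r)) => [x|].
  by rewrite -w_sol.
rewrite /wd -[- _]add0r; apply: derB; first exact: der_cst.
by apply: der_prim; apply: cont_idM; exact: avg_cont.
Qed.

Lemma sol_w0 : w 0 = c0.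
Proof. by rewrite w_sol prim0 ?subr0//; apply: cont_idM; exact: avg_cont. Qed.

Lemma sol_der_flux_w r : der (fun t => t ^+ k * wd t) r (- (r ^+ k * S r)).
Proof.
apply: (@der_ext _ (fun t => - (t ^+ k.+1 * avg k S t))) => [t|].
  by rewrite /wd exprSr; ring.
by apply: derN; apply: der_avg; exact: eS.1.
Qed.

Lemma sol_der_flux_v r : der (fun t => t ^+ k * v t) r (r ^+ k * w r).
Proof.
apply: (@der_ext _ (fun t => t ^+ k.+1 * avg k w t)) => [t|].
  by rewrite /v exprSr; ring.
by apply: der_avg; exact: ew.1.
Qed.

Lemma sol_der_wd r : r != 0 -> der wd r (- S r - k%:R / r * wd r).
Proof.
move=> r0; apply: der_div_pow => //; apply: (derE (sol_der_flux_w r)).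
by rewrite mulrN.
Qed.

Lemma sol_der_v r : r != 0 -> der v r (w r - k%:R / r * v r).
Proof. by move=> r0; apply: der_div_pow => //; exact: sol_der_flux_v. Qed.

Let cont_wd : continuous wd.
Proof.
apply: contN; apply: cont_idM; exact: avg_cont.
Qed.

Let SE r : S r = q (u r) * w r + b (u r) * vt r ^+ 2. Proof. by []. Qed.

Let der_u r : der u r (vt r). Proof. exact: der_uclamp. Qed.

Let der_qu r : der (fun t => q (u t)) r (dq (u r) * vt r).
Proof. by apply: der_comp; [exact/q_der/un|exact: der_u]. Qed.

Let vt_bd r : 0 <= r -> (1 + r ^+ k) * vt r ^+ 2 <= mu ^+ 2.
Proof.
move=> r0; rewrite -(rho_sq k mu r) (ger0_norm r0) ler_wpM2l//.
  by rewrite addr_ge0// exprn_ge0.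
rewrite -[vt r ^+ 2]real_normK ?num_real//.
by rewrite ler_pXn2r// ?nnegrE// ?rho_ge0// vclamp_norm_le.
Qed.

Let pow4_le r : 0 <= r -> r ^+ 4 <= 1 + r ^+ k.
Proof.
move=> r0; case: (leP r 1) => h.
  by apply: le_trans (_ : 1 <= _); [rewrite expr_le1|rewrite lerDl exprn_ge0].
by apply: le_trans (_ : r ^+ k <= _); [rewrite ler_weXn2l// ltW|rewrite lerDr].
Qed.

Let vt_bds r : 0 <= r -> [/\ vt r ^+ 2 <= mu ^+ 2, r ^+ k * vt r ^+ 2 <= mu ^+ 2,
  r ^+ 4 * vt r ^+ 2 <= mu ^+ 2 & r ^+ 2 * `|vt r| <= mu].
Proof.
move=> r0; have h := vt_bd r0; have p0 := exprn_ge0 k r0; have v0 := sqr_ge0 (vt r).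
have h4 : r ^+ 4 * vt r ^+ 2 <= mu ^+ 2.
  by apply: le_trans h; rewrite ler_wpM2r// pow4_le.
split => //; [by nra|by nra|].
rewrite -(@ler_pXn2r _ 2)// ?nnegrE ?mulr_ge0 ?exprn_ge0//.
by rewrite exprMn -exprM real_normK ?num_real.
Qed.

(* The friction term [- k / r * wd r] has the good sign and is dropped. *)
Lemma inner_bound r : 0 <= r <= 1 -> wd r ^+ 2 + w r ^+ 2 <= A_inner k K * sigma ^+ 2.
Proof.
move=> /andP[r0 r1]; have := K_ge1 => K1.
(* The added constant [mu ^ 4] absorbs the forcing and makes the differential inequality
   homogeneous, as Gronwall requires. *)
pose G x := wd x ^+ 2 + w x ^+ 2 + mu ^+ 4.
have DG x : 0 < x < r -> der G x (2 * wd x * (- S x - k%:R / x * wd x) + 2 * w x * wd x).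
  move=> /andP[x0 _]; have nx : x != 0 by rewrite gt_eqF.
  apply: (derE (derD (derD (derX 1 (sol_der_wd nx)) (derX 1 (sol_der_w x))) (der_cst _ _))).
  by ring.
have := @gronwall _ G _ (fun x => C_inner K * x) (fun=> C_inner K) 0 r r0 DG.
move=> /(_ _ _ _ _)/wrap[].
- by move=> x _; apply: (derE (derM (der_cst _ _) (der_id _))); ring.
- move=> x _; suff : continuous G by apply.
  apply: contD; last exact: cont_cst.
  by apply: contD; apply: contX => //; case: ew.
- by move=> x _; apply: contM; [exact: cont_cst|exact: cont_id].
- move=> x /andP[x0 xr]; have [vt2 _ _ _] := vt_bds (ltW x0).
  rewrite SE /G /C_inner; have /andP[Q0 QK] := q_bd (un x).
  have := b_bd (un x); set Q := q (u x) in Q0 QK *; set Bx := b (u x).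
  have kx : 0 <= k%:R / x * wd x ^+ 2 by rewrite mulr_ge0 ?sqr_ge0 ?divr_ge0// ltW.
  set V := vt x ^+ 2 in vt2 *; have V0 : 0 <= V := sqr_ge0 _.
  set y := wd x in kx *; set z := w x => BK.
  have e1 : 2 * y * z * (1 - Q) <= (1 + K) * (y ^+ 2 + z ^+ 2).
    have h1 := norm_mul2_le y z.
    have q00 := q0_gt0.
    have h2 : `|1 - Q| <= 1 + K by rewrite ler_norml; apply/andP; split; lra.
    apply: le_trans (ler_norm _) _; rewrite normrM mulrC.
    by apply: ler_pM.
  have e2 : - (2 * y * (Bx * V)) <= y ^+ 2 + K ^+ 2 * mu ^+ 4.
    have h1 : (Bx * V) ^+ 2 <= K ^+ 2 * mu ^+ 4.
      rewrite exprMn -[Bx ^+ 2]real_normK ?num_real// (exprM mu 2 2).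
      by apply: ler_pM; rewrite ?sqr_ge0// ler_pXn2r// nnegrE; lra.
    by have := norm_mul2_le y (Bx * V); rewrite ler_norml => /andP[]; lra.
  have K2 : 0 <= K ^+ 2 := sqr_ge0 _; have m4 : 0 <= mu ^+ 4 by rewrite exprn_ge0.
  have yz : 0 <= K ^+ 2 * (y ^+ 2 + z ^+ 2) by rewrite mulr_ge0// addr_ge0 ?sqr_ge0.
  have Km : 0 <= (2 + K) * mu ^+ 4 by rewrite mulr_ge0//; lra.
  have z0 := sqr_ge0 z.
  have -> : 2 * y * (- (Q * z + Bx * V) - k%:R / x * y) + 2 * z * y =
     2 * y * z * (1 - Q) - 2 * y * (Bx * V) - 2 * (k%:R / x * y ^+ 2) by ring.
  by lra.
rewrite mulr0 subr0 /G /wd mul0r oppr0 expr0n/= add0r sol_w0 => H.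
have m4 : 0 <= mu ^+ 4 by rewrite exprn_ge0.
have : wd r ^+ 2 + w r ^+ 2 <= expR (C_inner K * r) * (c0 ^+ 2 + mu ^+ 4).
  by apply: le_trans H; rewrite lerDl.
move=> /le_trans; apply; rewrite /A_inner -mulrA.
have C0 : 0 <= C_inner K by rewrite /C_inner; have := sqr_ge0 K; lra.
apply: ler_pM; rewrite ?expR_ge0// ?addr_ge0 ?sqr_ge0//.
  by rewrite ler_expR ler_piMr.
rewrite mulrDl mul1r lerD// -exprMn -c0_sigma real_normK ?num_real//.
Qed.

Let A_inner_ge0 : 0 <= A_inner k K.
Proof. by rewrite mulr_ge0 ?expR_ge0// addr_ge0 ?sqr_ge0. Qed.

Let sqr_bound (x A : R) : 0 <= A -> x ^+ 2 <= A * sigma ^+ 2 -> `|x| <= (1 + A) * sigma.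
Proof.
move=> A0 h; have s0 := sigma_gt0.
rewrite -(@ler_pXn2r _ 2)// ?nnegrE ?mulr_ge0 ?(ltW s0)// ?addr_ge0//.
rewrite real_normK ?num_real// (le_trans h)// exprMn ler_wpM2r ?sqr_ge0//.
by nra.
Qed.

Lemma inner_w r : 0 <= r <= 1 -> `|w r| <= (1 + A_inner k K) * sigma.
Proof.
move=> /inner_bound h; apply: sqr_bound => //; apply: le_trans h.
by rewrite lerDr sqr_ge0.
Qed.

Lemma inner_wd r : 0 <= r <= 1 -> `|wd r| <= (1 + A_inner k K) * sigma.
Proof.
move=> /inner_bound h; apply: sqr_bound => //; apply: le_trans h.
by rewrite lerDl sqr_ge0.
Qed.

Lemma inner_v r : 0 <= r <= 1 -> `|v r| <= (1 + A_inner k K) * sigma.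
Proof.
move=> /andP[r0 r1]; rewrite /v normrM ger0_norm// -[leRHS]mul1r; apply: ler_pM => //.
apply: le_trans (_ : (1 + A_inner k K) * sigma / k.+1%:R <= _).
  apply: avg_le => //; first exact: ew.1.
  by move=> t /andP[t0 tr]; apply: inner_w; rewrite t0 (le_trans tr).
by rewrite ler_pdivrMr ?ltr0n// ler_peMr ?ler1n// mulr_ge0 ?addr_ge0// ltW.
Qed.

(* With [z = r ^ m * w], [m = k / 2], this is [z' ^ 2 + q z ^ 2]; the exponent [m]
   removes the first-order term from the equation of [w]. *)
Definition energy r := r ^+ k * ((wd r + m * w r / r) ^+ 2 + q (u r) * w r ^+ 2).

(** In terms of [z = r ^ m * w] the equation is [z'' = m (m - 1) / r ^ 2 * z - q z - r ^ m * b * vt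
    ^ 2]. The terms in [q z z'] cancel; each of the others carries [r ^ -2] or a factor [vt]. *)
Lemma der_energy r : 0 < r -> der energy r
  (r ^+ k * (2 * (wd r + m * w r / r) * (m * (m - 1) / r ^+ 2 * w r - b (u r) * vt r ^+ 2)
     + dq (u r) * vt r * w r ^+ 2)).
Proof.
move=> r0; have nr : r != 0 by rewrite gt_eqF.
have D1 := derM (derM (der_cst m r) (sol_der_w r)) (derV nr (der_id r)).
have D2 := derX 1 (derD (sol_der_wd nr) D1).
have D3 := derD D2 (derM (der_qu r) (derX 1 (sol_der_w r))).
apply: (derE (derM (der_pow k nr) D3)).
have -> : k%:R = 2 * m by rewrite /m; field.
by rewrite SE; field.
Qed.

Lemma energy_parts r : 0 <= r ->
  r ^+ k * (wd r + m * w r / r) ^+ 2 <= energy r /\ r ^+ k * w r ^+ 2 <= energy r / q0.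
Proof.
move=> r0; have /andP[Q0 _] := q_bd (un r); have p0 := exprn_ge0 k r0.
have a0 := mulr_ge0 p0 (sqr_ge0 (wd r + m * w r / r)).
have w0 := mulr_ge0 p0 (sqr_ge0 (w r)).
have q00 := q0_gt0.
split; first by rewrite /energy ler_wpM2l// lerDl mulr_ge0 ?sqr_ge0//; lra.
rewrite ler_pdivlMr// /energy mulrDr mulrCA mulrC.
by have := ler_wpM2r w0 Q0; lra.
Qed.

Let energy_ge0 r : 0 <= r -> 0 <= energy r.
Proof.
move=> r0; apply: le_trans (energy_parts r0).1.
by rewrite mulr_ge0 ?sqr_ge0// exprn_ge0.
Qed.

Lemma der_energy_le r : 0 < r ->
  `|r ^+ k * (2 * (wd r + m * w r / r) * (m * (m - 1) / r ^+ 2 * w r - b (u r) * vt r ^+ 2)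
     + dq (u r) * vt r * w r ^+ 2)| <= C_outer k q0 K / r ^+ 2 * (energy r + mu ^+ 4).
Proof.
move=> r0; have [e1 e2] := energy_parts (ltW r0); have F0 := energy_ge0 (ltW r0).
have [_ v2 v3 v4] := vt_bds (ltW r0).
have m4 : 0 <= mu ^+ 4 by rewrite exprn_ge0.
have r2 : 0 < r ^+ 2 by rewrite exprn_gt0.
have P0 : 0 < r ^+ k by rewrite exprn_gt0.
have q00 := q0_gt0; have K1 := K_ge1; have mm := m2; have mu1 := mu_le.
rewrite [leRHS]mulrAC ler_pdivlMr// -[X in _ * X <= _](gtr0_norm r2) -normrM.
have bK := b_bd (un r); have dK := dq_bd (un r).
set F := energy r in e1 e2 F0 *; set a := wd r + m * w r / r in e1 *.
set P := r ^+ k in e1 e2 v2 P0 *; set y := w r in e2 *.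
set Bx := b (u r) in bK *; set D := dq (u r) in dK *; set V := vt r in v2 v3 v4 *.
have -> : P * (2 * a * (m * (m - 1) / r ^+ 2 * y - Bx * V ^+ 2) + D * V * y ^+ 2) * r ^+ 2 =
  m * (m - 1) * (P * (2 * a * y)) - P * (2 * a * (r ^+ 2 * (Bx * V ^+ 2)))
   + D * (r ^+ 2 * V) * (P * y ^+ 2) by field; rewrite gt_eqF.
have t1 : `|m * (m - 1) * (P * (2 * a * y))| <= m ^+ 2 * (F + F / q0).
  rewrite normrM; apply: ler_pM => //.
    have m1 : 0 <= m * (m - 1) by apply: mulr_ge0; lra.
    by rewrite ger0_norm//; lra.
  rewrite normrM gtr0_norm//; apply: le_trans (_ : P * (a ^+ 2 + y ^+ 2) <= _).
    by rewrite ler_wpM2l ?(ltW P0)// norm_mul2_le.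
  by rewrite mulrDr lerD.
have t2 : `|P * (2 * a * (r ^+ 2 * (Bx * V ^+ 2)))| <= F + K ^+ 2 * mu ^+ 4.
  set z := r ^+ 2 * (Bx * V ^+ 2).
  (* One factor [V ^ 2] pays for [r ^ k] and the other for [r ^ 4], each product being at most
     [mu ^ 2]. *)
  have z2 : P * z ^+ 2 <= K ^+ 2 * mu ^+ 4.
    have -> : P * z ^+ 2 = `|Bx| ^+ 2 * ((P * V ^+ 2) * (r ^+ 4 * V ^+ 2)).
      by rewrite real_normK ?num_real// /z; ring.
    have PV := mulr_ge0 (ltW P0) (sqr_ge0 V).
    have rV := mulr_ge0 (exprn_ge0 4 (ltW r0)) (sqr_ge0 V).
    apply: ler_pM; [exact: sqr_ge0|exact: mulr_ge0| |].
      by rewrite ler_pXn2r// nnegrE; lra.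
    by rewrite (exprD mu 2 2); exact: ler_pM.
  rewrite normrM gtr0_norm//; apply: le_trans (_ : P * (a ^+ 2 + z ^+ 2) <= _).
    by rewrite ler_wpM2l ?(ltW P0)// norm_mul2_le.
  by rewrite mulrDr lerD.
have t3 : `|D * (r ^+ 2 * V) * (P * y ^+ 2)| <= K * (F / q0).
  rewrite normrM; apply: ler_pM => //; last first.
    by rewrite ger0_norm// mulr_ge0 ?sqr_ge0// ltW.
  rewrite normrM -[leRHS]mulr1; apply: ler_pM => //.
  by rewrite normrM gtr0_norm// (le_trans v4)//; lra.
apply: le_trans (ler_normD _ _) _; apply: le_trans (lerD (ler_normB _ _) (lexx _)) _.
apply: le_trans (lerD (lerD t1 t2) t3) _.
rewrite /C_outer -/m.
have c1 : 0 <= (m ^+ 2 * (1 + q0^-1) + 1 + K / q0) * mu ^+ 4.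
  rewrite mulr_ge0// !addr_ge0// ?mulr_ge0// ?invr_ge0 ?sqr_ge0 ?addr_ge0// ?invr_ge0; lra.
have c2 : 0 <= K ^+ 2 * F by rewrite mulr_ge0// sqr_ge0.
by rewrite -subr_ge0; apply: le_trans (addr_ge0 c1 c2) _; rewrite le_eqVlt; apply/orP; left; apply/eqP; ring.
Qed.

(** A primitive of the Gronwall rate that stays bounded as [r] grows, because the rate is
    [O(r ^ -2)]; this makes the energies at distant radii comparable. *)
Let H r := - (C_outer k q0 K / r).
Let der_H r : 0 < r -> der H r (C_outer k q0 K / r ^+ 2).
Proof.
move=> r0; have nr : r != 0 by rewrite gt_eqF.
by apply: (derE (derN (derM (der_cst _ _) (derV nr (der_id r))))); field.
Qed.

Let der_G r : 0 < r -> der (fun r => energy r + mu ^+ 4) r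
  (r ^+ k * (2 * (wd r + m * w r / r) * (m * (m - 1) / r ^+ 2 * w r - b (u r) * vt r ^+ 2)
     + dq (u r) * vt r * w r ^+ 2)).
Proof.
by move=> r0; apply: (derE (derD (der_energy r0) (der_cst _ _))); rewrite addr0.
Qed.

Lemma energy_growth (a r : R) : 0 < a -> a <= r ->
  energy r + mu ^+ 4 <= expR (H r - H a) * (energy a + mu ^+ 4).
Proof.
move=> a0 ar; have pos x : a <= x <= r -> 0 < x by move=> /andP[/(lt_le_trans a0)].
have pos' x : a < x < r -> 0 < x by move=> /andP[/(lt_trans a0)].
apply: (@gronwall _ (fun r => energy r + mu ^+ 4) _ _ _ _ _ ar
  (fun x h => der_G (pos' x h)) (fun x h => der_H (pos' x h))).
- by move=> x /pos x0; exact: (der_cont (der_G x0)).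
- by move=> x /pos x0; exact: (der_cont (der_H x0)).
- by move=> x /pos' /der_energy_le; rewrite ler_norml => /andP[].
Qed.

Lemma energy_decay (a r : R) : 0 < a -> a <= r ->
  expR (- (H r - H a)) * (energy a + mu ^+ 4) <= energy r + mu ^+ 4.
Proof.
move=> a0 ar; have pos x : a <= x <= r -> 0 < x by move=> /andP[/(lt_le_trans a0)].
have pos' x : a < x < r -> 0 < x by move=> /andP[/(lt_trans a0)].
apply: (@gronwall_lower _ (fun r => energy r + mu ^+ 4) _ _ _ _ _ ar
  (fun x h => der_G (pos' x h)) (fun x h => der_H (pos' x h))).
- by move=> x /pos x0; exact: (der_cont (der_G x0)).
- by move=> x /pos x0; exact: (der_cont (der_H x0)).
- by move=> x /pos' /der_energy_le; rewrite ler_norml => /andP[].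
Qed.


Lemma outer_energy r : 1 <= r -> energy r <= A_outer k q0 K * sigma ^+ 2.
Proof.
move=> r1; have m4 : 0 <= mu ^+ 4 by rewrite exprn_ge0.
have K1 := K_ge1; have q00 := q0_gt0; have mm := m2.
have C0 : 0 <= C_outer k q0 K.
  by rewrite /C_outer !addr_ge0// ?mulr_ge0 ?addr_ge0 ?sqr_ge0 ?invr_ge0//; lra.
apply: le_trans (_ : energy r + mu ^+ 4 <= _); first by rewrite lerDl.
apply: le_trans (energy_growth ltr01 r1) _; rewrite /A_outer -mulrA.
apply: ler_pM; rewrite ?expR_ge0 ?addr_ge0 ?energy_ge0//.
  rewrite ler_expR /H divr1 opprK -lerBrDr subrr oppr_le0.
  by rewrite divr_ge0//; lra.
rewrite mulrDl mul1r lerD//.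
have := @inner_bound 1; rewrite lexx ler01 => /(_ isT).
set A := A_inner k K; rewrite /energy expr1n mul1r divr1 -/m => h.
have /andP[Q0 QK] := q_bd (un 1).
have a0 : 0 <= A * sigma ^+ 2 := le_trans (addr_ge0 (sqr_ge0 _) (sqr_ge0 _)) h.
have s1 := sqr_ge0 (wd 1); have s2 := sqr_ge0 (w 1).
have e1 : (wd 1 + m * w 1) ^+ 2 <= 2 * wd 1 ^+ 2 + 2 * m ^+ 2 * w 1 ^+ 2.
  by have := sqr_ge0 (wd 1 - m * w 1); rewrite sqrrB sqrrD exprMn; lra.
have e2 : q (u 1) * w 1 ^+ 2 <= K * w 1 ^+ 2 by rewrite ler_wpM2r.
have e3 : 2 * m ^+ 2 * w 1 ^+ 2 <= 2 * m ^+ 2 * (A * sigma ^+ 2).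
  by apply: ler_wpM2l; [rewrite mulr_ge0 ?sqr_ge0|lra].
have e4 : K * w 1 ^+ 2 <= K * (A * sigma ^+ 2) by apply: ler_wpM2l; lra.
by lra.
Qed.

Lemma outer_wd r : 1 <= r -> r ^+ k * wd r ^+ 2 <= A_der k q0 K * sigma ^+ 2.
Proof.
move=> r1; have r0 : 0 < r by lra.
have [e1 e2] := energy_parts (ltW r0); have e3 := outer_energy r1.
have P0 := exprn_ge0 k (ltW r0).
have i1 : 0 <= r^-1 <= 1 by rewrite invr_ge0 (ltW r0)/= invf_le1.
have h : wd r ^+ 2 <= 2 * (wd r + m * w r / r) ^+ 2 + 2 * m ^+ 2 * w r ^+ 2.
  have -> : wd r = (wd r + m * w r / r) - m * w r / r by ring.
  rewrite subrK; set a := wd r + _; set z := m * w r / r.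
  have z2 : z ^+ 2 <= m ^+ 2 * w r ^+ 2.
    rewrite /z exprMn exprMn; apply: ler_piMr; first by apply: mulr_ge0; exact: sqr_ge0.
    by move: i1 => /andP[i0 i1]; exact: exprn_ile1.
  by have := sqr_ge0 (a + z); rewrite sqrrB sqrrD; lra.
apply: le_trans (ler_wpM2l P0 h) _.
have -> : r ^+ k * (2 * (wd r + m * w r / r) ^+ 2 + 2 * m ^+ 2 * w r ^+ 2) =
  2 * (r ^+ k * (wd r + m * w r / r) ^+ 2) + 2 * m ^+ 2 * (r ^+ k * w r ^+ 2) by ring.
apply: le_trans (_ : 2 * energy r + 2 * m ^+ 2 * (energy r / q0) <= _).
  by apply: lerD; apply: ler_wpM2l => //; rewrite mulr_ge0 ?sqr_ge0.
have -> : 2 * energy r + 2 * m ^+ 2 * (energy r / q0) = (2 + 2 * m ^+ 2 / q0) * energy r by ring.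
have -> : A_der k q0 K * sigma ^+ 2 = (2 + 2 * m ^+ 2 / q0) * (A_outer k q0 K * sigma ^+ 2).
  by rewrite /A_der -/m; ring.
apply: ler_wpM2l => //.
by rewrite addr_ge0// divr_ge0 ?mulr_ge0 ?sqr_ge0// ltW.
Qed.

(* Since [(r ^ k * v)' = r ^ k * w] and [q w] is [- r ^ - k * (r ^ k * wd)'] up to
   quadratic terms, the oscillations cancel in this combination. *)
Definition flux r := r ^+ k * v r + r ^+ k * wd r / q (u r).

Let q_gt0 r : 0 < q (u r).
Proof. by have /andP[h _] := q_bd (un r); apply: lt_le_trans h. Qed.

Lemma der_flux r : der flux r
  (- (r ^+ k * (b (u r) * vt r ^+ 2) / q (u r)
      + r ^+ k * wd r * (dq (u r) * vt r) / q (u r) ^+ 2)).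
Proof.
have nq : q (u r) != 0 by rewrite gt_eqF.
have D := derD (sol_der_flux_v r)
  (derM (sol_der_flux_w r) (@derV _ (fun t => q (u t)) _ _ nq (der_qu r))).
by apply: (derE D); rewrite SE; field.
Qed.

(** The terms of size [mu ^ 2] are bounded by [sigma] and not by a multiple of [sigma ^ 2]: [mu]
    will be a multiple of [sigma] chosen in terms of [A_flux], which therefore must not depend on
    [mu]. *)
Lemma der_flux_le r : 1 <= r ->
  `|- (r ^+ k * (b (u r) * vt r ^+ 2) / q (u r)
      + r ^+ k * wd r * (dq (u r) * vt r) / q (u r) ^+ 2)| <=
  (K / q0 + K / (2 * q0 ^+ 2) * (A_der k q0 K + 1)) * sigma.
Proof.
move=> r1; have r0 : 0 < r by lra.
have [_ v2 _ _] := vt_bds (ltW r0); have h := outer_wd r1.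
have s0 := sigma_gt0; have s1 := sigma_le1; have ms := mu_sigma; have q00 := q0_gt0.
have K0 : 0 <= K by have := K_ge1; lra.
have P0 := exprn_gt0 k r0; have /andP[Q0 _] := q_bd (un r).
have bK := b_bd (un r); have dK := dq_bd (un r).
have iQ : (q (u r))^-1 <= q0^-1 by rewrite lef_pV2 ?posrE ?q_gt0.
have iQ0 : 0 <= (q (u r))^-1 by rewrite invr_ge0 ltW.
rewrite normrN; apply: le_trans (ler_normD _ _) _; rewrite mulrDl; apply: lerD.
  rewrite normrM normfV (gtr0_norm (q_gt0 r)).
  have -> : K / q0 * sigma = K * sigma / q0 by rewrite mulrAC.
  apply: ler_pM => //; rewrite mulrCA normrM; apply: ler_pM => //.
  by rewrite ger0_norm ?(le_trans v2)//; nonneg.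
have -> : r ^+ k * wd r * (dq (u r) * vt r) / q (u r) ^+ 2 =
  dq (u r) * (r ^+ k * (2 * wd r * vt r)) / 2 * ((q (u r))^-1 ^+ 2).
  by field; rewrite gt_eqF.
have -> : K / (2 * q0 ^+ 2) * (A_der k q0 K + 1) * sigma =
  K * (A_der k q0 K * sigma + sigma) / 2 * (q0^-1 ^+ 2).
  by field; rewrite gt_eqF.
rewrite normrM; apply: ler_pM => //; last first.
  by rewrite ger0_norm ?exprn_ge0// ler_pXn2r// nnegrE invr_ge0 ltW.
rewrite normrM [`|2^-1|]ger0_norm// ler_wpM2r// normrM; apply: ler_pM => //.
rewrite normrM gtr0_norm//; apply: le_trans (_ : r ^+ k * (wd r ^+ 2 + vt r ^+ 2) <= _).
  by rewrite ler_wpM2l ?(ltW P0)// norm_mul2_le.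
rewrite mulrDr lerD//; last by lra.
apply: le_trans h _; rewrite ler_wpM2l//; last by nra.
rewrite /A_der /A_outer !mulr_ge0 ?expR_ge0 ?addr_ge0 ?mulr_ge0 ?sqr_ge0 ?invr_ge0//; lra.
Qed.

Let A_der_ge0 : 0 <= A_der k q0 K.
Proof.
have K0 : 0 <= K by have := K_ge1; lra.
have q00 := q0_gt0.
by rewrite /A_der /A_outer !mulr_ge0 ?expR_ge0 ?addr_ge0 ?mulr_ge0 ?sqr_ge0 ?invr_ge0//; lra.
Qed.

Lemma flux_le r : 1 <= r -> `|flux r| <= A_flux k q0 K * sigma * r.
Proof.
move=> r1; have s0 := sigma_gt0; have q00 := q0_gt0.
have K0 : 0 <= K by have := K_ge1; lra.
set c := (K / q0 + K / (2 * q0 ^+ 2) * (A_der k q0 K + 1)) * sigma.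
have c0' : 0 <= c.
  rewrite /c mulr_ge0 ?(ltW s0)// addr_ge0 ?divr_ge0 ?(ltW q00)//.
  by rewrite mulr_ge0 ?addr_ge0// divr_ge0// mulr_ge0 ?sqr_ge0.
have := @der_norm_le _ flux (fun t => c * t) _ (fun=> c) 1 r r1 (fun x _ => der_flux x).
move=> /(_ _ _ _ _)/wrap[].
- by move=> x _; apply: (derE (derM (der_cst _ _) (der_id _))); ring.
- by move=> x _; exact: (der_cont (der_flux x)).
- by move=> x _; apply: contM; [exact: cont_cst|exact: cont_id].
- by move=> x /andP[x1 _]; apply: der_flux_le; exact: ltW.
have f1 : `|flux 1| <= (1 + A_inner k K) * (1 + q0^-1) * sigma.
  rewrite /flux expr1n !mul1r; apply: le_trans (ler_normD _ _) _.
  have -> : (1 + A_inner k K) * (1 + q0^-1) * sigma =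
    (1 + A_inner k K) * sigma + (1 + A_inner k K) * sigma / q0 by ring.
  apply: lerD; first by apply: inner_v; rewrite lexx ler01.
  rewrite normrM normfV (gtr0_norm (q_gt0 1)); apply: ler_pM => //.
  - by rewrite invr_ge0 ltW.
  - by apply: inner_wd; rewrite lexx ler01.
  - by have /andP[Q0 _] := q_bd (un 1); rewrite lef_pV2 ?posrE ?q_gt0.
move=> h; have -> : flux r = flux r - flux 1 + flux 1 by rewrite subrK.
apply: le_trans (ler_normD _ _) _; rewrite /A_flux -/c.
have B0 : 0 <= (1 + A_inner k K) * (1 + q0^-1) * sigma := le_trans (normr_ge0 _) f1.
have -> : (K / q0 + K / (2 * q0 ^+ 2) * (A_der k q0 K + 1) + (1 + A_inner k K) * (1 + q0^-1)) * sigma * r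
  = c * r + (1 + A_inner k K) * (1 + q0^-1) * sigma * r by rewrite /c; ring.
have := ler_wpM2l B0 r1; rewrite mulr1; lra.
Qed.

(** Bounds the untruncated velocity at the truncation rate, through
    [r ^ k * v = flux - r ^ k * wd / q]. The linear growth of the flux is harmless since
    [r ^ 2 <= r ^ k] for [r >= 1]. *)
Lemma velocity_le r : 0 <= r ->
  (1 + r ^+ k) * v r ^+ 2 <= 2 * (A_vel k q0 K + (1 + A_inner k K) ^+ 2) * sigma ^+ 2.
Proof.
move=> r0; have q00 := q0_gt0; have s2 := sqr_ge0 sigma.
have V0 : 0 <= A_vel k q0 K.
  by rewrite /A_vel; nonneg.
have I0 := sqr_ge0 (1 + A_inner k K).
rewrite -mulrA mulrDl; case: (leP r 1) => r1.
  have h : v r ^+ 2 <= (1 + A_inner k K) ^+ 2 * sigma ^+ 2.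
    have := @inner_v r; rewrite r0 r1 => /(_ isT) h.
    rewrite -exprMn -[v r ^+ 2]real_normK ?num_real// ler_pXn2r// nnegrE.
    exact: le_trans h.
  have p1 : r ^+ k <= 1 by rewrite exprn_ile1.
  have := sqr_ge0 (v r); have := mulr_ge0 V0 s2.
  have := ler_wpM2r (sqr_ge0 (v r)) p1; rewrite mul1r; lra.
have r1' := ltW r1; have h1 := outer_wd r1'; have h2 := flux_le r1'.
have P1 : 1 <= r ^+ k by rewrite exprn_ege1.
have P0 : 0 < r ^+ k := lt_le_trans ltr01 P1.
have rP : r ^+ 2 <= r ^+ k by rewrite ler_weXn2l// (leq_trans _ k4).
have /andP[Q0 _] := q_bd (un r).
have e : r ^+ k * v r = flux r - r ^+ k * wd r / q (u r) by rewrite /flux addrK.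
have f2 : flux r ^+ 2 <= A_flux k q0 K ^+ 2 * sigma ^+ 2 * r ^+ k.
  rewrite -[flux r ^+ 2]real_normK ?num_real//.
  apply: le_trans (_ : (A_flux k q0 K * sigma * r) ^+ 2 <= _).
    by rewrite ler_pXn2r// nnegrE (le_trans _ h2).
  by rewrite !exprMn ler_wpM2l// mulr_ge0 ?sqr_ge0.
have w2 : (r ^+ k * wd r / q (u r)) ^+ 2 <= A_der k q0 K / q0 ^+ 2 * sigma ^+ 2 * r ^+ k.
  have -> : (r ^+ k * wd r / q (u r)) ^+ 2 = (r ^+ k * wd r ^+ 2) * ((q (u r))^-1 ^+ 2) * r ^+ k.
    by field; rewrite gt_eqF.
  rewrite ler_wpM2r ?(ltW P0)// [leRHS]mulrAC -exprVn; apply: ler_pM => //.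
  - by rewrite mulr_ge0 ?sqr_ge0 ?(ltW P0).
  - exact: sqr_ge0.
  - by rewrite ler_pXn2r ?nnegrE ?invr_ge0 ?(ltW q00) ?(ltW (q_gt0 r))// lef_pV2 ?posrE ?q_gt0.
have key : r ^+ k * v r ^+ 2 <= A_vel k q0 K * sigma ^+ 2.
  rewrite -(ler_pM2r P0).
  have -> : r ^+ k * v r ^+ 2 * r ^+ k = (r ^+ k * v r) ^+ 2 by ring.
  rewrite e; set f := flux r in f2 *; set g := _ / _ in w2 *.
  have fg : (f - g) ^+ 2 <= 2 * f ^+ 2 + 2 * g ^+ 2.
    by have := sqr_ge0 (f + g); rewrite sqrrD sqrrB; lra.
  by rewrite /A_vel; lra.
have := ler_wpM2r (sqr_ge0 (v r)) P1; have := mulr_ge0 I0 s2; rewrite mul1r; lra.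
Qed.

Lemma clamp_inactive : 2 * (A_vel k q0 K + (1 + A_inner k K) ^+ 2) * sigma ^+ 2 <= mu ^+ 2 ->
  forall r, vt r = v r.
Proof.
move=> hM; suff pos r : 0 <= r -> vt r = v r.
  move=> r; case: (leP 0 r) => r0; first exact: pos.
  have := pos (- r); rewrite oppr_ge0 => /(_ (ltW r0)).
  rewrite /vt /v vclampN// avg_even// mulNr; exact: oppr_inj.
move=> r0; apply: clamp_id; rewrite -/(v r).
have P1 : 0 < 1 + `|r| ^+ k by rewrite ltr_pwDl// exprn_ge0.
rewrite -(@ler_pXn2r _ 2)// ?nnegrE ?rho_ge0// real_normK ?num_real// -(ler_pM2l P1) rho_sq.
by rewrite (ger0_norm r0); apply: le_trans hM; exact: velocity_le.
Qed.

Lemma energy_lower r : 1 <= r -> A_low k q0 K * sigma ^+ 2 - mu ^+ 4 <= energy r.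
Proof.
move=> r1; have s0 := sigma_gt0; have q00 := q0_gt0; have A0 := A_inner_ge0.
have K0 : 0 <= K by have := K_ge1; lra.
have mm := m2.
have C0 : 0 <= C_outer k q0 K.
  by rewrite /C_outer !addr_ge0// ?mulr_ge0 ?addr_ge0 ?sqr_ge0 ?invr_ge0//; lra.
(* On [[0, r0]] the slope bound [(1 + A_inner) * sigma] lets [w] move by at most [sigma], while
   [|c0| >= 2 * sigma]. So the energy is bounded below at [r0], from where Gronwall propagates
   it. *)
set r0 : R := (1 + A_inner k K)^-1.
have A1 : 0 < 1 + A_inner k K by lra.
have r00 : 0 < r0 by rewrite invr_gt0.
have r01 : r0 <= 1 by rewrite invf_le1//; lra.
have := energy_decay r00 (le_trans r01 r1); rewrite -lerBlDr; apply: le_trans.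
rewrite lerD2r /A_low -mulrA.
apply: ler_pM; [by nonneg|by nonneg| |].
  rewrite ler_expR lerN2 /H opprK /r0 invrK.
  have : 0 <= C_outer k q0 K / r by rewrite divr_ge0//; lra.
  lra.
apply: le_trans (_ : energy r0 <= _); last by rewrite lerDl exprn_ge0.
have /andP[Q0 _] := q_bd (un r0).
have ws : sigma <= `|w r0|.
  have := @der_norm_le _ w (fun t => (1 + A_inner k K) * sigma * t) wd
    (fun=> (1 + A_inner k K) * sigma) 0 r0 (ltW r00) (fun x _ => sol_der_w x).
  move=> /(_ _ _ _ _)/wrap[].
  - by move=> x _; apply: (derE (derM (der_cst _ _) (der_id _))); ring.
  - by move=> x _; case: ew => + _; apply.
  - by move=> x _; apply: contM; [exact: cont_cst|exact: cont_id].
  - by move=> x /andP[x0 xr]; apply: inner_wd; rewrite (ltW x0) (le_trans (ltW xr)).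
  rewrite mulr0 subr0 mulrAC divff ?gt_eqF// mul1r sol_w0 => h.
  have : `|c0| <= `|w r0| + `|w r0 - c0|.
    by apply: le_trans (ler_normB _ _); rewrite opprB addrC subrK.
  have k1 : 2 <= k.+1%:R :> R by rewrite ler_nat ltnS (leq_trans _ k4).
  by rewrite c0_sigma; have := ler_wpM2r (ltW s0) k1; lra.
rewrite /energy -mulrA mulrCA ler_wpM2l ?exprn_ge0 ?(ltW r00)//.
apply: le_trans (_ : q (u r0) * w r0 ^+ 2 <= _); last by rewrite lerDr sqr_ge0.
apply: ler_pM; rewrite ?(ltW q00) ?sqr_ge0//.
by rewrite -[w r0 ^+ 2]real_normK ?num_real// ler_pXn2r// nnegrE ltW.
Qed.

End Estimates.

(** * Choice of the small parameters *)

Section SmallSolutions.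
Context {R : realType}.
Implicit Types (r s : R).
Variables (k : nat) (q dq b db : R -> R) (q0 K : R).
Hypothesis k4 : (4 <= k)%N.
Hypothesis q0_gt0 : 0 < q0.
Hypothesis K_ge1 : 1 <= K.
Hypothesis q_bd : forall u, unear u -> q0 <= q u <= K.
Hypothesis b_bd : forall u, unear u -> `|b u| <= K.
Hypothesis q_der : forall u, unear u -> der q u (dq u).
Hypothesis b_der : forall u, unear u -> der b u (db u).
Hypothesis dq_bd : forall u, unear u -> `|dq u| <= K.
Hypothesis db_bd : forall u, unear u -> `|db u| <= K.

(** The truncation has disappeared from the conclusion, where [v] is the true velocity. The
    constants [C] and [d] may depend on [s], which is harmless for asymptotics at fixed [s]. *)
Lemma small_solution : exists2 eps : R, 0 < eps & forall s, 0 < `|s| < eps ->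
  exists u w : R -> R,
  let v r := r * avg k w r in
  let S r := q (u r) * w r + b (u r) * v r ^+ 2 in
  let wd r := - (r * avg k S r) in
  [/\ [/\ evenc u, evenc w & evenc S],
      [/\ u 0 = 1, w 0 = - (k.+1%:R * s) & forall r, unear (u r)],
      (forall r, der u r (v r)) /\ (forall r, der w r (wd r)),
      (forall r, 0 < r -> der v r (w r - k%:R / r * v r)) /\
      (forall r, 0 < r -> der wd r (- S r - k%:R / r * wd r))
    & exists C d : R, 0 < d /\ forall r, 1 <= r ->
      [/\ r ^+ k * v r ^+ 2 <= C,
          d <= r ^+ k * ((wd r + k%:R / 2 * w r / r) ^+ 2 + q (u r) * w r ^+ 2) <= C
        & `|r ^+ k * v r + r ^+ k * wd r / q (u r)| <= C * r]].
Proof.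
have K0 : 0 <= K := le_trans ler01 K_ge1.
pose c1 := 2 * (A_vel k q0 K + (1 + A_inner k K) ^+ 2).
have Ai : 0 <= A_inner k K by rewrite /A_inner; nonneg.
have Al : 0 < A_low k q0 K.
  by rewrite /A_low mulr_gt0 ?expR_gt0// mulr_gt0// exprn_gt0// invr_gt0; lra.
have Av : 0 <= A_vel k q0 K by rewrite /A_vel /A_der /A_outer; nonneg.
have c10 : 0 <= c1 by rewrite /c1; nonneg.
(* As [c1] is free of [mu], the choice [mu = M * sigma] is legitimate, and [c1 <= M <= M ^ 2] gives
   the inequality that makes the truncation inactive. *)
pose M := 1 + c1; have M1 : 1 <= M by rewrite /M; lra.
have M4 : 1 <= M ^+ 4 by rewrite exprn_ege1.
have M24 : M ^+ 2 <= M ^+ 4 by rewrite ler_weXn2l.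
have MM4 : M <= M ^+ 4 by rewrite -[leLHS]expr1 ler_weXn2l.
(* The first summand yields [sigma <= 1], [mu <= 1/8] and [mu ^ 2 <= sigma]; the second makes
   [mu ^ 4] at most half of [A_low * sigma ^ 2], so that the lower bound of the energy stays
   positive. *)
pose e := 8 * M ^+ 4 + 2 * M ^+ 4 / A_low k q0 K.
have e2 : 0 <= 2 * M ^+ 4 / A_low k q0 K by have M0 := le_trans ler01 M1; nonneg.
have e0 : 0 < e by rewrite /e; lra.
exists e^-1; first by rewrite invr_gt0.
move=> s; set sigma := `|s| => /andP[s0]; rewrite -[e^-1]mul1r ltr_pdivlMr// => se.
have s1 : sigma * (8 * M ^+ 4) <= 1.
  by apply: le_trans (ltW se); rewrite ler_wpM2l ?(ltW s0)// /e lerDl.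
have s2 : sigma * (2 * M ^+ 4) <= A_low k q0 K.
  have h : sigma * (2 * M ^+ 4 / A_low k q0 K) <= 1.
    by apply: le_trans (ltW se); rewrite ler_wpM2l ?(ltW s0)// /e lerDr; lra.
  by move: h; rewrite mulrA ler_pdivrMr// mul1r.
have sle1 : sigma <= 1 by apply: le_trans s1; rewrite ler_peMr ?(ltW s0)//; lra.
pose mu := M * sigma.
have mu0 : 0 <= mu by rewrite mulr_ge0 ?(ltW s0)//; lra.
have mu8 : mu <= 1/8.
  have := ler_wpM2l (ltW s0) MM4; rewrite /mu; lra.
have mus : mu ^+ 2 <= sigma.
  have := ler_wpM2l (ltW s0) M24; rewrite /mu exprMn => h.
  have : sigma * (M ^+ 2 * sigma) <= sigma * 1 by apply: ler_wpM2l; [exact: ltW|lra].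
  lra.
have muA : mu ^+ 4 <= A_low k q0 K / 2 * sigma ^+ 2.
  rewrite /mu exprMn (exprD sigma 2 2) mulrA ler_wpM2r ?sqr_ge0//.
  have : sigma * sigma <= sigma * 1 by rewrite ler_wpM2l ?(ltW s0).
  move=> /(ler_wpM2l (le_trans ler01 M4)); rewrite expr2; lra.
have muM : c1 * sigma ^+ 2 <= mu ^+ 2.
  rewrite /mu exprMn ler_wpM2r ?sqr_ge0//; apply: le_trans (_ : M <= _); first by rewrite /M; lra.
  by rewrite -[leLHS]expr1 ler_weXn2l.
pose c0 := - (k.+1%:R * s).
have c0s : `|c0| = k.+1%:R * sigma by rewrite normrN normrM ger0_norm.
have [w ew wsol] := clamped_solution k4 q0_gt0 K_ge1 q_bd b_bd q_der b_der dq_bd db_bd mu0 mu8 c0.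
have vE : vclamp k mu w = (fun r => r * avg k w r).
  by apply/funext; apply: (clamp_inactive k4 q0_gt0 K_ge1 q_bd b_bd q_der b_der dq_bd
    mu0 mu8 ew wsol c0s s0 sle1 mus muM).
have SE : rhs k q b mu w = fun r => q (uclamp k mu w r) * w r +
    b (uclamp k mu w r) * (r * avg k w r) ^+ 2.
  by apply/funext => r; rewrite /rhs vE.
exists (uclamp k mu w), w; move=> v S wd.
have SS : rhs k q b mu w = S by exact: SE.
split.
- split => //; first exact: evenc_uclamp.
  by rewrite -SS; exact: (evenc_rhs k4 q_der b_der).
- split.
  + by rewrite /uclamp prim0 ?addr0//; exact: vclamp_cont.
  + exact: (sol_w0 k4 q_der b_der mu0 mu8 ew wsol).
  + by move=> r; exact: uclamp_near.
- split=> r; first by have := @der_uclamp _ k mu w r ew; rewrite vE.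
  by have := sol_der_w k4 q_der b_der mu0 mu8 ew wsol r; rewrite SS.
- split=> r r0; have nr : r != 0 by rewrite gt_eqF.
    exact: (sol_der_v k ew nr).
  by have := sol_der_wd k4 q_der b_der mu0 mu8 ew nr; rewrite SS.
exists (mu ^+ 2 + A_outer k q0 K * sigma ^+ 2 + A_flux k q0 K * sigma),
  (A_low k q0 K / 2 * sigma ^+ 2); split.
  by rewrite mulr_gt0 ?exprn_gt0// divr_gt0.
move=> r r1; have r0 : 0 <= r by lra.
have t1 := sqr_ge0 mu.
have t2 : 0 <= A_outer k q0 K * sigma ^+ 2 by rewrite /A_outer; nonneg.
have t3 : 0 <= A_flux k q0 K * sigma.
  by apply: mulr_ge0; [rewrite /A_flux /A_der /A_outer; nonneg|exact: ltW].
have en := outer_energy k4 q0_gt0 K_ge1 q_bd b_bd q_der b_der dq_bd mu0 mu8 ew wsol c0s s0 mus r1.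
have el := energy_lower k4 q0_gt0 K_ge1 q_bd b_bd q_der b_der dq_bd mu0 mu8 ew wsol c0s s0 mus r1.
have fl := flux_le k4 q0_gt0 K_ge1 q_bd b_bd q_der b_der dq_bd mu0 mu8 ew wsol c0s s0 sle1 mus r1.
have vl := velocity_le k4 q0_gt0 K_ge1 q_bd b_bd q_der b_der dq_bd mu0 mu8 ew wsol c0s s0 sle1 mus r0.
rewrite /energy SS -/v in en el; rewrite /flux SS in fl.
split.
- have := sqr_ge0 (v r); rewrite -/c1 in vl; rewrite -/(v r) in vl; lra.
- by apply/andP; split; [apply: le_trans el; lra|apply: le_trans en _; lra].
- apply: le_trans fl _; rewrite ler_wpM2r//; lra.
Qed.

End SmallSolutions.

(** * Asymptotics at infinity *)

Section Asymptotics.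
Context {R : realType}.
Implicit Types (f df : R -> R) (r x : R).

Lemma le_of_le_invr (a b C : R) : (forall r, 1 <= r -> a <= b + C / r) -> a <= b.
Proof.
move=> H; apply/ler_addgt0Pr => e e0.
have C0 := normr_ge0 C; pose r := 1 + `|C| / e.
have r1 : 1 <= r by rewrite /r lerDl divr_ge0// ltW.
apply: le_trans (H r r1) _; rewrite lerD2l ler_pdivrMr; last by lra.
rewrite /r mulrDr mulr1 mulrCA divff ?gt_eqF// mulr1.
by have := ler_norm C; lra.
Qed.

(** [- g] is the tail of the integral of the bound. The intervals from [f + g] to [f - g] shrink as
    [r] grows, and their common point is the limit. *)
Lemma der_limit f df (C : R) j :
  (forall r, 1 <= r -> der f r (df r)) ->
  (forall r, 1 <= r -> `|df r| <= C / r ^+ j.+2) ->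
  exists l, forall r, 1 <= r -> `|f r - l| <= C / r ^+ j.+1.
Proof.
move=> Df Cf; have j0 : 0 < j.+1%:R :> R by rewrite ltr0n.
have C0 : 0 <= C by have := le_trans (normr_ge0 _) (Cf 1 (lexx _)); rewrite expr1n divr1.
pose g r := - (C / j.+1%:R) * (r ^+ j.+1)^-1.
have Dg r : 1 <= r -> der g r (C / r ^+ j.+2).
  move=> r1; have nr : r != 0 by rewrite gt_eqF//; lra.
  apply: (derE (derM (der_cst _ _)
    (@derV _ (fun t => t ^+ j.+1) _ _ (expf_neq0 _ nr) (derX j (der_id r))))).
  rewrite !exprS; field.
  by rewrite nr expf_neq0//= gt_eqF// -natr1 in j0 *; rewrite ?gt_eqF.
have H x y : 1 <= x -> x <= y -> `|f y - f x| <= g y - g x.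
  move=> x1 xy; have ge1 z : x <= z <= y -> 1 <= z by move=> /andP[/(le_trans x1)].
  have ge1' z : x < z < y -> 1 <= z by move=> /andP[/(le_lt_trans x1)/ltW].
  apply: (@der_norm_le _ f g df (fun r => C / r ^+ j.+2) x y xy) => z zI.
  - by apply: Df; exact: ge1'.
  - by apply: Dg; exact: ge1'.
  - exact: (der_cont (Df _ (ge1 _ zI))).
  - exact: (der_cont (Dg _ (ge1 _ zI))).
  - by apply: Cf; exact: ge1'.
have gle r : 1 <= r -> 0 <= - g r <= C / r ^+ j.+1.
  move=> r1; have p0 : 0 < r ^+ j.+1 by rewrite exprn_gt0//; lra.
  rewrite /g mulNr opprK divr_ge0 ?(ltW p0) ?divr_ge0 ?(ltW j0)//=.
  rewrite ler_wpM2r ?invr_ge0 ?(ltW p0)// ler_pdivrMr// ler_peMr// ler1n//.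
have [||l Hl] := @nested_point R R (fun r => 1 <= r) (fun r => f r + g r) (fun r => f r - g r).
- by exists 1.
- move=> x y x1 y1; have /andP[gx _] := gle _ x1; have /andP[gy _] := gle _ y1.
  by case: (leP x y) => xy; [have := H _ _ x1 xy|have := H _ _ y1 (ltW xy)];
    rewrite ler_norml => /andP[]; lra.
exists l => r r1; have := Hl r r1; have /andP[_ gr] := gle _ r1.
by rewrite ler_norml => /andP[h1 h2]; apply/andP; split; lra.
Qed.

Lemma sqr_le_norm (x C : R) : x ^+ 2 <= C -> `|x| <= 1 + C.
Proof.
move=> h; have C0 := le_trans (sqr_ge0 x) h.
rewrite -(@ler_pXn2r _ 2)// ?nnegrE ?addr_ge0// real_normK ?num_real//.
by apply: le_trans h _; nra.
Qed.

Lemma der_sqrt_pow k r : 0 < r ->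
  der (fun t => Num.sqrt (t ^+ k)) r (k%:R / 2 * Num.sqrt (r ^+ k) / r).
Proof.
move=> r0; have p0 : 0 < r ^+ k by rewrite exprn_gt0.
have nr : r != 0 by rewrite gt_eqF.
have s0 : Num.sqrt (r ^+ k) != 0 by rewrite gt_eqF// sqrtr_gt0.
apply: (derE (@der_comp _ Num.sqrt (fun t => t ^+ k) _ _ _ (is_derive1_sqrt p0) (der_pow k nr))).
have e := sqr_sqrtr (ltW p0); set s := Num.sqrt _ in e s0 *; rewrite -e.
by field; rewrite nr s0.
Qed.

Lemma der_sin_lin (a x : R) : der (fun t => sin (a * t)) x (a * cos (a * x)).
Proof.
have h : der (fun t => a * t) x a.
  by apply: (derE (derM (der_cst _ _) (der_id _))); ring.
by apply: (derE (@der_comp _ sin _ _ _ _ (is_derive_sin _) h)); ring.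
Qed.

Lemma der_cos_lin (a x : R) : der (fun t => cos (a * t)) x (- (a * sin (a * x))).
Proof.
have h : der (fun t => a * t) x a.
  by apply: (derE (derM (der_cst _ _) (der_id _))); ring.
by apply: (derE (@der_comp _ cos _ _ _ _ (is_derive_cos _) h)); ring.
Qed.

Lemma norm_cos_le1 (x : R) : `|cos x| <= 1.
Proof. by rewrite ler_norml cos_geN1 cos_le1. Qed.

Lemma norm_sin_le1 (x : R) : `|sin x| <= 1.
Proof. by rewrite ler_norml sin_geN1 sin_le1. Qed.

Variables (k : nat) (q dq b : R -> R) (q0 K C d : R) (u v w wd : R -> R).
Hypothesis k4 : (4 <= k)%N.
Hypothesis q0_gt0 : 0 < q0.
Hypothesis q_bd : forall u, unear u -> q0 <= q u <= K.
Hypothesis b_bd : forall u, unear u -> `|b u| <= K.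
Hypothesis q_der : forall u, unear u -> der q u (dq u).
Hypothesis dq_bd : forall u, unear u -> `|dq u| <= K.
Hypothesis un : forall r, unear (u r).
Hypothesis der_u : forall r, der u r (v r).
Hypothesis der_w : forall r, der w r (wd r).
Let S r := q (u r) * w r + b (u r) * v r ^+ 2.
Hypothesis der_wd : forall r, 0 < r -> der wd r (- S r - k%:R / r * wd r).
Hypothesis d_gt0 : 0 < d.
Hypothesis v_bd : forall r, 1 <= r -> r ^+ k * v r ^+ 2 <= C.
Let m : R := k%:R / 2.
Hypothesis energy_bd : forall r, 1 <= r ->
  d <= r ^+ k * ((wd r + m * w r / r) ^+ 2 + q (u r) * w r ^+ 2) <= C.
Hypothesis flux_bd : forall r, 1 <= r ->
  `|r ^+ k * v r + r ^+ k * wd r / q (u r)| <= C * r.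

Let C0 : 0 <= C.
Proof.
have /andP[h1 h2] := energy_bd (lexx 1); apply: le_trans h2.
exact: le_trans (ltW d_gt0) h1.
Qed.

Let K0 : 0 <= K.
Proof. by apply: le_trans (normr_ge0 _) (b_bd (un 0)). Qed.

Let q_gt0 r : 0 < q (u r).
Proof. by have /andP[h _] := q_bd (un r); apply: lt_le_trans h. Qed.

Let iq r : 0 <= (q (u r))^-1 <= q0^-1.
Proof.
have /andP[h _] := q_bd (un r).
by rewrite invr_ge0 (ltW (q_gt0 r)) lef_pV2 ?posrE ?q_gt0.
Qed.

Let der_qu r : der (fun t => q (u t)) r (dq (u r) * v r).
Proof. by apply: der_comp; [exact/q_der/un|exact: der_u]. Qed.

Let pw r := Num.sqrt (r ^+ k).
Let z r := pw r * w r.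
Let y r := pw r * (wd r + m * w r / r).

Let pw_gt0 r : 1 <= r -> 0 < pw r.
Proof. by move=> r1; rewrite sqrtr_gt0 exprn_gt0//; lra. Qed.

Let pw_sq r : 1 <= r -> pw r ^+ 2 = r ^+ k.
Proof. by move=> r1; rewrite sqr_sqrtr// exprn_ge0//; lra. Qed.

Let pow_ge2 r : 1 <= r -> r ^+ 4 <= r ^+ k.
Proof. by move=> r1; rewrite ler_weXn2l. Qed.

Let E1 := C / q0 + C.
Let E1_ge0 : 0 <= E1.
Proof. by rewrite addr_ge0// divr_ge0// ltW. Qed.

Let zy_sq r : 1 <= r -> [/\ z r ^+ 2 <= E1, y r ^+ 2 <= E1 & d <= y r ^+ 2 + q (u r) * z r ^+ 2].
Proof.
move=> r1; have /andP[h1 h2] := energy_bd r1; have /andP[Q0 _] := q_bd (un r).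
have q00 := q0_gt0; have C00 := C0.
rewrite /z /y !exprMn pw_sq//; set P := r ^+ k in h1 h2 *.
have P0 : 0 <= P by rewrite exprn_ge0//; lra.
have a0 := mulr_ge0 P0 (sqr_ge0 (wd r + m * w r / r)).
have w0 := mulr_ge0 P0 (sqr_ge0 (w r)).
have Cq : 0 <= C / q0 by rewrite divr_ge0// ltW.
have t : q0 * (P * w r ^+ 2) <= q (u r) * (P * w r ^+ 2) by rewrite ler_wpM2r.
have t0 : 0 <= q0 * (P * w r ^+ 2) by rewrite mulr_ge0// ltW.
rewrite /E1; split; last by lra.
  by apply: le_trans (_ : C / q0 <= _); [rewrite ler_pdivlMr//; lra|rewrite lerDl].
by lra.
Qed.

Let z_le r : 1 <= r -> `|z r| <= 1 + E1.
Proof. by move=> /zy_sq[h _ _]; exact: sqr_le_norm. Qed.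

Let pwv_le r : 1 <= r -> `|pw r * v r| <= 1 + C.
Proof. by move=> r1; apply: sqr_le_norm; rewrite exprMn pw_sq// v_bd. Qed.

Let pw_ge r : 1 <= r -> r ^+ 2 <= pw r.
Proof.
move=> r1; rewrite -(@ler_pXn2r _ 2)// ?nnegrE ?sqr_ge0 ?(ltW (pw_gt0 r1))// pw_sq//.
by rewrite -exprM pow_ge2.
Qed.

Let div_pw (x c r : R) : 1 <= r -> `|pw r * x| <= c -> `|x| <= c / r ^+ 2.
Proof.
move=> r1; rewrite normrM (gtr0_norm (pw_gt0 r1)) => h.
have r2 : 0 < r ^+ 2 by rewrite exprn_gt0//; lra.
rewrite ler_pdivlMr// (le_trans _ h)// mulrC ler_wpM2r// pw_ge//.
Qed.

Let v_le r : 1 <= r -> `|v r| <= (1 + C) / r ^+ 2.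
Proof. by move=> r1; apply: div_pw => //; exact: pwv_le. Qed.

Let w_le r : 1 <= r -> `|w r| <= (1 + E1) / r ^+ 2.
Proof. by move=> r1; apply: div_pw => //; exact: z_le. Qed.

(** With [q] frozen, the equation says that [w + q u] is harmonic up to quadratic terms; this
    combination therefore carries the non-oscillating part of [u]. *)
Let L r := u r + w r / q (u r).

Let der_L r : der L r (v r + wd r / q (u r) - w r * dq (u r) * v r / q (u r) ^+ 2).
Proof.
have nq : q (u r) != 0 by rewrite gt_eqF.
have D := derD (der_u r) (derM (der_w r) (@derV _ (fun t => q (u t)) _ _ nq (der_qu r))).
by apply: (derE D); field.
Qed.

Let CL := C + K * (1 + E1) * (1 + C) / q0 ^+ 2.

(** The flux divided by [r ^ k] is [O(r ^ (1 - k))], and [w * v] is [O(r ^ -k)]. One integration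
    then produces the exponent [2 - k = 3 - n]. *)
Let der_L_le r : 1 <= r ->
  `|v r + wd r / q (u r) - w r * dq (u r) * v r / q (u r) ^+ 2| <= CL / r ^+ k.-1.
Proof.
move=> r1; have r0 : 0 < r by lra.
have P0 : 0 < r ^+ k.-1 by rewrite exprn_gt0.
have Pk : r ^+ k = r ^+ k.-1 * r by rewrite -exprSr prednK// (leq_trans _ k4).
rewrite ler_pdivlMr// -[X in _ * X <= _](gtr0_norm P0) -normrM.
rewrite -(ler_pM2r r0) -[X in _ * X <= _](gtr0_norm r0) -normrM.
have nq : q (u r) != 0 by rewrite gt_eqF.
have -> : (v r + wd r / q (u r) - w r * dq (u r) * v r / q (u r) ^+ 2) * r ^+ k.-1 * r =
  (r ^+ k * v r + r ^+ k * wd r / q (u r))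
  - dq (u r) * (pw r * w r) * (pw r * v r) * (q (u r))^-1 ^+ 2.
  have -> : dq (u r) * (pw r * w r) * (pw r * v r) = dq (u r) * (w r * v r) * pw r ^+ 2 by ring.
  by rewrite pw_sq// Pk; field.
apply: le_trans (ler_normB _ _) _; rewrite /CL mulrDl; apply: lerD; first exact: flux_bd.
apply: le_trans (_ : K * (1 + E1) * (1 + C) / q0 ^+ 2 <= _); last first.
  have c0 := C0; have k0 := K0; have e0 := E1_ge0; have q00 := q0_gt0.
  by rewrite ler_peMr//; nonneg.
have /andP[i0 i1] := iq r.
rewrite normrM; apply: ler_pM => //.
  rewrite normrM; apply: ler_pM; [by []|by []| |exact: pwv_le].
  rewrite normrM; apply: ler_pM; [by []|by [] |exact: dq_bd |exact: z_le].
rewrite normrX ger0_norm// -exprVn ler_pXn2r// nnegrE//.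
exact: le_trans i1.
Qed.

(** Integrating [v = O(r ^ -2)] only yields [u - l = O(1 / r)]. The rate [r ^ -2], which makes
    [q(u) - q(l)] integrable, comes from [u = L - w / q(u)], where both parts are known to that
    order; the limits of [u] and [L] agree because [w / q(u)] tends to 0. *)
Lemma limit_at_infinity : exists l, [/\ unear l,
  exists Cu, forall r, 1 <= r -> `|u r - l| <= Cu / r ^+ 2 &
  exists Cl, forall r, 1 <= r -> `|u r + w r / q (u r) - l| <= Cl / r ^+ k.-2].
Proof.
have [l Hl] : exists l, forall r, 1 <= r -> `|u r - l| <= (1 + C) / r ^+ 1.
  by apply: (@der_limit u v) => // r r1; exact: v_le.
have [l' Hl'] : exists l, forall r, 1 <= r -> `|L r - l| <= CL / r ^+ k.-2.
  have -> : k.-2 = (k - 3).+1 by case: (k) k4 => [|[|[|j]]]//; rewrite !subSS subn0.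
  apply: (@der_limit L _ CL (k - 3) (fun r _ => der_L r)) => r r1.
  have -> : (k - 3).+2 = k.-1 by case: (k) k4 => [|[|[|j]]]//; rewrite !subSS subn0.
  exact: der_L_le.
have wq r : 1 <= r -> `|w r / q (u r)| <= (1 + E1) / q0 / r ^+ 2.
  move=> r1; have /andP[i0 i1] := iq r.
  rewrite normrM mulrAC; apply: ler_pM => //; first exact: w_le.
  by rewrite ger0_norm.
have inv_r r : 1 <= r -> (r ^+ 2)^-1 <= r^-1.
  move=> r1; rewrite lef_pV2 ?posrE ?exprn_gt0//; [|by lra|by lra].
  by rewrite -[leLHS]expr1 ler_weXn2l.
have CL0 : 0 <= CL by rewrite /CL; have h1 := K0; have h2 := E1_ge0; have h3 := C0; have h4 := q0_gt0; nonneg.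
have invk r : 1 <= r -> (r ^+ k.-2)^-1 <= (r ^+ 2)^-1.
  move=> r1; rewrite lef_pV2 ?posrE ?exprn_gt0//; [|by lra|by lra].
  by rewrite ler_weXn2l//; case: (k) k4 => [|[|[|[|]]]].
have ll : l' = l.
  have h r : 1 <= r -> `|l' - l| <= 0 + (CL + ((1 + E1) / q0 + (1 + C))) / r.
    move=> r1; rewrite add0r [leRHS]mulrDl [X in _ <= _ + X]mulrDl.
    have -> : l' - l = - (L r - l') + (w r / q (u r) + (u r - l)) by rewrite /L; ring.
    apply: le_trans (ler_normD _ _) _; rewrite normrN; apply: lerD.
      apply: le_trans (Hl' _ r1) _; apply: ler_wpM2l => //.
      exact: le_trans (invk _ r1) (inv_r _ r1).
    apply: le_trans (ler_normD _ _) _; apply: lerD; last by have := Hl _ r1; rewrite expr1.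
    apply: le_trans (wq _ r1) _; apply: ler_wpM2l; last exact: inv_r.
    by have h1 := E1_ge0; have h2 := q0_gt0; nonneg.
  by have := le_of_le_invr h; rewrite normr_le0 subr_eq0 => /eqP.
exists l; split.
- apply/andP; split; apply: (@le_of_le_invr _ _ (1 + C)) => r r1;
    have := Hl _ r1; rewrite ler_norml expr1 => /andP[h1 h2];
    have /andP[h3 h4] := un r; lra.
- exists (CL + (1 + E1) / q0) => r r1; rewrite mulrDl.
  have -> : u r - l = (L r - l') - w r / q (u r) by rewrite ll /L; ring.
  apply: le_trans (ler_normB _ _) _; apply: lerD; last exact: wq.
  apply: le_trans (Hl' _ r1) _; apply: ler_wpM2l => //; exact: invk.
- by exists CL; rewrite -ll.
Qed.

Let der_z r : 1 <= r -> der z r (y r).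
Proof.
move=> r1; have r0 : 0 < r by lra.
apply: (derE (derM (der_sqrt_pow k r0) (der_w r))).
by rewrite /y /pw -/m; field; rewrite gt_eqF.
Qed.

Let der_y r : 1 <= r ->
  der y r (pw r * (m * (m - 1) / r ^+ 2 * w r - q (u r) * w r - b (u r) * v r ^+ 2)).
Proof.
move=> r1; have r0 : 0 < r by lra.
have nr : r != 0 by rewrite gt_eqF.
have D1 := derM (derM (der_cst m r) (der_w r)) (derV nr (der_id r)).
apply: (derE (derM (der_sqrt_pow k r0) (derD (der_wd r0) D1))).
have -> : k%:R = 2 * m by rewrite /m; field.
by rewrite /S /pw; field.
Qed.

(** Variation of constants for [z'' + kap ^ 2 * z = g], where [z = r ^ m * w] and [g = O(r ^ -2)] is
    integrable. *)
Lemma oscillation l Cu (kap : R) : unear l -> 0 < kap -> kap ^+ 2 = q l ->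
  (forall r, 1 <= r -> `|u r - l| <= Cu / r ^+ 2) ->
  exists A B Ch : R, ~ (A = 0 /\ B = 0) /\
  forall r, 1 <= r ->
    `|pw r * w r - (A * cos (kap * r) + B * sin (kap * r))| <= Ch / r.
Proof.
move=> ul kap0 kapq Hu.
have nkap : kap != 0 by rewrite gt_eqF.
pose g r := pw r * (m * (m - 1) / r ^+ 2 * w r - q (u r) * w r - b (u r) * v r ^+ 2)
  + kap ^+ 2 * z r.
pose Cg := `|m * (m - 1)| * (1 + E1) + K * Cu * (1 + E1) + K * (1 + C) * (1 + C).
have g_le r : 1 <= r -> `|g r| <= Cg / r ^+ 2.
  move=> r1; have r2 : 0 < r ^+ 2 by rewrite exprn_gt0//; lra.
  have -> : g r = m * (m - 1) * z r / r ^+ 2 - (q (u r) - q l) * z r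
      - b (u r) * (pw r * v r) * v r.
    by rewrite /g /z kapq; field; rewrite gt_eqF//; lra.
  rewrite /Cg [leRHS]mulrDl [X in _ <= X + _]mulrDl; apply: le_trans (ler_normB _ _) _; apply: lerD.
    apply: le_trans (ler_normB _ _) _; apply: lerD.
      rewrite normrM normfV (gtr0_norm r2) ler_wpM2r ?invr_ge0 ?(ltW r2)//.
      by rewrite normrM ler_wpM2l// z_le.
    rewrite normrM mulrAC; apply: ler_pM => //; last exact: z_le.
    apply: le_trans (unear_lip q_der dq_bd (un r) ul) _; rewrite -mulrA ler_wpM2l//.
    exact: Hu.
  rewrite normrM -[leRHS]mulrA; apply: ler_pM => //; last exact: v_le.
  by rewrite normrM; apply: ler_pM => //; [exact: b_bd|exact: pwv_le].
(* Coordinates of [(z, z' / kap)] in the frame that rotates with the free oscillation; their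
   derivatives contain [g] alone. *)
pose a r := z r * cos (kap * r) - y r / kap * sin (kap * r).
pose bb r := z r * sin (kap * r) + y r / kap * cos (kap * r).
have Da r : 1 <= r -> der a r (- (g r * sin (kap * r) / kap)).
  move=> r1; have nr : r != 0 by rewrite gt_eqF//; lra.
  have Dy := derM (der_y r1) (der_cst kap^-1 r).
  apply: (derE (derB (derM (der_z r1) (der_cos_lin kap r)) (derM Dy (der_sin_lin kap r)))).
  by rewrite /g; field; rewrite ?nr ?nkap.
have Db r : 1 <= r -> der bb r (g r * cos (kap * r) / kap).
  move=> r1; have nr : r != 0 by rewrite gt_eqF//; lra.
  have Dy := derM (der_y r1) (der_cst kap^-1 r).
  apply: (derE (derD (derM (der_z r1) (der_sin_lin kap r)) (derM Dy (der_cos_lin kap r)))).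
  by rewrite /g; field; rewrite ?nr ?nkap.
have gk (r t : R) : 1 <= r -> `|t| <= 1 -> `|g r * t / kap| <= Cg / kap / r ^+ 2.
  move=> r1 t1; rewrite normrM normfV (gtr0_norm kap0) mulrAC ler_wpM2r ?invr_ge0 ?(ltW kap0)//.
  by rewrite normrM -[leRHS]mulr1; apply: ler_pM => //; exact: g_le.
have ga r : 1 <= r -> `|- (g r * sin (kap * r) / kap)| <= Cg / kap / r ^+ 2.
  by move=> r1; rewrite normrN; apply: gk => //; exact: norm_sin_le1.
have gb r : 1 <= r -> `|g r * cos (kap * r) / kap| <= Cg / kap / r ^+ 2.
  by move=> r1; apply: gk => //; exact: norm_cos_le1.
have [A HA] := der_limit Da ga; have [B HB] := der_limit Db gb.
set c := Cg / kap in HA HB.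
exists A, B, (c + c); split.
  (* If both limits vanished, [a] and [bb] would be [O(1 / r)]. The rotation preserves
     [z ^ 2 + (z' / kap) ^ 2], so the energy would tend to 0, against its lower bound [d]. *)
  move=> [A0 B0]; subst A B.
  have c0 : 0 <= c.
    by have := le_trans (normr_ge0 _) (HA 1 (lexx _)); rewrite expr1n divr1.
  suff : d <= 0 by rewrite leNgt d_gt0.
  apply: (@le_of_le_invr _ _ ((kap ^+ 2 + K) * (2 * c ^+ 2))) => r r1; rewrite add0r.
  have [_ _ h] := zy_sq r1; apply: le_trans h _.
  have r0 : 0 < r by lra.
  have i1 : 0 <= r^-1 <= 1 by rewrite invr_ge0 (ltW r0) invf_le1.
  have cs := cos2Dsin2 (kap * r).
  have sq (t : R) : `|t - 0| <= c / r ^+ 1 -> t ^+ 2 <= c ^+ 2 / r.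
    rewrite subr0 expr1 => ht; rewrite -[t ^+ 2]real_normK ?num_real//.
    apply: le_trans (_ : (c / r) ^+ 2 <= _).
      by rewrite ler_pXn2r// nnegrE (le_trans _ ht).
    rewrite exprMn ler_wpM2l ?sqr_ge0//; move: i1 => /andP[i0 i1].
    by rewrite expr2 ler_piMr.
  have ha := sq _ (HA r r1); have hb := sq _ (HB r r1).
  have e : z r ^+ 2 + (y r / kap) ^+ 2 = a r ^+ 2 + bb r ^+ 2.
    rewrite /a /bb -[LHS]mulr1 -cs; ring.
  have yk : y r ^+ 2 = kap ^+ 2 * (y r / kap) ^+ 2 by field.
  have /andP[_ QK] := q_bd (un r).
  have s1 := sqr_ge0 (z r); have s2 := sqr_ge0 (y r / kap).
  have t1 : q (u r) * z r ^+ 2 <= K * (2 * c ^+ 2 / r).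
    by apply: ler_pM => //; [exact: ltW|lra].
  have t2 : kap ^+ 2 * (y r / kap) ^+ 2 <= kap ^+ 2 * (2 * c ^+ 2 / r).
    by apply: ler_wpM2l; [exact: sqr_ge0|lra].
  by rewrite yk; lra.
move=> r r1; rewrite -/(z r).
have cs := cos2Dsin2 (kap * r).
have -> : z r - (A * cos (kap * r) + B * sin (kap * r)) =
   (a r - A) * cos (kap * r) + (bb r - B) * sin (kap * r).
  by rewrite /a /bb -{1}[z r]mulr1 -cs; ring.
apply: le_trans (ler_normD _ _) _; rewrite [leRHS]mulrDl; apply: lerD;
  rewrite normrM -[leRHS]mulr1; apply: ler_pM => //.
- by have := HA r r1; rewrite expr1.
- exact: norm_cos_le1.
- by have := HB r r1; rewrite expr1.
- exact: norm_sin_le1.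
Qed.

(** [u - L] is exactly [- w / q(u)], and replacing [q(u)] by [q(l) = kap ^ 2] costs [O(1 / r)];
    hence the division of the coefficients of [w] by [- kap ^ 2]. *)
Lemma profile_expansion l Cu (kap A B Ch : R) : unear l -> 0 < kap -> kap ^+ 2 = q l ->
  (forall r, 1 <= r -> `|u r - l| <= Cu / r ^+ 2) ->
  (forall r, 1 <= r ->
    `|pw r * w r - (A * cos (kap * r) + B * sin (kap * r))| <= Ch / r) ->
  exists Ch', forall r, 1 <= r ->
    `|pw r * (u r - (u r + w r / q (u r)))
      - (- A / kap ^+ 2 * cos (kap * r) + - B / kap ^+ 2 * sin (kap * r))| <= Ch' / r.
Proof.
move=> ul kap0 kapq Hu Hw.
have nkap : kap != 0 by rewrite gt_eqF.
have k2 : 0 < kap ^+ 2 by rewrite exprn_gt0.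
exists (Ch / kap ^+ 2 + (1 + E1) * (K * Cu) / (kap ^+ 2 * q0)) => r r1.
have r0 : 0 < r by lra.
have nq : q (u r) != 0 by rewrite gt_eqF.
have -> : pw r * (u r - (u r + w r / q (u r)))
      - (- A / kap ^+ 2 * cos (kap * r) + - B / kap ^+ 2 * sin (kap * r)) =
  - ((pw r * w r - (A * cos (kap * r) + B * sin (kap * r))) / kap ^+ 2)
   + z r * (q (u r) - q l) * ((kap ^+ 2)^-1 * (q (u r))^-1).
  by rewrite /z -kapq; field; rewrite nq.
apply: le_trans (ler_normD _ _) _; rewrite [leRHS]mulrDl; apply: lerD.
  rewrite normrN normrM normfV (gtr0_norm k2) mulrAC ler_wpM2r ?invr_ge0 ?(ltW k2)//.
  exact: Hw.
have /andP[i0 i1] := iq r.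
rewrite normrM [leRHS]mulrAC; apply: ler_pM => //.
  rewrite normrM -[leRHS]mulrA; apply: ler_pM => //; first exact: z_le.
  apply: le_trans (unear_lip q_der dq_bd (un r) ul) _; rewrite -mulrA ler_wpM2l//.
  apply: le_trans (Hu r r1) _.
  have Cu0 : 0 <= Cu.
    by have := le_trans (normr_ge0 _) (Hu 1 (lexx _)); rewrite expr1n divr1.
  rewrite ler_wpM2l// lef_pV2 ?posrE ?exprn_gt0//.
  by rewrite -[leLHS]expr1 ler_weXn2l.
have ik : 0 <= (kap ^+ 2)^-1 by rewrite invr_ge0 ltW.
by rewrite ger0_norm ?mulr_ge0// [leRHS]invfM ler_wpM2l.
Qed.

(** Shows that the gradient term in the Laplacian of [u ^ p] is of lower order than the oscillation
    of [w]. *)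
Lemma velocity_sq_le r : 1 <= r -> `|pw r * v r ^+ 2| <= (1 + C) * (1 + C) / r.
Proof.
move=> r1; have r0 : 0 < r by lra.
rewrite expr2 mulrA normrM -mulrA; apply: ler_pM => //; first exact: pwv_le.
apply: le_trans (v_le r1) _; have c0 := C0.
rewrite ler_wpM2l ?addr_ge0// lef_pV2 ?posrE ?exprn_gt0//.
by rewrite -[leLHS]expr1 ler_weXn2l.
Qed.

End Asymptotics.

(** * Sign changes of oscillating functions *)

Section SignChanges.
Context {R : realType}.

Lemma cos_shift (t : R) i : cos (t + i%:R * pi) = (-1) ^+ i * cos t.
Proof.
elim: i => [|i IH]; first by rewrite mul0r addr0 mul1r.
by rewrite -natr1 mulrDl mul1r addrA cosDpi IH exprS mulN1r mulNr.
Qed.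

Lemma sin_shift (t : R) i : sin (t + i%:R * pi) = (-1) ^+ i * sin t.
Proof.
elim: i => [|i IH]; first by rewrite mul0r addr0 mul1r.
by rewrite -natr1 mulrDl mul1r addrA sinDpi IH exprS mulN1r mulNr.
Qed.

(** A positive weight [rho] does not affect the sign of [g], and the Laplacians of [u] and of
    [u ^ p] call for different weights. *)
Lemma oscillation_sign_changes (g rho : R -> R) (kap A B C : R) :
  0 < kap -> ~ (A = 0 /\ B = 0) -> (forall r, 1 <= r -> 0 < rho r) ->
  (forall r, 1 <= r ->
     `|rho r * g r - (A * cos (kap * r) + B * sin (kap * r))| <= C / r) ->
  infinitely_many_sign_changes g.
Proof.
move=> kap0 nAB rho0 Hg N.
(* A phase at which the trigonometric part is nonzero: along its translates by multiples of [pi]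
   that part alternates with constant amplitude [|c|]. *)
have [t [c [t0 c0 Hc]]] : exists t c : R, [/\ 0 <= t, c != 0 &
    forall i, A * cos (t + i%:R * pi) + B * sin (t + i%:R * pi) = (-1) ^+ i * c].
  have [A0|A0] := eqVneq A 0.
    exists (pi / 2), B; split; first by rewrite divr_ge0// pi_ge0.
      by apply/eqP => B0; apply: nAB.
    by move=> i; rewrite cos_shift sin_shift cos_pihalf sin_pihalf A0; ring.
  by exists 0, A; split=> // i; rewrite cos_shift sin_shift cos0 sin0; ring.
have ac : 0 < `|c| by rewrite normr_gt0.
(* From this index on, [pi >= 1] gives [r i > 1 + |C| / |c|], so the error [C / r i] is below the
   amplitude [|c|]. *)
pose i0 := (Num.trunc (kap * (1 + `|C| / `|c|))).+1.
pose r i := (t + (i0 + i)%:R * pi) / kap.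
have r_ge i : 1 + `|C| / `|c| < r i.
  rewrite /r ltr_pdivlMr// mulrC; apply: lt_le_trans (truncnS_gt _) _; rewrite -/i0.
  apply: le_trans (_ : (i0 + i)%:R * 1 <= _); first by rewrite mulr1 ler_nat leq_addr.
  apply: le_trans (_ : (i0 + i)%:R * pi <= _); last by rewrite lerDr.
  by rewrite ler_wpM2l//; have := pi_ge2 R; lra.
have Cc : 0 <= `|C| / `|c| by rewrite divr_ge0.
have r1 i : 1 <= r i by have := r_ge i; lra.
have key i : 0 < ((-1) ^+ (i0 + i) * c) * g (r i).
  have ri0 : 0 < r i by have := r1 i; lra.
  have := Hg (r i) (r1 i); have e : kap * r i = t + (i0 + i)%:R * pi.
    by rewrite /r mulrC divfK// gt_eqF.
  rewrite e Hc; set s := _ * c; set G := rho (r i) * g (r i) => h.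
  have sc : `|s| = `|c| by rewrite /s normrM normrX normrN1 expr1n mul1r.
  have Cs : C / r i < `|s|.
    rewrite ltr_pdivrMr// sc; have := r_ge i; rewrite -(ltr_pM2l ac) mulrDr mulr1.
    rewrite mulrCA divff ?gt_eqF// mulr1; have := ler_norm C; lra.
  have s2 : 0 < s * G.
    have sG : `|G - s| < `|s| := le_lt_trans h Cs.
    have -> : s * G = s ^+ 2 + s * (G - s) by ring.
    have h1 : `|s * (G - s)| < s ^+ 2.
      by rewrite normrM -[s ^+ 2]real_normK ?num_real// expr2 ltr_pM2l// sc.
    by move: h1; rewrite ltr_norml => /andP[]; lra.
  have rg := rho0 _ (r1 i); rewrite -(pmulr_rgt0 _ rg).
  by move: s2; rewrite /G mulrCA.
exists r; split; first by have := r1 0%N; lra.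
move=> i _; split.
  rewrite /r ltr_pM2r ?invr_gt0// ltrD2l ltr_pM2r ?pi_gt0//.
  by rewrite ltr_nat addnS.
have h1 := key i; have := key i.+1; rewrite addnS exprS !mulN1r mulNr.
move=> h2; have := mulr_gt0 h1 h2; set s := _ * c.
have -> : s * g (r i) * (- s * g (r i.+1)) = s ^+ 2 * - (g (r i) * g (r i.+1)) by ring.
have ss : 0 < s ^+ 2.
  by rewrite exprn_even_gt0//= mulf_neq0// signr_eq0.
by rewrite pmulr_rgt0// oppr_gt0.
Qed.

Lemma cvg_of_le_invr (h : R -> R) (l C : R) :
  (forall r, 1 <= r -> `|h r - l| <= C / r) -> h r @[r --> +oo] --> l.
Proof.
move=> H; apply/cvgrPdist_le => e e0; near=> r.
have r1 : 1 <= r by near: r; apply: nbhs_pinfty_ge; rewrite num_real.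
have rC : `|C| / e <= r by near: r; apply: nbhs_pinfty_ge; rewrite num_real.
have r0 : 0 < r by lra.
rewrite distrC (le_trans (H r r1))// ler_pdivrMr//.
by move: rC; rewrite ler_pdivrMr// mulrC; apply: le_trans; exact: ler_norm.
Unshelve. all: by end_near. Qed.

End SignChanges.

(** * Even profiles as functions of the squared radius *)

Section EvenClasses.
Context {R : realType}.
Implicit Types (f g w : R -> R) (r x : R) (j k : nat).

(* [evenC j f]: the even function [f] is [j] times differentiable with respect to
   [r ^ 2] (up to the factor 2), with continuous derivatives. *)
Fixpoint evenC j f : Prop :=
  evenc f /\
  (if j is j'.+1 then exists g, evenC j' g /\ forall r, der f r (r * g r) else True).

Lemma evenC_evenc j f : evenC j f -> evenc f.
Proof. by case: j => [|j] []. Qed.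

Lemma evenCS j f : evenC j.+1 f -> evenC j f.
Proof.
elim: j f => [|j IH] f [ef [g [Cg Dg]]]; first by split.
by split=> //; exists g; split => //; exact: IH.
Qed.

Lemma evenC_cst j (c : R) : evenC j (fun=> c).
Proof.
elim: j c => [|j IH] c; split => //; try by split=> //; exact: cont_cst.
by exists (fun=> 0); split=> // r; rewrite mulr0; exact: der_cst.
Qed.

Lemma evencD f g : evenc f -> evenc g -> evenc (fun r => f r + g r).
Proof. by move=> [cf ef] [cg eg]; split; [exact: contD|move=> x; rewrite ef eg]. Qed.

Lemma evencM f g : evenc f -> evenc g -> evenc (fun r => f r * g r).
Proof. by move=> [cf ef] [cg eg]; split; [exact: contM|move=> x; rewrite ef eg]. Qed.

Lemma evenCD j f g : evenC j f -> evenC j g -> evenC j (fun r => f r + g r).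
Proof.
elim: j f g => [|j IH] f g [ef Hf] [eg Hg]; split => //; try exact: evencD.
case: Hf Hg => [f' [Cf Df]] [g' [Cg Dg]].
exists (fun r => f' r + g' r); split; first exact: IH.
by move=> r; rewrite mulrDr; exact: derD.
Qed.

Lemma evenCM j f g : evenC j f -> evenC j g -> evenC j (fun r => f r * g r).
Proof.
elim: j f g => [|j IH] f g Hf Hg; split => //.
- exact: evencM Hf.1 Hg.1.
- exact: evencM Hf.1 Hg.1.
have Cf0 := evenCS Hf; have Cg0 := evenCS Hg.
case: Hf Hg => [ef [f' [Cf Df]]] [eg [g' [Cg Dg]]].
exists (fun r => f' r * g r + f r * g' r); split; first by apply: evenCD; exact: IH.
by move=> r; apply: (derE (derM (Df r) (Dg r))); ring.
Qed.

Lemma evenC_sqr j : evenC j (fun r => r ^+ 2).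
Proof.
have e : evenc (fun r : R => r ^+ 2).
  by split; [exact: contX cont_id|move=> x; rewrite sqrrN].
case: j => [|j]; split => //; exists (fun=> 2); split; first exact: evenC_cst.
by move=> r; apply: (derE (derX 1 (der_id r))); ring.
Qed.

Lemma evenC_powR j f (a : R) : (forall r, 0 < f r) -> evenC j f ->
  evenC j (fun r => f r `^ a).
Proof.
move=> f0; elim: j a => [|j IH] a Hf.
  have [[cf ef] _] := Hf; split => //; split; last by move=> x; rewrite ef.
  move=> x; apply: (@continuous_comp _ _ _ f (fun y => y `^ a)); first exact: cf.
  by apply: (@der_cont _ (fun y => y `^ a)); exact: is_derive1_powR.
have ea := (IH a (evenCS Hf)); split; first exact: evenC_evenc ea.
case: (Hf) => _ [g [Cg Dg]].
exists (fun r => a * (f r `^ (a - 1) * g r)); split.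
  by apply: evenCM; [exact: evenC_cst|apply: evenCM => //; apply: IH; exact: evenCS].
by move=> r; apply: (derE (der_powR a (f0 r) (Dg r))); ring.
Qed.

Lemma evenCN j f : evenC j f -> evenC j (fun r => - f r).
Proof.
move=> Hf; have -> : (fun r => - f r) = (fun r => -1 * f r).
  by apply/funext => r; rewrite mulN1r.
by apply: evenCM => //; exact: evenC_cst.
Qed.

(* Both sides have the same primitive after multiplication by [r ^ k.+1]. *)
Lemma avg_recurrence k w h r : evenc w -> evenc h ->
  (forall r, der w r (r * h r)) ->
  w r = k.+1%:R * avg k w r + r ^+ 2 * avg k.+2 h r.
Proof.
move=> ew eh Dw.
pose D r := w r - k.+1%:R * avg k w r - r ^+ 2 * avg k.+2 h r.
suff : D r = 0 by rewrite /D; lra.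
have rD x : x ^+ k.+1 * D x = 0.
  have E t : t ^+ k.+1 * w t - k.+1%:R * (t ^+ k.+1 * avg k w t) -
      t ^+ k.+3 * avg k.+2 h t = t ^+ k.+1 * D t by rewrite /D !exprS; ring.
  have := @der0_eq _ (fun t => t ^+ k.+1 * D t) x 0; rewrite expr0n mul0r; apply=> t.
  apply: (der_ext E).
  apply: (derE (derB (derB (derM (derX k (der_id t)) (Dw t))
    (derM (der_cst _ _) (der_avg k t ew.1))) (der_avg k.+2 t eh.1))).
  by rewrite !exprS; ring.
have D0 x : x != 0 -> D x = 0.
  by move=> x0; have /eqP := rD x; rewrite mulf_eq0 expf_eq0 /= (negPf x0) => /eqP.
have [->|] := eqVneq r 0; last exact: D0.
apply: (@eq_at_limit _ D) => //.
have : continuous D; last by apply.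
apply: contB; first apply: contB; first exact: ew.1.
  by apply: contM; [exact: cont_cst|exact: avg_cont].
by apply: contM; [exact: contX cont_id|exact: avg_cont].
Qed.

(** Away from 0 the recurrence identifies the derivative of the quotient. At 0 it is solved for
    [avg k w]: the term with [h] has two factors [t], so continuity of the average of [h]
    suffices. *)
Lemma der_avg_even k w h r : evenc w -> evenc h ->
  (forall r, der w r (r * h r)) -> der (avg k w) r (r * avg k.+2 h r).
Proof.
move=> ew eh Dw; have [->|r0] := eqVneq r 0; last first.
  have D : der (fun t => t ^+ k.+1 * avg k w t) r (r ^+ k.+1 * (w r / r)).
    by apply: (derE (der_avg k r ew.1)); rewrite exprS; field.
  apply: (derE (der_div_pow r0 D)); rewrite (avg_recurrence k r ew eh Dw).
  by field.
rewrite mul0r; have k0 : k.+1%:R != 0 :> R by rewrite pnatr_eq0.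
apply: (@der_ext _ (fun t => (w t - t * (t * avg k.+2 h t)) / k.+1%:R)) => [t|].
  by rewrite {1}(avg_recurrence k t ew eh Dw); field.
have ct : {for 0, continuous (fun t : R => t * avg k.+2 h t)}.
  by have : continuous (fun t : R => t * avg k.+2 h t); [apply: cont_idM; exact: avg_cont|exact].
have Dt := der_mul_id0 ct.
apply: (derE (derM (derB (Dw 0) Dt) (der_cst _ _))).
by rewrite !mul0r subrr !mul0r mulr0 addr0.
Qed.

(** Differentiation raises the index of the average by 2 and replaces [w] by [h], hence an induction
    on [j] for all [k] at once. *)
Lemma evenC_avg j k w : evenC j w -> evenC j (avg k w).
Proof.
elim: j k w => [|j IH] k w Hw; split => //.
- by apply: evenc_avg; exact: Hw.1.
- by apply: evenc_avg; exact: Hw.1.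
case: Hw => ew [h [Ch Dw]]; exists (avg k.+2 h); split; first exact: IH.
by move=> r; apply: der_avg_even => //; exact: evenC_evenc Ch.
Qed.

End EvenClasses.

(** * Radial functions on the Euclidean space *)

Section RadialFunctions.
Context {R : realType} {n : nat}.
Implicit Types (f g h : R -> R) (F G : 'rV[R]_n -> R) (x : 'rV[R]_n) (i : 'I_n).

Definition lift f : 'rV[R]_n -> R := fun x => f (enorm x).

Lemma is_derive_line F x (v : 'rV[R]_n) (d : R) :
  der (fun t => F (t *: v + x)) 0 d -> is_derive x v F d.
Proof.
move=> [h1 h2]; split; first by apply/derivable1P.
rewrite -h2 /derive; set g1 := fun t => t^-1 *: _; set g2 := fun t => t^-1 *: _.
suff -> : g1 = g2 by [].
by apply/funext => t; rewrite /g1 /g2 /= addr0 scale0r add0r [_%:A]mulr1.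
Qed.

Lemma enorm_sq x : enorm x ^+ 2 = \sum_(i < n) x 0 i ^+ 2.
Proof. by rewrite sqr_sqrtr// sumr_ge0// => i _; exact: sqr_ge0. Qed.

Lemma enorm_ge0 x : 0 <= enorm x.
Proof. exact: sqrtr_ge0. Qed.

Lemma enorm_eq0 x : enorm x = 0 -> x = 0.
Proof.
move=> x0; have : \sum_(i < n) x 0 i ^+ 2 = 0 by rewrite -enorm_sq x0 expr0n.
move=> /eqP; rewrite psumr_eq0 => [|i _]; last exact: sqr_ge0.
move=> /allP H; apply/rowP => i; rewrite mxE; apply/eqP.
by have := H i; rewrite mem_index_enum sqrf_eq0 => /(_ isT).
Qed.

Lemma enorm_line x i (t : R) :
  enorm (t *: delta_mx 0 i + x) = Num.sqrt (enorm x ^+ 2 + 2 * t * x 0 i + t ^+ 2).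
Proof.
rewrite enorm_sq /enorm; congr Num.sqrt.
rewrite (bigD1 i)//= [in RHS](bigD1 i)//= !mxE !eqxx mulr1.
have -> : \sum_(j < n | j != i) ((t *: delta_mx 0 i + x) 0 j) ^+ 2 =
    \sum_(j < n | j != i) x 0 j ^+ 2.
  by apply: eq_bigr => j /negPf ji; rewrite !mxE eqxx ji mulr0 add0r.
by ring.
Qed.

(** Writing [f' = r * g] cancels the [1 / |x|] in the gradient of the norm, so the formula is
    regular at the origin; there the restriction of [lift f] to the axis is [f] itself, by
    evenness. *)
Lemma is_derive_lift f g x i : evenc f -> (forall r, der f r (r * g r)) ->
  is_derive x (delta_mx 0 i) (lift f) (x 0 i * g (enorm x)).
Proof.
move=> [cf ef] Df; apply: is_derive_line.
apply: (@der_ext _ (fun t => f (Num.sqrt (enorm x ^+ 2 + 2 * t * x 0 i + t ^+ 2)))) => [t|].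
  by rewrite -enorm_line.
have [x0|nx0] := eqVneq (enorm x) 0.
  rewrite x0 (enorm_eq0 x0) mxE mul0r.
  apply: (@der_ext _ f) => [t|]; last by have := Df 0; rewrite mul0r.
  rewrite mulr0 expr0n/= !add0r sqrtr_sqr.
  by case: (leP 0 t) => t0; [rewrite ger0_norm|rewrite ltr0_norm// ef].
have N0 : 0 < enorm x by rewrite lt_neqAle eq_sym nx0 enorm_ge0.
have a0 : enorm x ^+ 2 + 2 * 0 * x 0 i + 0 ^+ 2 = enorm x ^+ 2 by ring.
have s0 : Num.sqrt (enorm x ^+ 2 + 2 * 0 * x 0 i + 0 ^+ 2) = enorm x.
  by rewrite a0 sqrtr_sqr gtr0_norm.
have Dq : der (fun t => enorm x ^+ 2 + 2 * t * x 0 i + t ^+ 2) 0 (2 * x 0 i).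
  apply: (derE (derD (derD (der_cst _ _) (derM (derM (der_cst 2 0) (der_id 0)) (der_cst _ 0)))
    (derX 1 (der_id 0)))).
  by ring.
have Ds : der (fun t => Num.sqrt (enorm x ^+ 2 + 2 * t * x 0 i + t ^+ 2)) 0
    (x 0 i / enorm x).
  have p0 : 0 < enorm x ^+ 2 + 2 * 0 * x 0 i + 0 ^+ 2 by rewrite a0 exprn_gt0.
  apply: (derE (@der_comp _ Num.sqrt (fun t => enorm x ^+ 2 + 2 * t * x 0 i + t ^+ 2) 0 _ _
    (is_derive1_sqrt p0) Dq)).
  by rewrite s0; field.
have D1 : der f (Num.sqrt (enorm x ^+ 2 + 2 * 0 * x 0 i + 0 ^+ 2)) (enorm x * g (enorm x)).
  by rewrite s0; exact: Df.
by apply: (derE (@der_comp _ f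
  (fun t => Num.sqrt (enorm x ^+ 2 + 2 * t * x 0 i + t ^+ 2)) 0 _ _ D1 Ds)); field.
Qed.

Lemma partialE F G i : (forall x, is_derive x (delta_mx 0 i) F (G x)) -> partial i F = G.
Proof. by move=> D; apply/funext => x; rewrite /partial; have [_ ->] := D x. Qed.

Lemma is_derive_coord i j x : is_derive x (delta_mx 0 j) (fun y : 'rV[R]_n => y 0 i) ((i == j)%:R).
Proof.
apply: is_derive_line.
apply: (@der_ext _ (fun t => t * (i == j)%:R + x 0 i)) => [t|].
  by rewrite !mxE eqxx.
by apply: (derE (derD (derM (der_id _) (der_cst _ _)) (der_cst _ _))); ring.
Qed.

Lemma is_derive_mulR F G x v (a b : R) : is_derive x v F a -> is_derive x v G b ->
  is_derive x v (fun y => F y * G y) (F x * b + G x * a).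
Proof. by move=> Fa Gb; exact: is_deriveM. Qed.

Lemma CclassW m F : Cclass m.+1 F -> Cclass m F.
Proof.
elim: m F => [|m IH] F; first by case.
by move=> [cF dF HF]; split => // i; apply: IH; exact: HF.
Qed.

Lemma Cclass_cst m (c : R) : Cclass m (fun _ : 'rV[R]_n => c).
Proof.
elim: m c => [|m IH] c /=; first by move=> x; exact: cst_continuous.
split; [by move=> x; exact: cst_continuous|by move=> i x; exact: derivable_cst|].
move=> i; have H (x : 'rV[R]_n) : is_derive x (delta_mx 0 i) (fun _ : 'rV[R]_n => c) 0.
  exact: is_derive_cst.
by rewrite (partialE H); exact: IH.
Qed.

Lemma Cclass_coord m i : Cclass m (fun x : 'rV[R]_n => x 0 i).
Proof.
case: m => [|m] /=; first by move=> x; exact: coord_continuous.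
split; first by move=> x; exact: coord_continuous.
  by move=> j x; have [] := is_derive_coord i j x.
by move=> j; rewrite (partialE (is_derive_coord i j)); exact: Cclass_cst.
Qed.

Lemma CclassD m F G : Cclass m F -> Cclass m G -> Cclass m (fun x => F x + G x).
Proof.
elim: m F G => [|m IH] F G /=.
  by move=> cF cG x; apply: continuousD; [exact: cF|exact: cG].
move=> [cF dF HF] [cG dG HG]; split.
- by move=> x; apply: continuousD; [exact: cF|exact: cG].
- by move=> i x; apply: derivableD.
move=> i; have H x : is_derive x (delta_mx 0 i) (fun x => F x + G x)
    (partial i F x + partial i G x) by apply: is_deriveD; apply: derivableP.
by rewrite (partialE H); exact: IH.
Qed.

Lemma CclassM m F G : Cclass m F -> Cclass m G -> Cclass m (fun x => F x * G x).
Proof.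
elim: m F G => [|m IH] F G.
  by move=> cF cG x; apply: continuousM; [exact: cF|exact: cG].
move=> HF' HG'; have F0 := CclassW HF'; have G0 := CclassW HG'.
move: HF' HG' => [cF dF HF] [cG dG HG]; split.
- by move=> x; apply: continuousM; [exact: cF|exact: cG].
- by move=> i x; apply: derivableM.
move=> i; have H x : is_derive x (delta_mx 0 i) (fun x => F x * G x)
    (F x * partial i G x + G x * partial i F x) by apply: is_derive_mulR; apply: derivableP.
rewrite (partialE H); apply: CclassD.
  exact: (IH F _ F0 (HG i)).
exact: (IH G _ G0 (HF i)).
Qed.

Lemma enorm_continuous : continuous (fun x : 'rV[R]_n => enorm x).
Proof.
move=> x; apply: (@continuous_comp _ _ _ (fun x : 'rV[R]_n => \sum_(i < n) x 0 i ^+ 2) Num.sqrt);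
  last exact: sqrt_continuous.
have : continuous (fun x : 'rV[R]_n => \sum_(i < n) x 0 i ^+ 2); last by apply.
have H (s : seq 'I_n) : Cclass 0 (fun x : 'rV[R]_n => \sum_(i <- s) x 0 i ^+ 2).
  elim: s => [|i s IH].
    have -> : (fun x : 'rV[R]_n => \sum_(i <- [::]) x 0 i ^+ 2) = (fun=> 0).
      by apply/funext => y; rewrite big_nil.
    exact: Cclass_cst.
  have -> : (fun x : 'rV[R]_n => \sum_(j <- i :: s) x 0 j ^+ 2) =
      (fun x => x 0 i * x 0 i + \sum_(j <- s) x 0 j ^+ 2).
    by apply/funext => y; rewrite big_cons expr2.
  by apply: CclassD => //; apply: CclassM; exact: Cclass_coord.
exact: H.
Qed.

Lemma lift_continuous f : evenc f -> continuous (lift f).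
Proof.
move=> [cf _] x; apply: (@continuous_comp _ _ _ (fun x : 'rV[R]_n => enorm x) f).
  exact: enorm_continuous.
exact: cf.
Qed.

Lemma Cclass_lift m f : evenC m f -> Cclass m (lift f).
Proof.
elim: m f => [|m IH] f [ef Hf]; first exact: lift_continuous.
case: Hf => g [Cg Dg]; split; first exact: lift_continuous.
  by move=> i x; have [] := is_derive_lift x i ef Dg.
move=> i; rewrite (partialE (fun x => is_derive_lift x i ef Dg)).
by apply: CclassM; [exact: Cclass_coord|exact: IH].
Qed.

(** For [g = avg k w] and [n = k.+1] the right-hand side is the sum that [avg_recurrence] identifies
    with [w]. *)
Lemma laplacian_lift f g h : evenc f -> evenc g ->
  (forall r, der f r (r * g r)) -> (forall r, der g r (r * h r)) ->
  laplacian (lift f) = lift (fun r => n%:R * g r + r ^+ 2 * h r).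
Proof.
move=> ef eg Df Dg; apply/funext => x; rewrite /laplacian.
have P2 i : partial i (partial i (lift f)) x = g (enorm x) + x 0 i ^+ 2 * h (enorm x).
  rewrite (partialE (fun x => is_derive_lift x i ef Df)).
  have H y : is_derive y (delta_mx 0 i) (fun x => x 0 i * lift g x)
      (y 0 i * (y 0 i * h (enorm y)) + lift g y * (i == i)%:R).
    by apply: is_derive_mulR; [exact: is_derive_coord|exact: is_derive_lift].
  by rewrite (partialE H) eqxx mulr1 /lift mulrA -expr2 addrC.
rewrite (eq_bigr _ (fun i _ => P2 i)) big_split/= sumr_const card_ord -mulr_suml -enorm_sq.
by rewrite /lift mulr_natl.
Qed.

Lemma profile_lift f : (0 < n)%N -> (forall r, f (- r) = f r) -> profile (lift f) = f.
Proof.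
move=> n0 ef; apply/funext => r; rewrite /profile /lift.
have -> : enorm (r *: \row_(j < n) ((j : nat) == 0%N)%:R) = `|r|.
  rewrite /enorm (bigD1 (Ordinal n0))//= big1 => [|j /negPf jn0].
    by rewrite !mxE eqxx mulr1 addr0 sqrtr_sqr.
  by rewrite !mxE -[_ == 0%N]/(j == Ordinal n0) jn0 mulr0 expr0n.
by case: (leP 0 r) => r0; [rewrite ger0_norm|rewrite ltr0_norm// ef].
Qed.

End RadialFunctions.

(** * The theorem *)

Section Profiles.
Context {R : realType}.
Implicit Types (r s t : R).

Lemma unear_gt0 (u : R) : unear u -> 0 < u.
Proof. by move=> /andP[h _]; lra. Qed.

(** [|ln u| <= 1] on the interval, by [ln (1 + x) <= x] applied at [u] and at [1 / u]. *)
Lemma powR_near (u a : R) : unear u -> expR (- `|a|) <= u `^ a <= expR `|a|.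
Proof.
move=> uu; have u0 := unear_gt0 uu; move: uu => /andP[u1 u2].
have l1 : ln u <= 1.
  have := @le_ln1Dx R (u - 1); have -> : 1 + (u - 1) = u by ring.
  by move=> /(_ _)/wrap[]; lra.
have iu : u^-1 <= 2 by rewrite invf_ple ?posrE//; lra.
have iu0 : 0 < u^-1 by rewrite invr_gt0.
have l2 : - 1 <= ln u.
  have := @le_ln1Dx R (u^-1 - 1); have -> : 1 + (u^-1 - 1) = u^-1 by ring.
  by rewrite lnV// => /(_ _)/wrap[]; lra.
have al : `|a * ln u| <= `|a| by rewrite normrM ler_piMr// ler_norml l2.
rewrite /powR gt_eqF//; move: al; rewrite ler_norml => /andP[h1 h2].
by apply/andP; split; rewrite ler_expR.
Qed.

Lemma powRD_gt0 (x a e : R) : 0 < x -> x `^ (a + e) = x `^ a * x `^ e.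
Proof. by move=> x0; rewrite powRD// (gt_eqF x0) implybT. Qed.

Lemma powR_near_norm (u a : R) : unear u -> `|u `^ a| <= expR `|a|.
Proof. by move=> /(powR_near a)/andP[_ h]; rewrite ger0_norm// powR_ge0. Qed.

(** Bootstrap: averaging preserves the class, and since [u'] and [w'] are [r] times averages of [w]
    and of the source, class [j] for these gives class [j + 1] for [u] and [w], hence for the
    source. *)
Lemma radial_smooth k (q b : R -> R) (u w : R -> R) (cq aq cb ab : R) :
  (forall x, q x = cq * x `^ aq) -> (forall x, b x = cb * x `^ ab) ->
  (forall r, 0 < u r) -> evenc u -> evenc w ->
  (forall r, der u r (r * avg k w r)) ->
  (forall r, der w r (- (r * avg k (fun r => q (u r) * w r + b (u r) * (r * avg k w r) ^+ 2) r))) ->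
  forall j, [/\ evenC j u, evenC j w &
    evenC j (fun r => q (u r) * w r + b (u r) * (r * avg k w r) ^+ 2)].
Proof.
move=> qE bE u0 eu ew Du Dw.
have HS j : evenC j u -> evenC j w ->
    evenC j (fun r => q (u r) * w r + b (u r) * (r * avg k w r) ^+ 2).
  move=> ju jw.
  have -> : (fun r => q (u r) * w r + b (u r) * (r * avg k w r) ^+ 2) =
     (fun r => cq * u r `^ aq * w r + cb * u r `^ ab * (r ^+ 2 * (avg k w r * avg k w r))).
    by apply/funext => r; rewrite qE bE; ring.
  have ja : evenC j (avg k w) by exact: evenC_avg.
  apply: evenCD; apply: evenCM.
  - by apply: evenCM; [exact: evenC_cst|exact: evenC_powR].
  - by [].
  - by apply: evenCM; [exact: evenC_cst|exact: evenC_powR].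
  - by apply: evenCM; [exact: evenC_sqr|exact: evenCM].
elim=> [|j [ju jw jS]]; first by split; [by split|by split|apply: HS; split].
have ju' : evenC j.+1 u by split => //; exists (avg k w); split=> //; exact: evenC_avg.
have jw' : evenC j.+1 w.
  split => //; exists (fun r => - avg k (fun r => q (u r) * w r + b (u r) * (r * avg k w r) ^+ 2) r).
  split; first by apply: evenCN; exact: evenC_avg.
  by move=> r; apply: (derE (Dw r)); rewrite mulrN.
by split => //; exact: HS.
Qed.

Lemma not_bubble n (u : 'rV[R]_n -> R) : (5 <= n)%N -> (forall x, 1/2 <= u x) ->
  ~ standard_bubble u.
Proof.
move=> n5 u2 [xi [lam [lam0 uE]]].
have n0 : (0 < n)%N by rewrite (leq_trans _ n5).
pose e0 : 'rV[R]_n := delta_mx 0 (Ordinal n0).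
(* At this distance from the centre the base of the bubble is at most 1/16; its exponent is at least
   1/2, so the value is at most 1/4. *)
pose t : R := 1 + 32 * lam.
have := u2 (xi + t *: e0); rewrite uE /bubble addrAC subrr add0r.
have -> : enorm (t *: e0) ^+ 2 = t ^+ 2.
  rewrite enorm_sq (bigD1 (Ordinal n0))//= big1 => [|j /negPf jn0].
    by rewrite !mxE !eqxx mulr1 addr0.
  by rewrite !mxE jn0 mulr0 expr0n.
have t2 : 32 * lam <= t ^+ 2 by rewrite /t; nra.
have l2 : 0 <= lam ^+ 2 := sqr_ge0 _.
have B0 : 0 < 2 * lam / (lam ^+ 2 + t ^+ 2) by rewrite divr_gt0//; lra.
have B16 : 2 * lam / (lam ^+ 2 + t ^+ 2) <= (1/4) ^+ 2.
  by rewrite ler_pdivrMr; lra.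
set B := 2 * lam / _ in B0 B16 *.
have n5R : 5 <= n%:R :> R by rewrite ler_nat.
have : B `^ ((n%:R - 4) / 2) <= B `^ 2^-1.
  apply: ger_powR; first by rewrite B0; lra.
  lra.
rewrite powR12_sqrt; last exact: ltW.
have : Num.sqrt B <= 1/4.
  rewrite -[leRHS]ger0_norm ?divr_ge0// -sqrtr_sqr ler_sqrt//.
lra.
Qed.

Lemma powR_sqrt_pow k r : 0 < r -> r `^ (- (k%:R / 2)) = (Num.sqrt (r ^+ k))^-1.
Proof.
move=> r0; rewrite powRN; congr (_^-1).
by rewrite powRrM powR_mulrn ?(ltW r0)// powR12_sqrt// exprn_ge0// ltW.
Qed.

End Profiles.

Theorem theorem1p3 (R : realType) (n : nat) (hn : (5 <= n)%N) :
  let p := pexp R n in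
  let c := cconst R n in
  exists eps : R, 0 < eps /\
  forall s : R, 0 < `|s| < eps ->
  exists u : 'rV[R]_n -> R,
  [/\ [/\ smooth u, radial u, (forall x, 0 < u x)
        & forall x, laplacian (laplacian u) x =
            c * u x `^ (p - 1) * - laplacian (fun y => u y `^ p) x],
      [/\ profile u 0 = 1, derive1 (profile u) 0 = 0
        & derive1n 2 (profile u) 0 = - s],
      (exists l : R, [/\ 0 < l,
        profile u r @[r --> +oo] --> l
        & forall k : R, 0 < k -> k ^+ 2 = c * p * l `^ (2 * (p - 1)) ->
          exists A B : R, ~ (A = 0 /\ B = 0) /\
          exists L : R -> R,
            (exists C : R,
               \forall r \near +oo, `|L r - l| <= C * r `^ (3 - n%:R)) /\
            exists h : R -> R, h r @[r --> +oo] --> (0 : R) /\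
              \forall r \near +oo, profile u r = L r +
                r `^ (- ((n%:R - 1) / 2)) *
                  (A * cos (k * r) + B * sin (k * r) + h r)]),
      infinitely_many_sign_changes (profile (fun x => - laplacian u x)) /\
      infinitely_many_sign_changes
        (profile (fun x => - laplacian (fun y => u y `^ p) x))
      & ~ standard_bubble u /\ ~ weakly_superharmonic u].
Proof.
case: n hn => [//|k]; rewrite ltnS => k4 p c.
have k4R : 4 <= k%:R :> R by rewrite ler_nat.
have nE : k.+1%:R = k%:R + 1 :> R by rewrite natr1.
have n4 : 1 <= k.+1%:R - 4 :> R by rewrite nE; lra.
have p1 : p - 1 = 2 / (k.+1%:R - 4) by rewrite /p /pexp; field; rewrite gt_eqF//; lra.
have p10 : 0 < p - 1 by rewrite p1 divr_gt0//; lra.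
have p0 : 0 < p by lra.
have c0 : 0 < c by rewrite /c /cconst !divr_gt0// mulr_gt0//; lra.
have cp0 : 0 < c * p by rewrite mulr_gt0.
(* The coefficients come from expanding the Laplacian of [u ^ p] by the chain rule and multiplying
   by [c * u ^ (p - 1)]. *)
pose q (x : R) := c * p * x `^ (2 * (p - 1)).
pose dq (x : R) := c * p * (2 * (p - 1)) * x `^ (2 * (p - 1) - 1).
pose b (x : R) := c * p * (p - 1) * x `^ (2 * p - 3).
pose db (x : R) := c * p * (p - 1) * (2 * p - 3) * x `^ (2 * p - 3 - 1).
pose E (a : R) := expR `|a|.
pose q0 := c * p * expR (- `|2 * (p - 1)|).
pose K := 1 + c * p * E (2 * (p - 1)) + `|c * p * (2 * (p - 1))| * E (2 * (p - 1) - 1) +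
  `|c * p * (p - 1)| * E (2 * p - 3) + `|c * p * (p - 1) * (2 * p - 3)| * E (2 * p - 3 - 1).
have E0 a : 0 <= E a by exact: expR_ge0.
have k1 : 0 <= c * p * E (2 * (p - 1)) by rewrite mulr_ge0// ltW.
have k2 : 0 <= `|c * p * (2 * (p - 1))| * E (2 * (p - 1) - 1) by rewrite mulr_ge0.
have k3 : 0 <= `|c * p * (p - 1)| * E (2 * p - 3) by rewrite mulr_ge0.
have k5 : 0 <= `|c * p * (p - 1) * (2 * p - 3)| * E (2 * p - 3 - 1) by rewrite mulr_ge0.
have K1 : 1 <= K by rewrite /K; lra.
have q00 : 0 < q0 by rewrite mulr_gt0// expR_gt0.
have q_bd x : unear x -> q0 <= q x <= K.
  move=> ux; have /andP[h1 h2] := powR_near (2 * (p - 1)) ux.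
  rewrite /q0 /q ler_pM2l// h1 /=; apply: le_trans (_ : c * p * E (2 * (p - 1)) <= _).
    by rewrite ler_pM2l.
  by rewrite /K; lra.
have cE (d a x : R) : unear x -> `|d * x `^ a| <= `|d| * E a.
  by move=> ux; rewrite normrM ler_wpM2l// powR_near_norm.
have b_bd x : unear x -> `|b x| <= K.
  by move=> /(cE _ _ _)/le_trans; apply; rewrite /K; lra.
have dq_bd x : unear x -> `|dq x| <= K.
  by move=> /(cE _ _ _)/le_trans; apply; rewrite /K; lra.
have db_bd x : unear x -> `|db x| <= K.
  by move=> /(cE _ _ _)/le_trans; apply; rewrite /K; lra.
have pow_der (d a x : R) : unear x -> der (fun x => d * x `^ a) x (d * a * x `^ (a - 1)).
  move=> /unear_gt0 x0; apply: (derE (derM (der_cst d x) (is_derive1_powR a x0 : der _ _ _))).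
  by rewrite mul0r add0r mulrA.
have q_der x : unear x -> der q x (dq x) by exact: pow_der.
have b_der x : unear x -> der b x (db x) by exact: pow_der.
have [eps eps0 Heps] := small_solution k4 q00 K1 q_bd b_bd q_der b_der dq_bd db_bd.
exists eps; split => // s /Heps[u [w]] /=.
set S := fun r => q (u r) * w r + _.
move=> [[eu ew eS] [u0 w0 un] [Du Dw] [Dv Dwd] [C [d [d0 Hest]]]].
have up r : 0 < u r by exact: unear_gt0.
have Csm := radial_smooth (fun=> erefl) (fun=> erefl) up eu ew Du Dw.
(* The Laplacian of [w] is computed by recovering [S] from its average, and this takes one radial
   derivative [r * hS] of [S]. *)
have [_ _ [_ [hS [hS0 DS]]]] := Csm 1%N.
have {hS0} ehS := hS0.1.
pose hw r := - avg k S r.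
have ehw : evenc hw.
  by have [ca ea] := evenc_avg k eS; split; [exact: contN|move=> x; rewrite /hw ea].
have Dw' r : der w r (r * hw r) by apply: (derE (Dw r)); rewrite mulrN.
have efw := evenc_avg k ew.
have ehh := evenc_avg k.+2 ehw.
have lap1 : laplacian (lift u : 'rV[R]_k.+1 -> R) = lift w.
  rewrite (laplacian_lift eu efw Du (fun r => der_avg_even k r ew ehw Dw')).
  by congr lift; apply/funext => r; rewrite -avg_recurrence.
have lap2 : laplacian (lift w : 'rV[R]_k.+1 -> R) = lift (fun r => - S r).
  have Dhw r : der hw r (r * - avg k.+2 hS r).
    by rewrite mulrN; apply: derN; exact: der_avg_even.
  rewrite (laplacian_lift ew ehw Dw' Dhw).
  by congr lift; apply/funext => r; rewrite (avg_recurrence k r eS ehS DS) /hw; ring.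
pose LP r := p * u r `^ (p - 1) * w r + p * (p - 1) * u r `^ (p - 2) * (r * avg k w r) ^+ 2.
have lap3 : laplacian (lift (fun r => u r `^ p) : 'rV[R]_k.+1 -> R) = lift LP.
  pose g r := p * u r `^ (p - 1) * avg k w r.
  pose h r := p * (p - 1) * u r `^ (p - 2) * avg k w r ^+ 2 + p * u r `^ (p - 1) * avg k.+2 hw r.
  have eup : evenC 1 (fun r => u r `^ p) by apply: evenC_powR => //; case: (Csm 1%N).
  have Dg r : der (fun r => u r `^ p) r (r * g r).
    by apply: (derE (der_powR p (up r) (Du r))); rewrite /g; ring.
  have Dh r : der g r (r * h r).
    apply: (derE (derM (derM (der_cst p r) (der_powR (p - 1) (up r) (Du r)))
      (der_avg_even k r ew ehw Dw'))).
    by rewrite /h (_ : p - 1 - 1 = p - 2); ring.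
  have eg : evenc g.
    have eup1 : evenC 0 (fun r => u r `^ (p - 1)) by apply: evenC_powR => //; case: (Csm 0%N).
    by apply: evencM => //; apply: (evencM (evenC_evenc (evenC_cst 0 p)) eup1.1).
  rewrite (laplacian_lift eup.1 eg Dg Dh).
  congr lift; apply/funext => r; rewrite /LP [in RHS](avg_recurrence k r ew ehw Dw') /g /h.
  by ring.
have pu : profile (lift u : 'rV[R]_k.+1 -> R) = u by apply: profile_lift => //; exact: eu.2.
have v_bd r : 1 <= r -> r ^+ k * (r * avg k w r) ^+ 2 <= C by move=> /Hest[].
have en_bd r : 1 <= r -> d <= r ^+ k * ((- (r * avg k S r) + k%:R / 2 * w r / r) ^+ 2 +
    q (u r) * w r ^+ 2) <= C by move=> /Hest[].
have fl_bd r : 1 <= r -> `|r ^+ k * (r * avg k w r) +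
    r ^+ k * - (r * avg k S r) / q (u r)| <= C * r by move=> /Hest[].
have [l [ul [Cu Hu] [Cl Hl]]] :=
  limit_at_infinity k4 q00 q_bd b_bd q_der dq_bd un Du Dw d0 v_bd en_bd fl_bd.
have l0 := unear_gt0 ul.
have osc kap : 0 < kap -> kap ^+ 2 = q l -> exists A B Ch : R, ~ (A = 0 /\ B = 0) /\
    forall r, 1 <= r ->
      `|Num.sqrt (r ^+ k) * w r - (A * cos (kap * r) + B * sin (kap * r))| <= Ch / r.
  move=> kap0 kapq.
  exact: (oscillation k4 q00 q_bd b_bd q_der dq_bd un Dw Dwd d0 v_bd en_bd ul kap0 kapq Hu).
have pw0 (r : R) : 1 <= r -> 0 < Num.sqrt (r ^+ k) by move=> r1; rewrite sqrtr_gt0 exprn_gt0//; lra.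
have signs : infinitely_many_sign_changes (fun r => - w r) /\
    infinitely_many_sign_changes (fun r => - LP r).
  have ql0 : 0 < q l by have /andP[h _] := q_bd l ul; apply: lt_le_trans h.
  pose kap := Num.sqrt (q l).
  have kap0 : 0 < kap by rewrite sqrtr_gt0.
  have kapq : kap ^+ 2 = q l by rewrite sqr_sqrtr// ltW.
  have [A [B [Ch [nAB Hosc]]]] := osc kap kap0 kapq.
  have nAB' : ~ (- A = 0 /\ - B = 0).
    by move=> [/eqP + /eqP]; rewrite !oppr_eq0 => /eqP ? /eqP ?; apply: nAB.
  split.
    apply: (oscillation_sign_changes (C := Ch) kap0 nAB' pw0) => r r1.
    rewrite -normrN; apply: le_trans (Hosc r r1); rewrite le_eqVlt; apply/orP; left.
    by apply/eqP; congr `|_|; ring.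
  (* Dividing by [p * u ^ (p - 1)] turns the leading term of [LP] into [w]. What is left is
     [(p - 1) / u * u' ^ 2], and the factor 2 in the constant below bounds [1 / u]. *)
  pose rho r := Num.sqrt (r ^+ k) / (p * u r `^ (p - 1)).
  have up0 r : 0 < u r `^ (p - 1) by rewrite powR_gt0.
  have rho0 r : 1 <= r -> 0 < rho r.
    by move=> r1; rewrite divr_gt0 ?pw0// mulr_gt0.
  apply: (oscillation_sign_changes (C := Ch + (p - 1) * 2 * ((1 + C) * (1 + C)))
    kap0 nAB' rho0) => r r1.
  have e2 : u r `^ (p - 2) = u r `^ (p - 1) / u r.
    rewrite (_ : p - 2 = (p - 1) - 1); last by ring.
    have := powRD_gt0 (p - 1 - 1) 1 (up r); rewrite subrK (powRr1 (ltW (up r))) => ->.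
    by rewrite mulfK// gt_eqF.
  have -> : rho r * - LP r - (- A * cos (kap * r) + - B * sin (kap * r)) =
    - (Num.sqrt (r ^+ k) * w r - (A * cos (kap * r) + B * sin (kap * r)))
    - (p - 1) * (u r)^-1 * (Num.sqrt (r ^+ k) * (r * avg k w r) ^+ 2).
    rewrite /rho /LP e2; field; rewrite !gt_eqF//.
  apply: le_trans (ler_normB _ _) _; rewrite normrN [leRHS]mulrDl; apply: lerD; first exact: Hosc.
  have vs := velocity_sq_le k4 d0 v_bd en_bd r1.
  rewrite normrM -[leRHS]mulrA; apply: ler_pM => //.
  rewrite normrM gtr0_norm//; apply: ler_pM => //; first exact: ltW.
  rewrite gtr0_norm ?invr_gt0//; have /andP[h _] := un r.
  by rewrite invf_ple ?posrE//; lra.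
have prof1 : profile (fun x : 'rV[R]_k.+1 => - laplacian (lift u) x) = fun r => - w r.
  by rewrite lap1; apply: (@profile_lift _ k.+1 (fun r => - w r)) => // r; rewrite ew.2.
have eLP r : LP (- r) = LP r.
  by rewrite /LP eu.2 ew.2 efw.2 mulNr sqrrN.
have prof2 : profile (fun x : 'rV[R]_k.+1 => - laplacian (fun y => lift u y `^ p) x) =
    fun r => - LP r.
  rewrite [laplacian _]lap3.
  by apply: (@profile_lift _ k.+1 (fun r => - LP r)) => // r; rewrite eLP.
exists (lift u); split.
- split.
  + by move=> j; apply: Cclass_lift; case: (Csm j).
  + by exists u.
  + by move=> x; exact: up.
  + move=> x; rewrite lap1 lap2 [laplacian (fun y => _)]lap3 /lift.
    set r := enorm x; rewrite /S /LP /q /b.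
    have e1 : u r `^ (2 * (p - 1)) = u r `^ (p - 1) * u r `^ (p - 1).
      by rewrite -powRD_gt0//; congr (_ `^ _); ring.
    have e2 : u r `^ (2 * p - 3) = u r `^ (p - 1) * u r `^ (p - 2).
      by rewrite -powRD_gt0//; congr (_ `^ _); ring.
    by rewrite e1 e2; ring.
- have D1 : derive1 u = fun r => r * avg k w r.
    by apply/funext => r; exact: der_derive1.
  rewrite pu; split=> //; first by rewrite D1 mul0r.
  (* [u''(0)] is the value at 0 of the average, namely [w 0 / n]; this is why [w 0] was prescribed
     as [- n s]. *)
  rewrite D1; apply: der_derive1.
  have ca : {for 0, continuous (avg k w)} by have := efw.1; apply.
  apply: (derE (der_mul_id0 ca)); rewrite /avg eqxx w0.
  by rewrite mulNr mulrAC divff ?mul1r// pnatr_eq0.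
- exists l; split => //.
    rewrite pu; apply: (@cvg_of_le_invr _ _ _ Cu) => r r1; apply: le_trans (Hu r r1) _.
    have Cu0 : 0 <= Cu by have := le_trans (normr_ge0 _) (Hu 1 (lexx _)); rewrite expr1n divr1.
    have r0 : 0 < r by lra.
    rewrite ler_wpM2l// lef_pV2 ?posrE ?exprn_gt0//.
    by rewrite -[leLHS]expr1 ler_weXn2l.
  move=> kap kap0 kapq; have [A [B [Ch [nAB Hosc]]]] := osc kap kap0 kapq.
  have [Ch' Hprof] := profile_expansion q00 q_bd b_bd q_der dq_bd un d0 en_bd ul kap0 kapq Hu Hosc.
  have nk2 : kap ^+ 2 != 0 by rewrite expf_neq0// gt_eqF.
  exists (- A / kap ^+ 2), (- B / kap ^+ 2); split.
    move=> [/eqP + /eqP]; rewrite !mulf_eq0 !oppr_eq0 !invr_eq0 (negPf nk2) !orbF.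
    by move=> /eqP ? /eqP ?; apply: nAB.
  exists (fun r => u r + w r / q (u r)); split.
    exists Cl; near=> r.
    have r1 : 1 <= r by near: r; apply: nbhs_pinfty_ge; rewrite num_real.
    have e3 : 3 - k.+1%:R = - k.-2%:R :> R.
      by rewrite -subn2 natrB ?(leq_trans _ k4)// nE; ring.
    by apply: le_trans (Hl r r1) _; rewrite e3 powRN powR_mulrn//; lra.
  (* The remainder is defined by solving the expansion for it, so the identity is algebraic and the
     content lies in the limit 0. *)
  exists (fun r => Num.sqrt (r ^+ k) * (u r - (u r + w r / q (u r)))
      - (- A / kap ^+ 2 * cos (kap * r) + - B / kap ^+ 2 * sin (kap * r))); split.
    by apply: (@cvg_of_le_invr _ _ _ Ch') => r r1; rewrite subr0; exact: Hprof.
  near=> r.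
  have r1 : 1 <= r by near: r; apply: nbhs_pinfty_ge; rewrite num_real.
  have r0 : 0 < r by lra.
  rewrite pu (_ : - ((k.+1%:R - 1) / 2) = - (k%:R / 2)); last by rewrite nE; ring.
  rewrite powR_sqrt_pow// addrC [X in _ = X + _]/=.
  have nq : q (u r) != 0 by rewrite gt_eqF//; have /andP[h _] := q_bd _ (un r); apply: lt_le_trans h.
  by field; rewrite ?nq ?nk2 ?gt_eqF ?pw0.
- split; [exact: (eq_ind_r _ signs.1 prof1)|exact: (eq_ind_r _ signs.2 prof2)].
- split; first by apply: not_bubble => // x; case/andP: (un (enorm x)).
  (* A single alternation suffices: two values of [- w] with negative product cannot both be
     nonnegative. *)
  move=> sup; have [r [_ /(_ 0%N isT)[_]]] := signs.1 1%N.
  have pos t : 0 <= - w t.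
    by have := sup (t *: \row_(j < k.+1) ((j : nat) == 0%N)%:R); rewrite -[- w t]/((fun r => - w r) t) -prof1.
  by rewrite ltNge mulr_ge0.
Unshelve. all: by end_near. Qed.
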